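(* Let $\epsilon\in(0,\infty)$, $\alpha\in[0,1)$, $\beta\in(\alpha^2,1)$, $p\in[2,\infty)$, and let $(\gamma_n)_{n\in\mathbb N}\subseteq(0,\infty)$ be a non-summable decreasing sequence converging to zero which satisfies $\sup_{\varepsilon\in(0,\infty)}\liminf_{n\to\infty}\bigl((\gamma_n)^{-1}\gamma_{n+\lceil(\gamma_n)^{-1}\varepsilon\rceil}\bigr)>0$ and $\sum_{n=1}^\infty(\gamma_n)^{1+p/3}<\infty$. Let $(t_n)_{n\in\mathbb N_0}$ be the associated training times, let $d\in\mathbb N$, $\vartheta\in\mathbb R^d$, let $(X,U)$ be a locally $p$-regular innovation, and let $(\theta_n)_{n\in\mathbb N_0}$ be the Adam algorithm with innovation $(X,U)$, step-sizes $(\gamma_n)_{n\in\mathbb N}$ and damping parameters $(\alpha,\beta,\epsilon)$ started in $\vartheta$. Let $(\Psi_t)_{t\in[0,\infty)}$ be the semiflow of the corresponding Adam vector field $f$. Let $(\bar\theta_t)_{t\in[0,\infty)}$ be the process with $\bar\theta_{t_n}=\theta_n$ for all $n\in\mathbb N_0$ which on each interval $[t_{n-1},t_n]$, $n\in\mathbb N$, is the linear interpolation between its two boundary values. Then, almost surely on the event $$\mathbb B=\Bigl\{\limsup_{n\to\infty}|\theta_n|<\infty\Bigr\},$$ $(\bar\theta_t)_{t\in[0,\infty)}$ is an asymptotic pseudo-trajectory of the semiflow $(\Psi_t)_{t\in[0,\infty)}$.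
   Context: Innovation: a pair $(X,U)$ where $U$ is a random variable on a probability space $(\Omega,\mathcal F,\mathbb P)$ with values in a measurable space $\mathcal U$ and $X:\mathcal U\times\mathbb R^d\to\mathbb R^d$ is product measurable. $X^{(j)}$ is the $j$-th component. For $p\in[2,\infty)$, $(X,U)$ is locally $p$-regular if there is a continuous $c:\mathbb R\to\mathbb R$ such that for all $\theta,\vartheta\in\mathbb R^d$: $\mathbb E[|X(U,\theta)|^p]\le c(0)(1+e^{c(0)|\theta|})$ and $\mathbb E[|X(U,\theta)-X(U,\vartheta)|^p]\le c(|\theta|+|\vartheta|)\,|\theta-\vartheta|^p$. Adam algorithm with innovation $(X,U)$, step-sizes $(\gamma_n)_{n\in\mathbb N}$, damping parameters $(\alpha,\beta,\epsilon)$, started in $\vartheta$: a process $(\theta_n)_{n\in\mathbb N_0}$ in $\mathbb R^d$ for which there are i.i.d. copies $U_1,U_2,\dots$ of $U$ such that $\theta_0=\vartheta$, $m_0=v_0=0\in\mathbb R^d$, and for all $n\in\mathbb N$, $j\in\{1,\dots,d\}$: $$m_n=\alpha m_{n-1}+(1-\alpha)X(U_n,\theta_{n-1}),\quad v_n^{(j)}=\beta v_{n-1}^{(j)}+(1-\beta)(X^{(j)}(U_n,\theta_{n-1}))^2,$$ $$\sigma_n^{(j)}=\bigl(\sqrt{v_n^{(j)}/(1-\beta^n)}+\epsilon\bigr)^{-1},\quad \theta_n^{(j)}=\theta_{n-1}^{(j)}+\gamma_n\sigma_n^{(j)}m_n^{(j)}.$$ Adam vector field $f=(f^{(1)},\dots,f^{(d)}):\mathbb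 R^d\to\mathbb R^d$ of $(X,U)$ with damping parameters $(\alpha,\beta,\epsilon)$: with $(U_k)_{k\in\mathbb Z,k\le0}$ i.i.d. copies of $U$ (and $0^0=1$), $$f^{(j)}(\theta)=(1-\alpha)\,\mathbb E\Bigl[\Bigl(\Bigl[(1-\beta)\sum_{k=-\infty}^0\beta^{-k}|X^{(j)}(U_k,\theta)|^2\Bigr]^{1/2}+\epsilon\Bigr)^{-1}\sum_{k=-\infty}^0\alpha^{-k}X^{(j)}(U_k,\theta)\Bigr].$$ Semiflow: $\Psi_t:\mathbb R^d\to\mathbb R^d$, $t\in[0,\infty)$, solves $\dot\Psi_t(\theta)=f(\Psi_t(\theta))$, $\Psi_0(\theta)=\theta$ (for locally $p$-regular innovations and $\alpha<\sqrt\beta$ the field $f$ is bounded and locally Lipschitz, so the solution exists uniquely for all $t\ge0$). Training times: $t_n=\sum_{i=1}^n\gamma_i$, $n\in\mathbb N_0$. Asymptotic pseudo-trajectory: a curve $(y(t))_{t\in[0,\infty)}$ in $\mathbb R^d$ is an asymptotic pseudo-trajectory of $(\Psi_t)$ if for all $T\in(0,\infty)$, $\lim_{t\to\infty}\sup_{0\le h\le T}|y(t+h)-\Psi_h(y(t))|=0$. *)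

(* Defs.v *)
From HB Require Import structures.
From mathcomp Require Export all_boot all_order all_algebra finmap.
From mathcomp Require Export all_classical all_reals all_analysis.
Export Order.TTheory GRing.Theory Num.Theory.
Export numFieldNormedType.Exports.

Set Implicit Arguments.
Unset Strict Implicit.
Unset Printing Implicit Defensive.

Local Open Scope classical_set_scope.
Local Open Scope ring_scope.

(* The library norm on matrices is the sup norm. *)
Definition eucl_norm (R : realType) (d : nat) (x : 'rV[R]_d) : R :=
  Num.sqrt (\sum_(j < d) x 0 j ^+ 2).

(* R^d with its Borel sigma-algebra *)
Definition borel_rV (R : realType) (d : nat) :=
  g_sigma_algebraType (@open 'rV[R]_d).

Definition product_measurable (R : realType) (dU : measure_display)
    (UU : measurableType dU) (d : nat) (X : UU -> 'rV[R]_d -> 'rV[R]_d) :=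
  measurable_fun setT
    (fun x : UU * borel_rV R d => X x.1 x.2 : borel_rV R d).

Definition mutually_independent (R : realType)
    (dO : measure_display) (Omega : measurableType dO) (P : probability Omega R)
    (dU : measure_display) (UU : measurableType dU)
    (V : nat -> {RV P >-> UU}) :=
  forall (J : {fset nat}) (A : nat -> set UU), (forall j, measurable (A j)) ->
    (P (\bigcap_(j in [set` J]) (V j @^-1` A j)) =
     \prod_(j <- J) P (V j @^-1` A j))%E.

(* Laws are compared on measurable sets only, since [distribution] is
   unspecified elsewhere. *)
Definition iid_copies (R : realType)
    (dO : measure_display) (Omega : measurableType dO) (P : probability Omega R)
    (dU : measure_display) (UU : measurableType dU) (U : {RV P >-> UU})
    (dO' : measure_display) (Omega' : measurableType dO')
    (P' : probability Omega' R) (V : nat -> {RV P' >-> UU}) :=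
  mutually_independent V /\
  forall k (A : set UU), measurable A ->
    distribution P' (V k) A = distribution P U A.

Definition locally_regular (R : realType)
    (dO : measure_display) (Omega : measurableType dO) (P : probability Omega R)
    (dU : measure_display) (UU : measurableType dU) (U : {RV P >-> UU})
    (d : nat) (X : UU -> 'rV[R]_d -> 'rV[R]_d) (p : R) :=
  exists2 c : R -> R, continuous c &
    forall theta vartheta : 'rV[R]_d,
      ('E_P[fun w => (eucl_norm (X (U w) theta) `^ p)%R]
         <= (c 0 * (1 + expR (c 0 * eucl_norm theta)))%:E)%E /\
      ('E_P[fun w =>
             (eucl_norm (X (U w) theta - X (U w) vartheta) `^ p)%R]
         <= (c (eucl_norm theta + eucl_norm vartheta)
             * eucl_norm (theta - vartheta) `^ p)%:E)%E.

(* [gamma n] and [V n] are only relevant for 1 <= n. *)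
Definition adam_process (R : realType)
    (dO : measure_display) (Omega : measurableType dO) (P : probability Omega R)
    (dU : measure_display) (UU : measurableType dU) (U : {RV P >-> UU})
    (d : nat) (X : UU -> 'rV[R]_d -> 'rV[R]_d)
    (gamma : nat -> R) (alpha beta eps : R) (vartheta : 'rV[R]_d)
    (dO' : measure_display) (Omega' : measurableType dO')
    (P' : probability Omega' R) (theta : nat -> Omega' -> 'rV[R]_d) :=
  exists (V : nat -> {RV P' >-> UU}) (m v : nat -> Omega' -> 'rV[R]_d),
    iid_copies U (fun n => V n.+1) /\
    forall w : Omega',
      [/\ theta 0%N w = vartheta, m 0%N w = 0, v 0%N w = 0 &
          forall n (j : 'I_d),
          let x := X (V n.+1 w) (theta n w) in
          let sigma :=
            (Num.sqrt (v n.+1 w 0 j / (1 - beta ^+ n.+1)) + eps)^-1 in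
          [/\ m n.+1 w 0 j = alpha * m n w 0 j + (1 - alpha) * x 0 j,
              v n.+1 w 0 j = beta * v n w 0 j + (1 - beta) * x 0 j ^+ 2 &
              theta n.+1 w 0 j =
                theta n w 0 j + gamma n.+1 * sigma * m n.+1 w 0 j]].

(* [V k] plays the role of U_{-k}. Under local regularity with p >= 2 and
   alpha ^+ 2 < beta < 1, both series converge almost surely, so the default
   value of [limn] at divergent series is immaterial, and the expectation is
   finite. *)
Definition adam_vector_field (R : realType)
    (dO : measure_display) (Omega : measurableType dO) (P : probability Omega R)
    (dU : measure_display) (UU : measurableType dU) (U : {RV P >-> UU})
    (d : nat) (X : UU -> 'rV[R]_d -> 'rV[R]_d)
    (alpha beta eps : R) (f : 'rV[R]_d -> 'rV[R]_d) :=
  exists (dO' : measure_display) (Omega' : measurableType dO')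
         (P' : probability Omega' R) (V : nat -> {RV P' >-> UU}),
    iid_copies U V /\
    forall theta (j : 'I_d),
      f theta 0 j = (1 - alpha) * fine ('E_P'[fun w =>
        ((Num.sqrt ((1 - beta) *
           limn (series (fun k => beta ^+ k * `|X (V k w) theta 0 j| ^+ 2)))
         + eps)^-1
        * limn (series (fun k => alpha ^+ k * X (V k w) theta 0 j)))%R])%E.

(* The difference quotient is taken over h <> 0 with 0 <= t + h: a two-sided
   derivative at t > 0 and a right derivative at t = 0. *)
Definition semiflow_of (R : realType) (d : nat)
    (f : 'rV[R]_d -> 'rV[R]_d) (Psi : R -> 'rV[R]_d -> 'rV[R]_d) :=
  forall theta : 'rV[R]_d,
    Psi 0 theta = theta /\
    forall t : R, 0 <= t ->
      h^-1 *: (Psi (t + h) theta - Psi t theta)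
        @[h --> within [set h | 0 <= t + h] (0 : R)^'] --> f (Psi t theta).

Definition training_time (R : realType) (gamma : nat -> R) (n : nat) : R :=
  \sum_(1 <= i < n.+1) gamma i.

Definition linear_interpolation (R : realType) (d : nat)
    (t : nat -> R) (x : nat -> 'rV[R]_d) (y : R -> 'rV[R]_d) :=
  (forall n, y (t n) = x n) /\
  forall n (s : R), t n <= s <= t n.+1 ->
    y s = x n + ((s - t n) / (t n.+1 - t n)) *: (x n.+1 - x n).

Definition asymptotic_pseudotrajectory (R : realType) (d : nat)
    (Psi : R -> 'rV[R]_d -> 'rV[R]_d) (y : R -> 'rV[R]_d) :=
  forall T : R, 0 < T ->
    ereal_sup [set (eucl_norm (y (t + h) - Psi h (y t)))%:E | h in `[0, T]]
      @[t --> +oo] --> 0%E.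

(* Main.v *)
From mathcomp Require Import measurable_realfun ring lra zify.
Require Import Defs.

(** Write [g] for the Adam direction at a time, that is, for the discounted mean
    of the gradients divided by the discounted root mean square plus [eps].
    Cauchy-Schwarz with [alpha ^ 2 < beta] bounds [g] by a constant and makes it
    Lipschitz in the discounted l2 norm of the gradients (momentum_le,
    wdir_lip).  An increment of Adam is [gamma g] up to the bias correction,
    which is exponentially small (adam_increment).  So the theorem is about a
    stochastic approximation with a bounded but history-dependent direction,
    and what has to be shown is that the drift errors
    [theta_(k+1) - theta_k - gamma_(k+1) f(theta_k)], summed over stretches of
    bounded time, tend to zero.

    Localisation.  On the event that [theta] stays in the ball of radius [N],
    the innovation may be evaluated at clipped parameters.  The clipped
    innovation has p-th moments and L^p Lipschitz constants that do not depend
    on the parameter (clipped_moments).  Countably many [N] exhaust the event.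

    Averaging.  Time is cut into windows of a fixed length [delta]; let [q] be
    the step size at the beginning of a window.  In the next window the
    direction is replaced by the one that is built from the last
    [L = q ^ (-1/3)] samples with the parameter frozen before them.  The
    parameter moves by at most [O(q ^ (2/3))] during [L] steps and the older
    samples carry the weight [beta ^ L], so the error has discounted p-th
    moments [O(q ^ (p/3))] (expected_history_err).  The frozen direction minus
    its conditional mean depends on a block of [L] samples that is independent
    of the frozen parameter; along one residue class modulo [L] these
    differences are bounded martingale increments, whose exponential moments at
    the scale [q ^ (-1/2)] are bounded (class_sum_exp).  All this is gathered in
    one nonnegative variable per window with expectation [O(q ^ (p/3))]
    (expected_window_var), and it dominates the drift error of the window
    (window_sum_le): the [L] residue classes contribute
    [L q ^ (1/2) |log q|], which tends to zero.  Since a window is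
    [delta] long, the sum of [q ^ (p/3)] over the windows is controlled by the
    sum of [gamma ^ (1 + p/3)] (grid_summable), hence the window variables are
    almost surely summable and the window errors vanish (window_sums_cvg0).
    The conditional means converge geometrically to [f], which is therefore
    bounded and Lipschitz on balls (meanfield_cauchy, vector_field_lip).

    Conclusion.  Letting the window length run through [1/(m+1)] passes from
    windows to arbitrary stretches of bounded time (small_sums).  Both the
    interpolated process and the flow line through one of its points are then
    Euler schemes for [f] with small summed errors, and a discrete Gronwall
    inequality keeps them together (tracking). *)

Set Implicit Arguments.
Unset Strict Implicit.
Unset Printing Implicit Defensive.

Local Open Scope classical_set_scope.
Local Open Scope ring_scope.

(** * The Adam direction as a function of the gradients *)

Section cauchy_schwarz.
Context {R : realType}.

Lemma sum_cauchy_schwarz n (x y : nat -> R) :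
  (\sum_(i < n) x i * y i) ^+ 2 <=
  (\sum_(i < n) x i ^+ 2) * \sum_(i < n) y i ^+ 2.
Proof.
elim: n => [|n IH]; first by rewrite !big_ord0 expr0n mulr0.
rewrite !big_ord_recr /=; move: IH.
set sx := \sum_(i < n) x i ^+ 2; set sy := \sum_(i < n) y i ^+ 2.
set s := \sum_(i < n) x i * y i => IH.
have sx0 : 0 <= sx by apply: sumr_ge0 => i _; exact: sqr_ge0.
have sy0 : 0 <= sy by apply: sumr_ge0 => i _; exact: sqr_ge0.
have H : 2 * s * (x n * y n) <= sx * y n ^+ 2 + sy * x n ^+ 2.
  have r0 : 0 <= sx * y n ^+ 2 + sy * x n ^+ 2.
    by rewrite addr_ge0// mulr_ge0// sqr_ge0.
  have : (2 * s * (x n * y n)) ^+ 2 <= (sx * y n ^+ 2 + sy * x n ^+ 2) ^+ 2.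
    have := sqr_ge0 (sx * y n ^+ 2 - sy * x n ^+ 2).
    have : s ^+ 2 * (x n * y n) ^+ 2 <= sx * sy * (x n * y n) ^+ 2.
      by rewrite ler_wpM2r// sqr_ge0.
    move=> h1 h2.
    rewrite -subr_ge0.
    rewrite (_ : _ - _ = (sx * y n ^+ 2 - sy * x n ^+ 2) ^+ 2
      + 4 * (sx * sy * (x n * y n) ^+ 2 - s ^+ 2 * (x n * y n) ^+ 2)); last by ring.
    by rewrite addr_ge0// mulr_ge0// subr_ge0.
  move=> h; rewrite (le_trans (ler_norm _))// -(ger0_norm r0).
  by rewrite -ler_sqr ?nnegrE// !real_normK ?num_real.
rewrite -subr_ge0 (_ : _ - _ = (sx * sy - s ^+ 2) +
   (sx * y n ^+ 2 + sy * x n ^+ 2 - 2 * s * (x n * y n))); last by ring.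
by rewrite addr_ge0// subr_ge0.
Qed.

End cauchy_schwarz.

(** Histories are listed newest entry first, so that the weight of an entry
    does not depend on the time; [n] is the length that is taken into account.
    The bias correction of Adam is left out, see [bias_correction]. *)
Definition wnorm (R : realType) (be : R) (n : nat) (a : nat -> R) : R :=
  Num.sqrt ((1 - be) * \sum_(i < n) be ^+ i * a i ^+ 2).

Definition wdir (R : realType) (al be eps : R) (n : nat) (a : nat -> R) : R :=
  (1 - al) * (\sum_(i < n) al ^+ i * a i) / (wnorm be n a + eps).

(** The constant that Cauchy-Schwarz yields in [momentum_le]. *)
Definition wbound (R : realType) (al be : R) : R :=
  (1 - al) / Num.sqrt ((1 - be) * (1 - al ^+ 2 / be)).

Section weighted.
Context {R : realType} {al be eps : R}.
Hypotheses (al01 : 0 <= al < 1) (hbe : al ^+ 2 < be < 1) (eps0 : 0 < eps).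

Lemma be_gt0 : 0 < be.
Proof. by case/andP: hbe => h _; rewrite (le_lt_trans _ h)// sqr_ge0. Qed.

Lemma onem_be_gt0 : 0 < 1 - be.
Proof. by case/andP: hbe => _; rewrite subr_gt0. Qed.

Lemma onem_al_gt0 : 0 < 1 - al.
Proof. by case/andP: al01 => _; rewrite subr_gt0. Qed.

Lemma onem_ratio_gt0 : 0 < 1 - al ^+ 2 / be.
Proof.
by rewrite subr_gt0 ltr_pdivrMr ?mul1r; [case/andP: hbe|exact: be_gt0].
Qed.

Implicit Types a b : nat -> R.
Notation nb := (wnorm be).
Notation Phi := (wdir al be eps).
Notation C := (wbound al be).

Lemma wsqsum_ge0 n (a : nat -> R) :
  0 <= (1 - be) * \sum_(i < n) be ^+ i * a i ^+ 2.
Proof.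
rewrite mulr_ge0 ?(ltW onem_be_gt0)//; apply: sumr_ge0 => i _.
by rewrite mulr_ge0 ?sqr_ge0// exprn_ge0// ltW// be_gt0.
Qed.

Lemma wnorm_ge0 n a : 0 <= nb n a. Proof. exact: sqrtr_ge0. Qed.

Lemma sqr_wnorm n a :
  nb n a ^+ 2 = (1 - be) * \sum_(i < n) be ^+ i * a i ^+ 2.
Proof. by rewrite sqr_sqrtr// wsqsum_ge0. Qed.

Lemma wbound_gt0 : 0 < C.
Proof. by rewrite divr_gt0 ?onem_al_gt0// sqrtr_gt0 mulr_gt0 ?onem_be_gt0// onem_ratio_gt0. Qed.

Lemma geom_sum_le n (r : R) : 0 <= r < 1 -> \sum_(i < n) r ^+ i <= (1 - r)^-1.
Proof.
move=> /andP[r0 r1].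
rewrite -[leRHS]mul1r ler_pdivlMr ?subr_gt0// mulrC -[X in X * _]opprB mulNr.
by rewrite -subrX1 opprB lerBlDr lerDl exprn_ge0.
Qed.

(** Cauchy-Schwarz with the weights [be ^ i]: the remaining factors
    [(al ^ 2 / be) ^ i] are summable because [al ^ 2 < be]. *)
Lemma momentum_le n a :
  `|(1 - al) * \sum_(i < n) al ^+ i * a i| <= C * nb n a.
Proof.
have be0 := be_gt0.
have sb0 : 0 < Num.sqrt be by rewrite sqrtr_gt0.
have C0 := wbound_gt0.
have Cn : 0 <= C * nb n a by apply: mulr_ge0; [exact: ltW C0|exact: wnorm_ge0].
rewrite -ler_sqr ?nnegrE ?normr_ge0//.
rewrite real_normK ?num_real//.
rewrite [leRHS]exprMn sqr_wnorm /C expr_div_n sqr_sqrtr; last first.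
  by rewrite mulr_ge0 ?ltW ?onem_be_gt0// onem_ratio_gt0.
have -> : \sum_(i < n) al ^+ i * a i =
   \sum_(i < n) (al / Num.sqrt be) ^+ i * (Num.sqrt be ^+ i * a i).
  apply: eq_bigr => i _; rewrite mulrA; congr (_ * _).
  by rewrite -exprMn divfK// gt_eqF.
rewrite exprMn -[leRHS]mulrA ler_wpM2l ?sqr_ge0//.
apply: (le_trans (sum_cauchy_schwarz n (fun i => (al / Num.sqrt be) ^+ i)
  (fun i => Num.sqrt be ^+ i * a i))).
have -> : \sum_(i < n) (Num.sqrt be ^+ i * a i) ^+ 2 =
          \sum_(i < n) be ^+ i * a i ^+ 2.
  by apply: eq_bigr => i _; rewrite exprMn -exprM mulnC exprM sqr_sqrtr// ltW.
rewrite invfM mulrACA mulrA -mulrA; rewrite mulVf ?mul1r; last first.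
  by rewrite gt_eqF// onem_be_gt0.
rewrite ler_wpM2r//.
  by apply: sumr_ge0 => i _; rewrite mulr_ge0 ?sqr_ge0// exprn_ge0// ltW.
have -> : \sum_(i < n) (al / Num.sqrt be) ^+ i ^+ 2 =
   \sum_(i < n) (al ^+ 2 / be) ^+ i.
  apply: eq_bigr => i _; rewrite -exprM mulnC exprM expr_div_n sqr_sqrtr//.
  by rewrite ltW.
apply: geom_sum_le; rewrite divr_ge0 ?sqr_ge0 ?(ltW be0)//=.
by rewrite -subr_gt0 onem_ratio_gt0.
Qed.

Lemma wnorm_triangle n a b : nb n (fun i => a i + b i) <= nb n a + nb n b.
Proof.
rewrite -ler_sqr ?nnegrE ?addr_ge0 ?wnorm_ge0// sqr_wnorm sqrrD !sqr_wnorm.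
set A := \sum_(i < n) be ^+ i * a i ^+ 2.
set B := \sum_(i < n) be ^+ i * b i ^+ 2.
pose D := \sum_(i < n) be ^+ i * (a i * b i).
have -> : \sum_(i < n) be ^+ i * (a i + b i) ^+ 2 = A + 2 * D + B.
  rewrite /A /D /B mulr_sumr -!big_split /=; apply: eq_bigr => i _; ring.
have be0 := be_gt0; have sb0 : 0 < Num.sqrt be by rewrite sqrtr_gt0.
have HD : (1 - be) * D <= nb n a * nb n b.
  apply: (le_trans (ler_norm _)).
  rewrite -ler_sqr ?nnegrE ?mulr_ge0 ?wnorm_ge0// real_normK ?num_real//.
  rewrite !exprMn !sqr_wnorm -/A -/B.
  rewrite [leRHS]mulrACA -expr2 ler_wpM2l ?sqr_ge0//.
  have E (c : nat -> R) : \sum_(i < n) be ^+ i * c i ^+ 2 =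
      \sum_(i < n) (Num.sqrt be ^+ i * c i) ^+ 2.
    by apply: eq_bigr => i _; rewrite exprMn -exprM mulnC exprM sqr_sqrtr// ltW.
  rewrite /A /B !E.
  have -> : D = \sum_(i < n) (Num.sqrt be ^+ i * a i) * (Num.sqrt be ^+ i * b i).
    apply: eq_bigr => i _; rewrite mulrACA -expr2 -exprM mulnC exprM sqr_sqrtr//.
    by rewrite ltW.
  exact: (sum_cauchy_schwarz n (fun i => Num.sqrt be ^+ i * a i)
    (fun i => Num.sqrt be ^+ i * b i)).
rewrite (_ : (1 - be) * _ = (1 - be) * A + ((1 - be) * D) *+ 2 + (1 - be) * B); last by ring.
by rewrite lerD2r lerD2l lerMn2r HD orbT.
Qed.

Lemma wnorm_lip n a b :
  `|nb n a - nb n b| <= nb n (fun i => a i - b i).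
Proof.
have nbN c d : nb n (fun i => c i - d i) = nb n (fun i => d i - c i).
  by rewrite /wnorm; congr (Num.sqrt (_ * _)); apply: eq_bigr => i _;
     rewrite -sqrrN opprB.
have H c d : nb n c - nb n d <= nb n (fun i => c i - d i).
  rewrite lerBlDr (le_trans _ (wnorm_triangle _ _ _))//.
  rewrite /wnorm; rewrite le_eqVlt; apply/orP; left; apply/eqP.
  by congr (Num.sqrt (_ * _)); apply: eq_bigr => i _; rewrite subrK.
by rewrite ler_norml H lerNl opprB nbN H.
Qed.

Lemma wdir_le n a : `|Phi n a| <= C.
Proof.
have h : 0 < nb n a + eps by rewrite ltr_wpDl// wnorm_ge0.
rewrite normrM normfV (gtr0_norm h) ler_pdivrMr//.
rewrite (le_trans (momentum_le _ _))// ler_wpM2l ?lerDl ?ltW ?wbound_gt0//.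
Qed.

(** The denominator cancels the size of the numerator, so the direction is
    Lipschitz in the weighted norm although neither factor is bounded. *)
Lemma wdir_lip n a b :
  `|Phi n a - Phi n b| <= 2 * C / eps * nb n (fun i => a i - b i).
Proof.
have ha : 0 < nb n a + eps by rewrite ltr_wpDl// wnorm_ge0.
have hb : 0 < nb n b + eps by rewrite ltr_wpDl// wnorm_ge0.
pose A := (1 - al) * \sum_(i < n) al ^+ i * a i.
pose B := (1 - al) * \sum_(i < n) al ^+ i * b i.
set D := nb n (fun i => a i - b i).
have hAB : `|A - B| <= C * D.
  rewrite (_ : A - B = (1 - al) * \sum_(i < n) al ^+ i * (a i - b i)).
    exact: momentum_le.
  by rewrite /A /B -mulrBr -sumrB; congr (_ * _); apply: eq_bigr => i _; ring.
have hB : `|B| <= C * nb n b := momentum_le _ _.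
have D0 : 0 <= D by exact: wnorm_ge0.
have C0 := ltW wbound_gt0.
have nb0 := wnorm_ge0 n b.
have na0 := wnorm_ge0 n a.
have -> : Phi n a - Phi n b = (A - B) / (nb n a + eps) +
   B * (nb n b - nb n a) / ((nb n a + eps) * (nb n b + eps)).
  rewrite /wdir -/A -/B; field; rewrite !gt_eqF//.
rewrite (le_trans (ler_normD _ _))// (_ : 2 * C / eps * D = C * D / eps + C * D / eps); last by ring.
apply: lerD.
  rewrite normrM normfV (gtr0_norm ha) ler_pdivrMr// mulrAC ler_pdivlMr//.
  by apply: ler_pM => //; rewrite ?lerDr// ltW.
rewrite normrM normfV (gtr0_norm (mulr_gt0 ha hb)) ler_pdivrMr ?mulr_gt0//.
rewrite [leRHS]mulrAC ler_pdivlMr// normrM.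
have hd : `|nb n b - nb n a| <= D by rewrite distrC; exact: wnorm_lip.
rewrite (_ : C * D * _ = (C * (nb n b + eps)) * D * (nb n a + eps)); last by ring.
apply: ler_pM; rewrite ?mulr_ge0 ?(ltW eps0)// ?lerDr//.
apply: ler_pM => //; apply: (le_trans hB); apply: ler_wpM2l => //; rewrite lerDl; exact: ltW.
Qed.

(** The factor [1 - be ^ n] changes the denominator by a relative error
    [be ^ n], and the numerator is dominated by the denominator. *)
Lemma bias_correction n a : (0 < n)%N ->
  `|(1 - al) * (\sum_(i < n) al ^+ i * a i) /
     (Num.sqrt ((1 - be) * (\sum_(i < n) be ^+ i * a i ^+ 2) / (1 - be ^+ n)) + eps)
    - Phi n a| <= C * be ^+ n.
Proof.
move=> n0.
have be0 := be_gt0; have := onem_be_gt0; rewrite subr_gt0 => be1.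
have bn1 : be ^+ n < 1 by rewrite exprn_ilt1 ?ltW// -lt0n.
have bn0 : 0 < be ^+ n by rewrite exprn_gt0.
pose c := Num.sqrt (1 - be ^+ n).
have c0 : 0 < c by rewrite sqrtr_gt0 subr_gt0.
have cge : 1 - be ^+ n <= c.
  rewrite -ler_sqr ?nnegrE ?subr_ge0 ?(ltW bn1) ?(ltW c0)//.
  rewrite sqr_sqrtr ?subr_ge0 ?(ltW bn1)//.
  by rewrite expr2 ler_piMl ?subr_ge0 ?(ltW bn1)// gerBl ltW.
have c1 : c <= 1.
  by rewrite -sqrtr1 ler_sqrt// gerBl ltW.
rewrite sqrtrM ?wsqsum_ge0// sqrtrV ?subr_ge0 ?(ltW bn1)// -/(nb n a) -/c.
rewrite /wdir.
set A := (1 - al) * _; set s := nb n a.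
have hA : `|A| <= C * s := momentum_le _ _.
have s0 : 0 <= s := wnorm_ge0 _ _.
move: A hA => A hA.
have h1 : 0 < s + eps * c by rewrite ltr_wpDl// mulr_gt0.
have h2 : 0 < s + eps by rewrite ltr_wpDl.
have -> : A / (s / c + eps) - A / (s + eps) = A * s * (c - 1) / ((s + eps * c) * (s + eps)).
  field; rewrite !gt_eqF ?andbT//=.
rewrite normrM normfV (gtr0_norm (mulr_gt0 h1 h2)) ler_pdivrMr ?mulr_gt0//.
rewrite !normrM (ger0_norm s0) (ler0_norm (_ : c - 1 <= 0)) ?subr_le0// opprB.
have C0 := ltW wbound_gt0.
rewrite [leRHS]mulrAC.
apply: ler_pM; rewrite ?mulr_ge0 ?subr_ge0//; last by rewrite lerBlDr addrC -lerBlDr.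
rewrite (le_trans (ler_wpM2r s0 hA))// -mulrA; apply: ler_wpM2l => //.
by apply: ler_pM => //; rewrite lerDl ?mulr_ge0 ?(ltW eps0) ?(ltW c0).
Qed.

(** Below the scale [eta] the square is at most [eta ^ 2], above it the p-th
    power dominates; this trades second moments for p-th moments. *)
Lemma sqr_le_powR (p eta x : R) : 2 <= p -> 0 < eta ->
  x ^+ 2 <= eta ^+ 2 + eta `^ (2 - p) * `|x| `^ p.
Proof.
move=> p2 e0; have [xe|ex] := leP `|x| eta.
  rewrite -[leLHS]addr0 lerD ?mulr_ge0 ?powR_ge0//.
  by rewrite -real_normK ?num_real// ler_sqr ?nnegrE// ltW.
rewrite -[leLHS]add0r lerD ?sqr_ge0//.
have x0 : 0 < `|x| by exact: lt_trans ex.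
rewrite -real_normK ?num_real//.
have -> : `|x| `^ p = `|x| `^ (p - 2) * `|x| ^+ 2.
  by rewrite -powR_mulrn ?(ltW x0)// -powRD ?subrK// (gt_eqF x0) implybT.
rewrite mulrA ler_peMl ?sqr_ge0//.
rewrite -opprB powRN mulrC -[leLHS](divff (_ : eta `^ (p - 2) != 0)); last first.
  by rewrite gt_eqF// powR_gt0.
rewrite ler_wpM2r ?invr_ge0 ?powR_ge0// ge0_ler_powR ?nnegrE ?subr_ge0 ?(ltW e0) ?(ltW x0) ?(ltW ex)//.
Qed.

(** [s <= eta + s ^ 2 / eta] replaces a norm by its square, which can be
    summed and integrated term by term. *)
Lemma wnorm_le_sq (eta : R) n a : 0 < eta -> nb n a <= eta + nb n a ^+ 2 / eta.
Proof.
move=> e0; have := wnorm_ge0 n a; set s := nb n a => s0.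
rewrite -(ler_pM2r e0) mulrDl divfK ?gt_eqF//; nra.
Qed.

Lemma sqr_wnorm_le (p eta : R) n a : 2 <= p -> 0 < eta ->
  nb n a ^+ 2 <= eta ^+ 2 +
    eta `^ (2 - p) * ((1 - be) * \sum_(i < n) be ^+ i * `|a i| `^ p).
Proof.
move=> p2 e0; rewrite sqr_wnorm.
have be0 := ltW be_gt0.
have : \sum_(i < n) be ^+ i * a i ^+ 2 <=
   \sum_(i < n) (be ^+ i * eta ^+ 2 + eta `^ (2 - p) * (be ^+ i * `|a i| `^ p)).
  apply: ler_sum => i _; rewrite (mulrCA (eta `^ _)) -mulrDr ler_wpM2l ?exprn_ge0//.
  exact: sqr_le_powR.
rewrite big_split /= -mulr_suml -mulr_sumr => H.
apply: (le_trans (ler_wpM2l (ltW onem_be_gt0) H)).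
rewrite mulrDr [in leRHS]mulrCA lerD2r mulrA -[leRHS]mul1r ler_wpM2r ?sqr_ge0//.
rewrite -ler_pdivlMl ?onem_be_gt0// mulr1; apply: geom_sum_le; rewrite be0 /=.
by rewrite -subr_gt0 onem_be_gt0.
Qed.

Lemma wnorm_le_powR (p eta : R) n a : 2 <= p -> 0 < eta ->
  nb n a <= 2 * eta +
    eta `^ (1 - p) * ((1 - be) * \sum_(i < n) be ^+ i * `|a i| `^ p).
Proof.
move=> p2 e0; apply: (le_trans (wnorm_le_sq n a e0)).
rewrite mulr_natl mulr2n -addrA lerD2l ler_pdivrMr// mulrDl -expr2.
rewrite (le_trans (sqr_wnorm_le n a p2 e0))// lerD2l mulrAC ler_wpM2r//.
  rewrite mulr_ge0 ?(ltW onem_be_gt0)//; apply: sumr_ge0 => i _.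
  by rewrite mulr_ge0 ?powR_ge0// exprn_ge0// ltW// be_gt0.
rewrite -[X in _ * X]powRr1 ?(ltW e0)// -powRD ?(gt_eqF e0) ?implybT//.
by rewrite (_ : 1 - p + 1 = 2 - p)//; ring.
Qed.

End weighted.

(** * Laws of independent sequences *)

Definition cylinders (dU : measure_display) (UU : measurableType dU) :
    set (set (nat -> UU)) :=
  [set C | exists (n : nat) (A : nat -> set UU),
     (forall k, measurable (A k)) /\
     C = [set u | forall k, (k < n)%N -> A k (u k)]].

(** The product sigma-algebra on sequences. *)
Definition seqspace (dU : measure_display) (UU : measurableType dU) :=
  g_sigma_algebraType (@cylinders dU UU).

Section seqspace.
Context {dU : measure_display} {UU : measurableType dU}.

Lemma cylindersI : setI_closed (@cylinders dU UU).
Proof.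
move=> _ _ [n [A [mA ->]]] [m [B [mB ->]]].
exists (maxn n m), (fun k => (if (k < n)%N then A k else setT) `&`
                             (if (k < m)%N then B k else setT)); split.
  by move=> k; apply: measurableI; case: ifP.
apply/seteqP; split=> u /=.
  by move=> [uA uB] k _; split; case: ifPn => // kn; [exact: uA|exact: uB].
by move=> h; split=> k kn; have := h k; rewrite leq_max kn ?orbT => /(_ isT)[].
Qed.

Lemma measurable_seq_proj k :
  measurable_fun setT (fun u : seqspace UU => u k).
Proof.
move=> _ A mA; rewrite setTI; apply: sub_sigma_algebra.
exists k.+1, (fun i => if i == k then A else setT); split.
  by move=> i; case: ifP.
apply/seteqP; split=> u /=; first by move=> Au i _; case: eqP => // ->.
by move=> /(_ k (ltnSn k)); rewrite eqxx.
Qed.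

Lemma measurable_to_seq (d : measure_display) (T : measurableType d)
    (V : nat -> T -> UU) : (forall k, measurable_fun setT (V k)) ->
  measurable_fun setT (fun w => (fun k => V k w) : seqspace UU).
Proof.
move=> mV; apply: (@measurability _ _ T (seqspace UU) setT _ (@cylinders dU UU)) => //.
move=> _ [_ [n [A [mA ->]]] <-].
rewrite setTI (_ : _ @^-1` _ = \big[setI/setT]_(k < n) (V k @^-1` A k)).
  apply: bigsetI_measurable => k _; rewrite -[X in measurable X]setTI.
  exact: mV.
rewrite -(bigcap_mkord n (fun k => V k @^-1` A k)); apply/seteqP; split=> w /= h k; exact: h.
Qed.

End seqspace.

Section iid.
Context {R : realType} {dU : measure_display} {UU : measurableType dU}.

(** The product rule is stated for plain functions and duplicate-free lists of
    indices, so that reindexing and splicing act by list operations. *)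
Definition iidseq (d : measure_display) (T : measurableType d)
    (m : set T -> \bar R) (V : nat -> T -> UU) (mu : set UU -> \bar R) :=
  (forall k, measurable_fun setT (V k)) /\
  forall (s : seq nat) (A : nat -> set UU), uniq s ->
    (forall k, measurable (A k)) ->
    (m [set w | forall k, k \in s -> A k (V k w)] =
     \prod_(k <- s) mu (A k))%E.

Lemma iidseq_reindex (d : measure_display) (T : measurableType d)
    (m : set T -> \bar R) (V : nat -> T -> UU) (mu : set UU -> \bar R)
    (f g : nat -> nat) : cancel f g ->
  iidseq m V mu -> iidseq m (fun k => V (f k)) mu.
Proof.
move=> fK [mV hV]; split=> [k|s A us mA]; first exact: mV.
have /= := hV (map f s) (fun k => A (g k)).
rewrite map_inj_uniq//; last exact: can_inj fK.
rewrite big_map => /(_ us (fun k => mA (g k))).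
under eq_bigr do rewrite fK.
move=> <-; congr (m _); apply/seteqP; split=> w /= h k.
  by move=> /mapP[i si ->]; rewrite fK; exact: h.
by move=> sk; have := h (f k) (map_f f sk); rewrite fK.
Qed.

(** The cylinders are stable under intersection and generate, so the
    finite-dimensional marginals determine the law of the whole sequence. *)
Lemma iidseq_law (d1 d2 : measure_display) (T1 : measurableType d1)
    (T2 : measurableType d2) (m1 : {measure set T1 -> \bar R})
    (m2 : {measure set T2 -> \bar R}) (V1 : nat -> T1 -> UU)
    (V2 : nat -> T2 -> UU) (mu : set UU -> \bar R)
    (h : seqspace UU -> \bar R) :
  iidseq m1 V1 mu -> iidseq m2 V2 mu ->
  measurable_fun setT h -> (forall u, 0 <= h u)%E ->
  (\int[m1]_w h (fun k => V1 k w) = \int[m2]_w h (fun k => V2 k w))%E.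
Proof.
move=> [mV1 hV1] [mV2 hV2] mh h0.
have mW1 := measurable_to_seq mV1; have mW2 := measurable_to_seq mV2.
pose W1 : T1 -> seqspace UU := fun w k => V1 k w.
pose W2 : T2 -> seqspace UU := fun w k => V2 k w.
have e1 : (\int[pushforward m1 W1]_u h u = \int[m1]_w h (fun k => V1 k w))%E.
  by rewrite (@ge0_integral_pushforward _ _ _ _ _ _ mW1)// preimage_setT.
have e2 : (\int[pushforward m2 W2]_u h u = \int[m2]_w h (fun k => V2 k w))%E.
  by rewrite (@ge0_integral_pushforward _ _ _ _ _ _ mW2)// preimage_setT.
rewrite -e1 -e2; apply: eq_measure_integral => A mA _.
have key n (B : nat -> set UU) (mB : forall k, measurable (B k)) :
   forall d (T : measurableType d) (m : set T -> \bar R) V, iidseq m V mu ->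
   m [set w | forall k, (k < n)%N -> B k (V k w)] = (\prod_(k <- iota 0 n) mu (B k))%E.
  move=> d T m V [_ hV]; rewrite -hV ?iota_uniq//; congr (m _).
  apply/seteqP; split=> w /= H k; have := H k; rewrite mem_iota add0n//.
apply: (@measure_unique _ R (seqspace UU) (@cylinders dU UU) (fun=> setT) erefl
  cylindersI _ _ (pushforward m1 W1) (pushforward m2 W2)) => //.
- move=> _; exists 0%N, (fun=> setT); split => //.
  by apply/seteqP; split.
- by apply/seteqP; split => // u _; exists 0%N.
- move=> _ [n [B [mB ->]]].
  transitivity (\prod_(k <- iota 0 n) mu (B k))%E.
    exact: (key n B mB _ _ m1 V1).
  by apply/esym; exact: (key n B mB _ _ m2 V2).
- move=> _.
  have := hV1 [::] (fun=> setT) isT (fun=> measurableT).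
  rewrite big_nil => h1.
  have e : m1 (W1 @^-1` setT) = 1%E.
    by rewrite -h1; congr (m1 _); apply/seteqP; split.
  by change (m1 (W1 @^-1` setT) < +oo)%E; rewrite e ltry.
Qed.

Definition splice (n : nat) (u v : nat -> UU) : nat -> UU :=
  fun k => if (k < n)%N then u k else v k.

(** Independence of past and future as decoupling: the spliced sequence is
    i.i.d. on the product space, so the future may be drawn from a second copy
    of the probability space.  This replaces conditioning on the past. *)
Lemma iidseq_splice (d : measure_display) (T : measurableType d)
    (P : probability T R) (V : nat -> T -> UU) (mu : set UU -> \bar R)
    (n : nat) (h : seqspace UU -> \bar R) :
  iidseq P V mu -> measurable_fun setT h -> (forall u, 0 <= h u)%E ->
  (\int[P]_w h (fun k => V k w) =
   \int[P]_w \int[P]_w' h (splice n (fun k => V k w) (fun k => V k w')))%E.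
Proof.
move=> iV mh h0; have [mV hV] := iV.
pose W k (x : T * T) := if (k < n)%N then V k x.1 else V k x.2.
have iW : iidseq (P \x P)%E W mu.
  split=> [k|s A us mA].
    by rewrite /W; case: (k < n)%N; apply: measurableT_comp.
  have mE (t : seq nat) : measurable [set w | forall k, k \in t -> A k (V k w)].
    rewrite (_ : [set w | _] = \big[setI/setT]_(k <- t) (V k @^-1` A k)).
      by apply: bigsetI_measurable => k _; rewrite -[X in measurable X]setTI; exact: mV.
    by rewrite -bigcap_seq; apply/seteqP; split.
  rewrite (_ : [set w | _] =
      [set w | forall k, k \in [seq k <- s | (k < n)%N] -> A k (V k w)] `*`
      [set w | forall k, k \in [seq k <- s | ~~ (k < n)%N] -> A k (V k w)]).
    rewrite product_measure1E//.
    transitivity (\prod_(k <- [seq k <- s | (k < n)%N]) mu (A k) *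
        \prod_(k <- [seq k <- s | ~~ (k < n)%N]) mu (A k))%E.
      by congr (_ * _)%E; apply: hV; rewrite ?filter_uniq.
    rewrite !big_filter.
    by rewrite [in RHS](bigID (fun k => (k < n)%N)).
  apply/seteqP; split=> -[w w'] /= => [H|[H1 H2]].
    split=> k; rewrite mem_filter => /andP[kn ks]; have := H k ks; rewrite /W /=.
      by rewrite kn.
    by rewrite (negPf kn).
  move=> k ks; rewrite /W /=; case: ifPn => kn; [apply: H1|apply: H2];
    by rewrite mem_filter kn.
rewrite (iidseq_law iV iW mh h0).
have mhW : measurable_fun setT (fun x : T * T => h (fun k => W k x)).
  have [mW _] := iW.
  exact: (measurableT_comp mh (measurable_to_seq mW)).
by rewrite (fubini_tonelli1 (fun x : T * T => h (fun k => W k x))).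
Qed.

End iid.

(** * Norms and Borel sets of the Euclidean space *)

Section norms.
Context {R : realType} {d : nat}.
Implicit Types x y : 'rV[R]_d.

Lemma coord_le_norm x j : `|x 0 j| <= `|x|.
Proof.
rewrite [leRHS]/Num.norm /= mx_normrE.
by apply: (@le_bigmax _ _ _ _ (fun ij : 'I_1 * 'I_d => `|x ij.1 ij.2|) (0, j)).
Qed.

Lemma norm_le_coord x c : 0 <= c -> (forall j, `|x 0 j| <= c) -> `|x| <= c.
Proof.
move=> c0 h; rewrite [leLHS]/Num.norm /= mx_normrE.
apply/bigmax_leP; split=> // -[i j] _ /=; rewrite (_ : i = 0) ?h//.
by apply/val_inj; case: i => -[].
Qed.

Lemma eucl_norm_ge0 x : 0 <= eucl_norm x.
Proof. exact: sqrtr_ge0. Qed.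

Lemma coord_le_eucl x j : `|x 0 j| <= eucl_norm x.
Proof.
rewrite -sqrtr_sqr ler_sqrt; last by apply: sumr_ge0 => i _; exact: sqr_ge0.
by rewrite (bigD1 j)//= lerDl; apply: sumr_ge0 => i _; exact: sqr_ge0.
Qed.

Lemma eucl_norm_le x : eucl_norm x <= d%:R * `|x|.
Proof.
rewrite -[leRHS]ger0_norm ?mulr_ge0// -sqrtr_sqr ler_sqrt ?sqr_ge0//.
apply: (@le_trans _ _ (\sum_(j < d) `|x| ^+ 2)).
  apply: ler_sum => j _; rewrite -real_normK ?num_real// ler_sqr ?nnegrE//.
  exact: coord_le_norm.
rewrite sumr_const card_ord -[leLHS]mulr_natl exprMn ler_wpM2r ?sqr_ge0//.
by case: d => [|n]; rewrite ?expr0n// expr2 ler_peMr// ler1n.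
Qed.

End norms.

Section borel.
Context {R : realType} {d : nat}.

Lemma measurable_coord (j : 'I_d) :
  measurable_fun setT (fun x : borel_rV R d => x 0 j).
Proof.
apply: (measurability _ (RGenOpens.measurableE R)).
move=> _ [_ [a [b ->] <-]]; rewrite setTI; apply: sub_sigma_algebra.
apply: (@open_comp _ _ (fun x : 'rV[R]_d => x 0 j)); last exact: interval_open.
by move=> x _; exact: coord_continuous.
Qed.

(** The open sets of R^d are countable unions of rational boxes, so Borel
    measurability may be tested on coordinates. *)
Lemma measurable_borel_rV (dT : measure_display) (T : measurableType dT)
    (g : T -> borel_rV R d) :
  (forall j, measurable_fun setT (fun w => g w 0 j : R)) -> measurable_fun setT g.
Proof.
move=> mg; apply: (@measurability _ _ T (borel_rV R d) setT _ (@open 'rV[R]_d)) => //.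
move=> _ [B oB <-]; rewrite setTI.
pose box (q : 'rV[rat]_d) (n : nat) : set 'rV[R]_d :=
  [set x | forall j, `|x 0 j - ratr (q 0 j)| < n.+1%:R^-1].
pose F (i : 'rV[rat]_d * nat) : set T :=
  if `[< box i.1 i.2 `<=` B >] then g @^-1` box i.1 i.2 else set0.
rewrite (_ : g @^-1` B = \bigcup_i F i); last first.
  apply/seteqP; split=> [w /= Bw|w [[q n] _]]; last first.
    by rewrite /F /=; case: asboolP => // h; exact: h.
  have := open_nbhs_nbhs (conj oB Bw) => /nbhs_ballP[e /= e0 eB].
  pose n := Num.truncn (2 / e).
  have ne : 2 * n.+1%:R^-1 < e.
    rewrite ltr_pdivrMr// mulrC -ltr_pdivrMr//; exact: truncnS_gt.
  have hq j : exists q : rat, `|g w 0 j - ratr q| < n.+1%:R^-1.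
    have : g w 0 j - n.+1%:R^-1 < g w 0 j + n.+1%:R^-1.
      by rewrite ltrD2l gtrN// invr_gt0.
    move=> /rat_in_itvoo[q]; rewrite in_itv /= => /andP[h1 h2]; exists q.
    by rewrite distrC ltr_distl h1 h2.
  have [q hq'] := choice hq.
  exists (\row_j q j, n) => //; rewrite /F /=.
  have gb : box (\row_j q j) n (g w) by move=> j; rewrite mxE.
  case: asboolP => // -[] x hx; apply: eB; split => // i j.
  rewrite (_ : i = 0); last by apply/val_inj; case: i => -[].
  rewrite /ball /= /ball_ /=; have := hx j; have := gb j; rewrite !mxE.
  set a := g w 0 j; set b := x 0 j; set c := ratr _; move=> h1 h2.
  rewrite (_ : a - b = (a - c) - (b - c)); last by ring.
  by rewrite (le_lt_trans (ler_normB _ _))// (le_lt_trans _ ne)//; rewrite mulr_natl mulr2n lerD// ltW.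
apply: countable_bigcupT_measurable; first exact: countableP.
move=> [q n]; rewrite /F /=; case: asboolP => // _.
rewrite (_ : _ @^-1` _ = \big[setI/setT]_(j <- enum 'I_d)
   ((fun w => g w 0 j) @^-1` [set y | `|y - ratr (q 0 j)| < n.+1%:R^-1])).
  apply: bigsetI_measurable => j _; rewrite -[X in measurable X]setTI.
  apply: mg => //; apply: open_measurable.
  have -> : [set y : R | `|y - ratr (q 0 j)| < n.+1%:R^-1] = ball (ratr (q 0 j) : R) n.+1%:R^-1.
    by apply/seteqP; split=> y /=; rewrite /ball /= distrC.
  exact: ball_open.
rewrite -bigcap_seq; apply/seteqP; split=> w /= h j; first by move=> _; exact: h.
by apply: h => /=; rewrite mem_enum.
Qed.

End borel.

(** * Adam as a function of the driving sequence *)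

Section measurable_helpers.
Context {R : realType} {d : measure_display} {T : measurableType d}.

Lemma measurable_fun_sqrt (f : T -> R) :
  measurable_fun setT f -> measurable_fun setT (fun w => Num.sqrt (f w)).
Proof.
move=> mf; apply: (measurableT_comp (f := @Num.sqrt R)) => //.
exact: continuous_measurable_fun (@sqrt_continuous R).
Qed.

Lemma measurable_fun_inv_gt0 (f : T -> R) : (forall w, 0 < f w) ->
  measurable_fun setT f -> measurable_fun setT (fun w => (f w)^-1).
Proof.
move=> f0 mf; rewrite (_ : (fun w => _) = fun w => f w `^ (-1)).
  exact: (measurableT_comp (measurable_powR (-1))).
by apply/funext => w; rewrite powR_inv1// ltW.
Qed.

Lemma measurable_wnorm (be : R) n (a : nat -> T -> R) :
  (forall k, measurable_fun setT (a k)) ->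
  measurable_fun setT (fun w => wnorm be n (fun k => a k w)).
Proof.
move=> ma; apply: measurable_fun_sqrt; apply: measurable_funM => //.
apply: measurable_sum => k; apply: measurable_funM => //.
exact: measurable_funX.
Qed.

Lemma measurable_wdir (al be eps : R) n (a : nat -> T -> R) : 0 < eps ->
  (forall k, measurable_fun setT (a k)) ->
  measurable_fun setT (fun w => wdir al be eps n (fun k => a k w)).
Proof.
move=> e0 ma; apply: measurable_funM.
  apply: measurable_funM => //.
  by apply: measurable_sum => k; apply: measurable_funM.
apply: measurable_fun_inv_gt0; first by move=> w; rewrite ltr_wpDl// sqrtr_ge0.
by apply: measurable_funD => //; exact: measurable_wnorm.
Qed.

End measurable_helpers.

Section clip.
Context {R : realType} {d : nat}.

(** Clipping coordinates is the projection onto the ball of the sup norm, hence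
    1-Lipschitz for this norm. *)
Definition clip (N : R) (x : 'rV[R]_d) : 'rV[R]_d :=
  \row_j Num.max (- N) (Num.min N (x 0 j)).

Lemma clip_id N x : `|x| <= N -> clip N x = x.
Proof.
move=> xN; apply/rowP => j; rewrite mxE.
have := le_trans (coord_le_norm x j) xN; rewrite ler_norml => /andP[h1 h2].
by rewrite min_r// max_r.
Qed.

Lemma norm_clip N x : 0 <= N -> `|clip N x| <= N.
Proof.
move=> N0; apply: norm_le_coord => // j; rewrite mxE ler_norml.
rewrite le_max lexx ge_max ge_min lexx /= andbT.
by rewrite (le_trans _ N0)// oppr_le0.
Qed.

Lemma clip_lip N x y : `|clip N x - clip N y| <= `|x - y|.
Proof.
have key (a b : R) : `|Num.max (- N) (Num.min N a) - Num.max (- N) (Num.min N b)|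
    <= `|a - b|.
  rewrite /Num.max /Num.min.
  case: (ltP N a) => h1; case: (ltP N b) => h2; case: (ltP (- N) N) => h3;
   case: (ltP (- N) a) => h4; case: (ltP (- N) b) => h5;
   rewrite ler_norml; case: (lerP b a) => h6; apply/andP; split; lra.
apply: norm_le_coord => // j; rewrite !mxE (le_trans (key _ _))//.
by have := coord_le_norm (x - y) j; rewrite !mxE.
Qed.

Lemma measurable_clip (dT : measure_display) (T : measurableType dT) N
  (g : T -> borel_rV R d) : measurable_fun setT g ->
  measurable_fun setT (fun w => clip N (g w) : borel_rV R d).
Proof.
move=> mg; apply: measurable_borel_rV => j.
under eq_fun do rewrite mxE.
apply: measurable_maxr => //; apply: measurable_minr => //.
exact: (measurableT_comp (measurable_coord j) mg).
Qed.

End clip.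

Section adam.
Context {R : realType} {dU : measure_display} {UU : measurableType dU} {d : nat}.
Variables (X : UU -> 'rV[R]_d -> 'rV[R]_d) (gamma : nat -> R) (al be eps : R).
Variable vartheta : 'rV[R]_d.

(** The state is (parameters, momentum, squared gradients); step [n] leads from
    time [n] to time [n + 1] and consumes the sample with index [n], so samples
    and directions are indexed from 0. *)
Definition adam_step (n : nat) (u : UU) (s : 'rV[R]_d * 'rV[R]_d * 'rV[R]_d) :=
  let x := X u s.1.1 in
  let m := \row_j (al * s.1.2 0 j + (1 - al) * x 0 j) in
  let v := \row_j (be * s.2 0 j + (1 - be) * x 0 j ^+ 2) in
  (\row_j (s.1.1 0 j +
     gamma n.+1 * (Num.sqrt (v 0 j / (1 - be ^+ n.+1)) + eps)^-1 * m 0 j), m, v).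

Fixpoint adam_state (n : nat) (u : nat -> UU) :=
  if n is n'.+1 then adam_step n' (u n') (adam_state n' u)
  else (vartheta, 0 : 'rV[R]_d, 0 : 'rV[R]_d).

Definition adam_path n u := (adam_state n u).1.1.

Lemma adam_state_ext n u u' : (forall k, (k < n)%N -> u k = u' k) ->
  adam_state n u = adam_state n u'.
Proof.
elim: n => //= n IH h; rewrite h// IH// => k kn; apply: h; exact: ltnW.
Qed.

Hypotheses (eps0 : 0 < eps) (mX : product_measurable X).

Lemma measurable_innovation (dT : measure_display) (T : measurableType dT)
    (U : T -> UU) (g : T -> borel_rV R d) j :
  measurable_fun setT U -> measurable_fun setT g ->
  measurable_fun setT (fun w => X (U w) (g w) 0 j).
Proof.
move=> mU mg; apply: (measurableT_comp (measurable_coord j)).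
exact: (measurableT_comp mX (measurable_fun_pair mU mg)).
Qed.

Lemma measurable_adam_state n :
  [/\ measurable_fun setT (fun u : seqspace UU => (adam_state n u).1.1 : borel_rV R d),
      forall j, measurable_fun setT (fun u : seqspace UU => (adam_state n u).1.2 0 j) &
      forall j, measurable_fun setT (fun u : seqspace UU => (adam_state n u).2 0 j)].
Proof.
elim: n => [|n [mth mm mv]] /=.
  by split=> [|j|j]; exact: measurable_cst.
have mx j : measurable_fun setT (fun u : seqspace UU => X (u n) (adam_state n u).1.1 0 j).
  by apply: measurable_innovation => //; exact: measurable_seq_proj.
have mm' j : measurable_fun setT (fun u : seqspace UU =>
    (adam_step n (u n) (adam_state n u)).1.2 0 j).
  apply: (eq_measurable_fun (fun u : seqspace UU => al * (adam_state n u).1.2 0 j +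
      (1 - al) * X (u n) (adam_state n u).1.1 0 j)).
    by move=> u _; rewrite mxE.
  by apply: measurable_funD; apply: measurable_funM.
have mv' j : measurable_fun setT (fun u : seqspace UU =>
    (adam_step n (u n) (adam_state n u)).2 0 j).
  apply: (eq_measurable_fun (fun u : seqspace UU => be * (adam_state n u).2 0 j +
      (1 - be) * X (u n) (adam_state n u).1.1 0 j ^+ 2)).
    by move=> u _; rewrite mxE.
  by apply: measurable_funD; apply: measurable_funM => //; exact: measurable_funX.
split=> //; apply: measurable_borel_rV => j.
apply: (eq_measurable_fun (fun u : seqspace UU => (adam_state n u).1.1 0 j +
    gamma n.+1 * (Num.sqrt ((adam_step n (u n) (adam_state n u)).2 0 j /
      (1 - be ^+ n.+1)) + eps)^-1 *
      (adam_step n (u n) (adam_state n u)).1.2 0 j)).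
  by move=> u _; rewrite /adam_step /= [in RHS]mxE.
apply: measurable_funD; first exact: (measurableT_comp (measurable_coord j) mth).
apply: measurable_funM; last exact: mm'.
apply: measurable_funM => //; apply: measurable_fun_inv_gt0.
  by move=> w; rewrite ltr_wpDl// sqrtr_ge0.
apply: measurable_funD => //; apply: measurable_fun_sqrt.
by apply: measurable_funM => //; exact: mv'.
Qed.

(** A process that satisfies the recursion is a function of its driving
    sequence, which makes it adapted and reduces all laws to the law of the
    sequence. *)
Lemma adam_stateP (u : nat -> UU) (th m v : nat -> 'rV[R]_d) :
  th 0%N = vartheta -> m 0%N = 0 -> v 0%N = 0 ->
  (forall n (j : 'I_d),
     let x := X (u n) (th n) in
     let sigma := (Num.sqrt (v n.+1 0 j / (1 - be ^+ n.+1)) + eps)^-1 in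
     [/\ m n.+1 0 j = al * m n 0 j + (1 - al) * x 0 j,
         v n.+1 0 j = be * v n 0 j + (1 - be) * x 0 j ^+ 2 &
         th n.+1 0 j = th n 0 j + gamma n.+1 * sigma * m n.+1 0 j]) ->
  forall n, adam_state n u = (th n, m n, v n).
Proof.
move=> th0 m0 v0 rec; elim=> [|n IH] /=; first by rewrite th0 m0 v0.
rewrite IH /adam_step /=; congr (_, _, _); apply/rowP => j; rewrite !mxE;
  have [hm hv ht] := rec n j => //.
by rewrite ht hv hm.
Qed.

(** Solving the two recursions brings the state into the form of [wdir]. *)
Lemma adam_state_sum (u : nat -> UU) n j :
  (adam_state n u).1.2 0 j =
    (1 - al) * \sum_(i < n) al ^+ i * X (u (n - i.+1)%N) (adam_path (n - i.+1) u) 0 j /\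
  (adam_state n u).2 0 j =
    (1 - be) * \sum_(i < n) be ^+ i * X (u (n - i.+1)%N) (adam_path (n - i.+1) u) 0 j ^+ 2.
Proof.
elim: n => [|n [IHm IHv]] /=; first by rewrite !mxE !big_ord0 !mulr0.
rewrite !mxE IHm IHv !big_ord_recl /= !expr0 !mul1r !subSS !subn0 -/(adam_path n u).
split; rewrite [in RHS]mulrDr addrC; congr (_ + _); rewrite mulrCA; congr (_ * _);
  rewrite mulr_sumr; apply: eq_bigr => i _;
  by rewrite /bump /= (exprS _ i) -mulrA ?add1n ?subSS.
Qed.

End adam.

Section iid_link.
Context {R : realType}.

Lemma iid_copies_iidseq
    (dO : measure_display) (Omega : measurableType dO) (P : probability Omega R)
    (dU : measure_display) (UU : measurableType dU) (U : {RV P >-> UU})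
    (dO' : measure_display) (Omega' : measurableType dO')
    (P' : probability Omega' R) (V : nat -> {RV P' >-> UU}) :
  iid_copies U V -> iidseq P' (fun k => V k : Omega' -> UU) (distribution P U).
Proof.
move=> [ind law]; split=> [k|s A us mA]; first exact: measurable_funP.
have := ind [fset x in s]%fset A mA.
have e : perm_eq [fset x in s]%fset s.
  by apply: uniq_perm => //; move=> x; rewrite in_fset.
rewrite (perm_big _ e) /=.
rewrite (eq_bigr (fun k => distribution P U (A k))); last by move=> k _; rewrite -(law k).
move=> <-; congr (P' _); apply/seteqP; split=> w /= h k; have := h k; rewrite /= in_fset//.
Qed.

End iid_link.

(** * Integration *)

Section limn_measurable.
Context {R : realType} {d : measure_display} {T : measurableType d}.

(** The set of convergence is measurable by the Cauchy criterion, and outside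
    of it [limn] is a constant. *)
Lemma measurable_limn (h : nat -> T -> R) :
  (forall n, measurable_fun setT (h n)) ->
  measurable_fun setT (fun w => limn (fun n => h n w)).
Proof.
move=> mh.
pose Cv : set T := [set w | cvgn (fun n => h n w)].
have CvE : Cv = \bigcap_k \bigcup_N \bigcap_(m in [set m | (N <= m)%N])
    \bigcap_(n in [set n | (N <= n)%N]) [set w | `|h m w - h n w| < k.+1%:R^-1].
  apply/seteqP; split=> w /=.
    move=> /cvg_cauchy/cauchy_ballP cw k _.
    have k0 : (0 : R) < k.+1%:R^-1 by rewrite invr_gt0.
    have /= := cw _ k0; rewrite near_map2 => -[[A B]] /= [[NA _ hA] [NB _ hB]] hAB.
    exists (maxn NA NB) => // m /= mN n /= nN.
    apply: (hAB (m, n)); split => /=; [apply: hA|apply: hB] => /=.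
      by apply: leq_trans mN; exact: leq_maxl.
    by apply: leq_trans nN; exact: leq_maxr.
  move=> H; apply: cauchy_cvg; apply/cauchy_ballP => e e0.
  pose k := Num.truncn e^-1.
  have ke : k.+1%:R^-1 < e.
    rewrite invf_plt ?posrE//; exact: truncnS_gt.
  have [N _ HN] := H k I; rewrite near_map2.
  exists ([set n | (N <= n)%N], [set n | (N <= n)%N]) => /=.
    by split; exists N.
  move=> [m n] /= [mN nN]; rewrite /ball /=; apply: (lt_trans _ ke).
  exact: HN.
have mCv : measurable Cv.
  rewrite CvE; apply: bigcap_measurableType => k _; apply: bigcup_measurable => N _.
  apply: bigcap_measurableType => m _; apply: bigcap_measurableType => n _.
  rewrite (_ : [set w | _] = (fun w => `|h m w - h n w|) @^-1` `]-oo, k.+1%:R^-1[).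
    rewrite -[X in measurable X]setTI.
    by apply: (measurableT_comp (@normr_measurable R setT)) => //; exact: measurable_funB.
  by apply/seteqP; split=> w /=; rewrite in_itv.
rewrite -(setUv Cv); apply/measurable_funU => //; first exact: measurableC.
split.
  by apply: (measurable_fun_cvg (fun n => measurable_funTS (mh n))) => w /=.
apply: (eq_measurable_fun (cst point)); last exact: measurable_cst.
move=> w; rewrite inE => nw; rewrite /cst; apply/esym.
by apply: getPN => l hl; apply: nw; apply/cvg_ex; exists l.
Qed.

End limn_measurable.

Section expectation_helpers.
Context {R : realType} {d : measure_display} {T : measurableType d}
  {P : probability T R}.

Lemma bounded_integrable (C : R) (f : T -> R) : measurable_fun setT f ->
  (forall w, `|f w| <= C) -> P.-integrable setT (EFin \o f).
Proof.
move=> mf fC; apply: measurable_bounded_integrable => //.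
  exact: (le_lt_trans (probability_le1 P measurableT) (ltry 1)).
exists C; split; rewrite ?num_real// => y Cy w _ /=.
by apply: le_trans (ltW Cy).
Qed.

Lemma Rintegral_EFin (f : T -> R) : P.-integrable setT (EFin \o f) ->
  (\int[P]_w f w)%:E = (\int[P]_w (f w)%:E)%E.
Proof. by move=> fi; rewrite /Rintegral fineK//; exact: integrable_fin_num. Qed.

Lemma Rintegral_bound (C : R) (f : T -> R) : measurable_fun setT f ->
  (forall w, `|f w| <= C) -> `|\int[P]_w f w| <= C.
Proof.
move=> mf fC; have fi := bounded_integrable mf fC.
apply: (le_trans (le_normr_Rintegral measurableT fi)).
have -> : C = \int[P]_w C.
  by rewrite Rintegral_cst//= probability_setT mulr1.
apply: le_Rintegral => //.
  apply: (@bounded_integrable C) => [|w]; first exact: measurableT_comp.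
  by rewrite normr_id.
by apply: (@bounded_integrable `|C|) => [|w]; first exact: measurable_cst.
Qed.

Lemma Rintegral_le_EFin (f : T -> R) (c : R) : measurable_fun setT f ->
  (forall w, 0 <= f w) -> (\int[P]_w (f w)%:E <= c%:E)%E ->
  P.-integrable setT (EFin \o f) /\ \int[P]_w f w <= c.
Proof.
move=> mf f0 fc.
have fi : P.-integrable setT (EFin \o f).
  apply/integrableP; split; first exact/measurable_EFinP.
  rewrite (_ : (fun w => _) = EFin \o f); first exact: (le_lt_trans fc (ltry _)).
  by apply/funext => w /=; rewrite ger0_norm.
by split=> //; rewrite -lee_fin Rintegral_EFin.
Qed.

End expectation_helpers.

Section iid_expectations.
Context {R : realType} {dU : measure_display} {UU : measurableType dU}.
Variable mu : {measure set UU -> \bar R}.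

Lemma iidseq_integral (d : measure_display) (T : measurableType d)
    (P : probability T R) (V : nat -> T -> UU) (k : nat) (h : UU -> \bar R) :
  iidseq P V mu -> measurable_fun setT h -> (forall u, 0 <= h u)%E ->
  (\int[P]_w h (V k w) = \int[mu]_u h u)%E.
Proof.
move=> [mV hV] mh h0.
have e : (\int[pushforward P (V k)]_u h u = \int[P]_w h (V k w))%E.
  by rewrite (@ge0_integral_pushforward _ _ _ _ _ _ (mV k))// preimage_setT.
rewrite -e; apply: eq_measure_integral => A mA _.
have /= := hV [:: k] (fun=> A) isT (fun=> mA).
rewrite big_seq1 => <-; rewrite /pushforward /=; congr (P _).
by apply/seteqP; split=> w /= => [Aw i|]; [rewrite inE => /eqP ->|apply; rewrite inE].
Qed.

Lemma iidseq_splice_le (d : measure_display) (T : measurableType d)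
    (P : probability T R) (V : nat -> T -> UU)
    (n : nat) (h : seqspace UU -> \bar R) (G : T -> \bar R) :
  iidseq P V mu -> measurable_fun setT h -> (forall u, 0 <= h u)%E ->
  measurable_fun setT G ->
  (forall w, \int[P]_w' h (splice n (fun k => V k w) (fun k => V k w')) <= G w)%E ->
  (\int[P]_w h (fun k => V k w) <= \int[P]_w G w)%E.
Proof.
move=> iV mh h0 mG hG; rewrite (iidseq_splice n iV mh h0).
have [mV _] := iV.
have mhs : measurable_fun setT (fun x : T * T =>
    h (splice n (fun k => V k x.1) (fun k => V k x.2))).
  apply: (measurableT_comp mh); apply: measurable_to_seq => k.
  by rewrite /splice; case: (k < n)%N; apply: measurableT_comp.
apply: ge0_le_integral => //.
- by move=> w _; apply: integral_ge0.
- exact: (measurable_fun_fubini_tonelli_F (m2 := P) _ mhs).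
Qed.

(** Adding the bound makes the function nonnegative, which reduces the claim to
    [iidseq_law]. *)
Lemma Rintegral_iidseq_law (d1 d2 : measure_display) (T1 : measurableType d1)
    (T2 : measurableType d2) (P1 : probability T1 R) (P2 : probability T2 R)
    (V1 : nat -> T1 -> UU) (V2 : nat -> T2 -> UU) (h : seqspace UU -> R) (C : R) :
  iidseq P1 V1 mu -> iidseq P2 V2 mu ->
  measurable_fun setT h -> (forall u, `|h u| <= C) ->
  \int[P1]_w h (fun k => V1 k w) = \int[P2]_w h (fun k => V2 k w).
Proof.
move=> i1 i2 mh hC.
have key d (T : measurableType d) (P : probability T R) (V : nat -> T -> UU) :
    iidseq P V mu -> \int[P]_w h (fun k => V k w) =
      fine (\int[P]_w (h (fun k => V k w) + C)%:E)%E - C.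
  move=> [mV _].
  have mhV : measurable_fun setT (fun w => h (fun k => V k w)).
    exact: (measurableT_comp mh (measurable_to_seq mV)).
  rewrite -[fine _]/(\int[P]_w (h (fun k => V k w) + C)) RintegralD//.
  - by rewrite Rintegral_cst//= probability_setT mulr1 addrK.
  - by apply: (@bounded_integrable _ _ _ _ C).
  - by apply: (@bounded_integrable _ _ _ _ `|C|).
rewrite (key _ _ _ _ i1) (key _ _ _ _ i2); congr (fine _ - C).
apply: (iidseq_law (h := fun u => (h u + C)%:E) i1 i2).
  by apply/measurable_EFinP; exact: measurable_funD.
by move=> u; rewrite lee_fin; have := hC u; rewrite ler_norml; lra.
Qed.

End iid_expectations.

Section ae_summable.
Context {R : realType} {d : measure_display} {T : measurableType d}
  (P : probability T R).

(** A series of nonnegative variables with summable expectations is almost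
    surely finite, by monotone convergence. *)
Lemma ae_summable (Z : nat -> T -> R) (c : nat -> R) (M : R) :
  (forall i, measurable_fun setT (Z i)) -> (forall i w, 0 <= Z i w) ->
  (forall i, (\int[P]_w (Z i w)%:E <= (c i)%:E)%E) ->
  (forall n, \sum_(i < n) c i <= M) ->
  {ae P, forall w, exists B, forall n, \sum_(i < n) Z i w <= B}.
Proof.
move=> mZ Z0 Zc cM.
pose f w := (\sum_(i <oo) (Z i w)%:E)%E.
have mf : measurable_fun setT f.
  by apply: ge0_emeasurable_sum => [k w _ _|k _]; [rewrite lee_fin|exact/measurable_EFinP].
have f0 w : (0 <= f w)%E by apply: nneseries_ge0 => *; rewrite lee_fin.
have If : (\int[P]_w f w <= M%:E)%E.
  rewrite integral_nneseries//; last 2 first.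
  - by move=> n; exact/measurable_EFinP.
  - by move=> *; rewrite lee_fin.
  apply: lime_le; first by apply: is_cvg_nneseries => *; apply: integral_ge0 => w _; rewrite lee_fin.
  apply: nearW => n; apply: (@le_trans _ _ (\sum_(0 <= i < n) (c i)%:E)%E).
    by apply: lee_sum => i _.
  by rewrite big_mkord sumEFin lee_fin.
have fi : P.-integrable setT f.
  apply/integrableP; split=> //.
  rewrite (_ : (fun w => _) = f); first exact: (le_lt_trans If (ltry _)).
  by apply/funext => w; rewrite gee0_abs.
have := integrable_ae measurableT fi.
apply: filterS => w /(_ I) fw; exists (fine (f w)) => n.
rewrite -lee_fin fineK// -sumEFin -(big_mkord xpredT (fun i => (Z i w)%:E)).
by apply: nneseries_lim_ge => k _ _; rewrite lee_fin.
Qed.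

End ae_summable.

Section summable_seq.
Context {R : realType}.

Lemma bounded_series_cvg (z : nat -> R) (B : R) : (forall i, 0 <= z i) ->
  (forall n, \sum_(i < n) z i <= B) -> cvgn (series z).
Proof.
move=> z0 zB; apply: nondecreasing_is_cvgn.
  by apply/nondecreasing_seqP => n; rewrite !seriesEnat /= big_nat_recr//= lerDl.
by exists B => _ [n _ <-]; rewrite seriesEnat /= big_mkord.
Qed.

Lemma bounded_series_cvg0 (z : nat -> R) (B : R) : (forall i, 0 <= z i) ->
  (forall n, \sum_(i < n) z i <= B) -> z @ \oo --> 0.
Proof. by move=> z0 zB; apply: cvg_series_cvg_0; exact: bounded_series_cvg zB. Qed.

End summable_seq.

Section moments.
Context {R : realType} {d : measure_display} {T : measurableType d}
  (P : probability T R) {al be eps : R}.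
Hypotheses (al01 : 0 <= al < 1) (hbe : al ^+ 2 < be < 1) (eps0 : 0 < eps).

Lemma second_moment (p r M : R) (c : T -> R) : 2 <= p -> 0 < r -> 0 <= M ->
  measurable_fun setT c -> (\int[P]_w (`|c w| `^ p)%:E <= M%:E)%E ->
  (\int[P]_w (c w ^+ 2)%:E <= (r ^+ 2 + r `^ (2 - p) * M)%:E)%E.
Proof.
move=> p2 r0 M0 mc hM.
have mcp : measurable_fun setT (fun w => `|c w| `^ p).
  apply: (measurableT_comp (measurable_powR p)).
  exact: (measurableT_comp (@normr_measurable R setT)).
apply: (@le_trans _ _ (\int[P]_w ((r ^+ 2)%:E + (r `^ (2 - p))%:E * (`|c w| `^ p)%:E))%E).
  apply: ge0_le_integral => //.
  - by move=> w _; rewrite lee_fin sqr_ge0.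
  - by apply/measurable_EFinP; exact: measurable_funX.
  - apply: emeasurable_funD; first exact: measurable_cst.
    by apply: measurable_funeM; exact/measurable_EFinP.
  - by move=> w _; rewrite -EFinM -EFinD lee_fin; exact: sqr_le_powR.
rewrite ge0_integralD//; last 3 first.
- by move=> w _; rewrite lee_fin sqr_ge0.
- by move=> w _; rewrite mule_ge0// lee_fin powR_ge0.
- by apply: measurable_funeM; exact/measurable_EFinP.
rewrite integral_cst//= probability_setT mule1 ge0_integralZl_EFin//; last 2 first.
- exact/measurable_EFinP.
- exact: powR_ge0.
by rewrite EFinD (EFinM _ M); apply: leeD2l; apply: lee_wpmul2l => //; rewrite lee_fin powR_ge0.
Qed.

Lemma expectation_wsum (a : nat -> T -> R) (kap : nat -> R) n :
  (forall k w, 0 <= a k w) -> (forall k, measurable_fun setT (a k)) ->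
  (forall k, (k < n)%N -> (\int[P]_w (a k w)%:E <= (kap k)%:E)%E) ->
  (\int[P]_w ((1 - be) * \sum_(i < n) be ^+ i * a i w)%:E
    <= ((1 - be) * \sum_(i < n) be ^+ i * kap i)%:E)%E.
Proof.
move=> a0 ma hk.
have be0 := ltW (be_gt0 hbe); have b1 := ltW (onem_be_gt0 hbe).
under eq_integral do rewrite EFinM.
rewrite ge0_integralZl_EFin//; last 2 first.
- move=> w _; rewrite lee_fin; apply: sumr_ge0 => i _.
  by rewrite mulr_ge0// exprn_ge0.
- by apply/measurable_EFinP; apply: measurable_sum => i; exact: measurable_funM.
rewrite EFinM lee_wpmul2l ?lee_fin//.
under eq_integral do rewrite -sumEFin.
rewrite ge0_integral_sum//; last 2 first.
- by move=> i; apply/measurable_EFinP; exact: measurable_funM.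
- by move=> i w _; rewrite lee_fin mulr_ge0// exprn_ge0.
rewrite -sumEFin; apply: lee_sum => i _.
under eq_integral do rewrite EFinM.
rewrite ge0_integralZl_EFin//.
- by rewrite EFinM lee_wpmul2l ?hk// lee_fin exprn_ge0.
- by move=> w _; rewrite lee_fin.
- exact/measurable_EFinP.
- exact: exprn_ge0.
Qed.

(** By [wdir_lip] the difference is controlled by the discounted l2 norm of
    [a - b], and [wnorm_le_sq] turns this norm into second moments, at a scale
    [eta] to be optimised by the user. *)
Lemma expected_wdir_diff n (a b : nat -> T -> R) (kap : nat -> R) (eta : R) :
  (forall k, measurable_fun setT (a k)) ->
  (forall k, measurable_fun setT (b k)) -> 0 < eta ->
  (forall k, (k < n)%N ->
     (\int[P]_w ((a k w - b k w) ^+ 2)%:E <= (kap k)%:E)%E) ->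
  `|\int[P]_w wdir al be eps n (a ^~ w) - \int[P]_w wdir al be eps n (b ^~ w)| <=
  2 * wbound al be / eps *
    (eta + ((1 - be) * \sum_(i < n) be ^+ i * kap i) / eta).
Proof.
move=> ma mb e0 hk.
have mda := measurable_wdir al be n eps0 ma.
have mdb := measurable_wdir al be n eps0 mb.
have ia := bounded_integrable (P := P) mda (fun w => wdir_le al01 hbe eps0 n (a ^~ w)).
have ib := bounded_integrable (P := P) mdb (fun w => wdir_le al01 hbe eps0 n (b ^~ w)).
rewrite -RintegralB//.
pose c k w := a k w - b k w.
have mc k : measurable_fun setT (c k) by exact: measurable_funB.
have Q0 : 0 <= 2 * wbound al be / eps.
  apply: divr_ge0; last exact: ltW.
  by apply: mulr_ge0 => //; exact: ltW (wbound_gt0 al01 hbe).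
have mw : measurable_fun setT (fun w => wnorm be n (c ^~ w) ^+ 2).
  by apply: measurable_funX; exact: measurable_wnorm.
have hsqE : (\int[P]_w (wnorm be n (c ^~ w) ^+ 2)%:E <=
    ((1 - be) * \sum_(i < n) be ^+ i * kap i)%:E)%E.
  under eq_integral do rewrite (sqr_wnorm hbe).
  apply: (expectation_wsum (a := fun k w => c k w ^+ 2)) => //.
  - by move=> *; exact: sqr_ge0.
  - by move=> k; exact: measurable_funX.
have [isq hsq] := Rintegral_le_EFin mw (fun w => sqr_ge0 _) hsqE.
have mab : measurable_fun setT (fun w =>
    wdir al be eps n (a^~ w) - wdir al be eps n (b^~ w)).
  exact: measurable_funB.
have iab : P.-integrable setT (EFin \o (fun w =>
    wdir al be eps n (a^~ w) - wdir al be eps n (b^~ w))).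
  apply: (@bounded_integrable _ _ _ _ (wbound al be + wbound al be)) => // w.
  by apply: (le_trans (ler_normB _ _)); apply: lerD; exact: wdir_le.
apply: (le_trans (le_normr_Rintegral measurableT iab)).
pose g w := 2 * wbound al be / eps * (eta + eta^-1 * wnorm be n (c ^~ w) ^+ 2).
pose sq w := wnorm be n (c ^~ w) ^+ 2.
pose esq w := eta + eta^-1 * wnorm be n (c ^~ w) ^+ 2.
have ie : P.-integrable setT (EFin \o esq).
  have -> : EFin \o esq =
      (fun w => (EFin \o cst eta) w + eta^-1%:E * (EFin \o sq) w)%E.
    by apply/funext => w /=; rewrite -EFinM -EFinD.
  apply: integrableD => //; last exact: integrableZl.
  by apply: (@bounded_integrable _ _ _ _ `|eta|).
apply: (@le_trans _ _ (\int[P]_w g w)).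
  apply: le_Rintegral => //.
  - apply: (@bounded_integrable _ _ _ _ (wbound al be + wbound al be)) => [|w].
      exact: (measurableT_comp (@normr_measurable R setT)).
    rewrite normr_id.
    by apply: (le_trans (ler_normB _ _)); apply: lerD; exact: wdir_le.
  - have -> : EFin \o g = (fun w => (2 * wbound al be / eps)%:E * (EFin \o esq) w)%E by [].
    exact: integrableZl.
  - move=> w _; apply: (le_trans (wdir_lip al01 hbe eps0 _ _ _)).
    by rewrite ler_wpM2l// [_^-1 * _]mulrC; exact: wnorm_le_sq.
rewrite /g RintegralZl// ler_wpM2l// RintegralD//.
- rewrite Rintegral_cst//= probability_setT mulr1 lerD2l RintegralZl// mulrC.
  by rewrite ler_wpM2r// invr_ge0 ltW.
- by apply: (@bounded_integrable _ _ _ _ `|eta|).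
- exact: (integrableZl _ eta^-1 isq).
Qed.

End moments.

(** * Infinite histories *)

Section weights.
Context {R : realType} {al be eps : R}.
Hypotheses (al01 : 0 <= al < 1) (hbe : al ^+ 2 < be < 1) (eps0 : 0 < eps).

(** A short history is a long one that is padded by zeros; thus histories of
    different lengths compare through [wdir_lip]. *)
Lemma wdir_trunc L n (a : nat -> R) : (L <= n)%N ->
  wdir al be eps L a = wdir al be eps n (fun i => if (i < L)%N then a i else 0).
Proof.
move=> Ln; rewrite /wdir /wnorm.
have H (g : nat -> R) (g0 : forall i, ~~ (i < L)%N -> g i = 0) :
    \sum_(i < n) g i = \sum_(i < L) g i.
  rewrite -!(big_mkord xpredT g) (big_cat_nat (leq0n L) Ln) /=.
  rewrite [X in _ + X]big1_seq ?addr0// => i /andP[_]; rewrite mem_index_iota.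
  by move=> /andP[Li _]; apply: g0; rewrite -leqNgt.
rewrite (H (fun i => al ^+ i * (if (i < L)%N then a i else 0))); last first.
  by move=> i /negPf ->; rewrite mulr0.
rewrite (H (fun i => be ^+ i * (if (i < L)%N then a i else 0) ^+ 2)); last first.
  by move=> i /negPf ->; rewrite expr0n mulr0.
congr (_ * _ / (Num.sqrt (_ * _) + _)); apply: eq_bigr => i _; by rewrite ltn_ord.
Qed.

(** The first [L] weights have total mass at most 1 and the others [be ^ L]. *)
Lemma geom_split L n (A B : R) : 0 <= A -> 0 <= B ->
  (1 - be) * \sum_(i < n) be ^+ i * (if (i < L)%N then A else B) <= A + B * be ^+ L.
Proof.
move=> A0 B0; have be0 := be_gt0 hbe; have b1 := onem_be_gt0 hbe.
have key : (1 - be) * \sum_(i < n) be ^+ i * (if (i < L)%N then A else B) <=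
    A * (1 - be ^+ n) + (if (L <= n)%N then B * (be ^+ L - be ^+ n) else 0).
  elim: n => [|n IH].
    rewrite big_ord0 mulr0 expr0 subrr mulr0 add0r.
    by case: ifPn => //; rewrite leqn0 => /eqP ->; rewrite expr0 subrr mulr0.
  rewrite big_ord_recr /= mulrDr (le_trans (lerD IH (lexx _)))//.
  have bn0 : 0 <= be ^+ n by rewrite exprn_ge0// ltW.
  rewrite exprS.
  case: (ltnP n L) => nL.
    case: (ltngtP L n.+1) => Ln.
    - by move: Ln; rewrite ltnS leqNgt nL.
    - rewrite -subr_ge0 (_ : _ - _ = 0) ?lexx//; ring.
    - rewrite Ln exprS -subr_ge0 (_ : _ - _ = 0) ?lexx//; ring.
  rewrite (leq_trans nL (leqnSn n)) -subr_ge0.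
  rewrite (_ : _ - _ = A * (1 - be) * be ^+ n); last by ring.
  by rewrite !mulr_ge0// ltW.
have bn0 : 0 <= be ^+ n by rewrite exprn_ge0// ltW.
have bL0 : 0 <= be ^+ L by rewrite exprn_ge0// ltW.
apply: (le_trans key); apply: lerD.
  by rewrite ler_piMr// gerBl.
by case: ifP => _; [rewrite ler_wpM2l// gerBl|rewrite mulr_ge0].
Qed.

(** Convergence of the discounted square sums entails absolute convergence of
    the momentum, because [|x y| <= x ^ 2 + y ^ 2] splits its terms into the
    summands of the former and a geometric series of ratio [al ^ 2 / be]. *)
Lemma wdir_cvg (a : nat -> R) (B : R) :
  (forall n, \sum_(i < n) be ^+ i * a i ^+ 2 <= B) ->
  (wdir al be eps n a @[n --> \oo] -->
   (1 - al) * ((Num.sqrt ((1 - be) *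
       limn (series (fun k => be ^+ k * `|a k| ^+ 2))) + eps)^-1
     * limn (series (fun k => al ^+ k * a k)))).
Proof.
move=> hB; have be0 := be_gt0 hbe; have b1 := onem_be_gt0 hbe.
have e2 : (fun k => be ^+ k * `|a k| ^+ 2) = (fun k => be ^+ k * a k ^+ 2).
  by apply/funext => k; rewrite real_normK ?num_real.
rewrite e2.
have c2 : cvgn (series (fun k => be ^+ k * a k ^+ 2)).
  apply: (bounded_series_cvg (B := B)) => // i.
  by rewrite mulr_ge0 ?sqr_ge0// exprn_ge0// ltW.
have c1 : cvgn (series (fun k => al ^+ k * a k)).
  apply: normed_cvg.
  apply: (bounded_series_cvg (z := fun k => `|al ^+ k * a k|)
    (B := B + (1 - al ^+ 2 / be)^-1)) => // n.
  apply: (@le_trans _ _ (\sum_(i < n) (be ^+ i * a i ^+ 2 + (al ^+ 2 / be) ^+ i))).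
    apply: ler_sum => i _.
    have sb0 : 0 < Num.sqrt be by rewrite sqrtr_gt0.
    pose x := (al / Num.sqrt be) ^+ i; pose y := Num.sqrt be ^+ i * a i.
    have -> : al ^+ i * a i = x * y.
      by rewrite /x /y mulrA -exprMn divfK// gt_eqF.
    have -> : be ^+ i * a i ^+ 2 = y ^+ 2.
      by rewrite /y exprMn -exprM mulnC exprM sqr_sqrtr// ltW.
    have -> : (al ^+ 2 / be) ^+ i = x ^+ 2.
      rewrite /x -exprM mulnC exprM; congr (_ ^+ _).
      by rewrite expr_div_n sqr_sqrtr// ltW.
    rewrite ler_norml; apply/andP; split; nra.
  rewrite big_split /=; apply: lerD; [exact: hB|apply: geom_sum_le].
  rewrite divr_ge0 ?sqr_ge0 ?(ltW be0)//=.
  by have := onem_ratio_gt0 hbe; rewrite subr_gt0.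
have -> : wdir al be eps ^~ a = (fun n => (1 - al) *
   ((Num.sqrt ((1 - be) * series (fun k => be ^+ k * a k ^+ 2) n) + eps)^-1
     * series (fun k => al ^+ k * a k) n)).
  apply/funext => n; rewrite /wdir /wnorm !seriesEnat /= !big_mkord.
  by rewrite -mulrA [_ / _]mulrC.
apply: cvgMr; apply: cvgM => //.
apply: cvgV; first by rewrite gt_eqF// ltr_wpDl// sqrtr_ge0.
apply: cvgD; last exact: cvg_cst.
apply: continuous_cvg; first exact: sqrt_continuous.
by apply: cvgMr.
Qed.

Section field_limit.
Context {d : measure_display} {T : measurableType d} (P : probability T R).

(** Dominated convergence, the directions being bounded by [wbound al be]. *)
Lemma wdir_expectation_cvg (a : nat -> T -> R) (K : R) : 0 <= K ->
  (forall k, measurable_fun setT (a k)) ->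
  (forall k, (\int[P]_w (a k w ^+ 2)%:E <= K%:E)%E) ->
  (\int[P]_w wdir al be eps n (a ^~ w) @[n --> \oo] -->
   (1 - al) * fine ('E_P[fun w =>
     ((Num.sqrt ((1 - be) *
       limn (series (fun k => be ^+ k * `|a k w| ^+ 2))) + eps)^-1
     * limn (series (fun k => al ^+ k * a k w)))%R])%E).
Proof.
move=> K0 ma hK; have be0 := be_gt0 hbe; have b1 := onem_be_gt0 hbe.
pose h w := (Num.sqrt ((1 - be) *
       limn (series (fun k => be ^+ k * `|a k w| ^+ 2))) + eps)^-1
     * limn (series (fun k => al ^+ k * a k w)).
have mser (g : nat -> T -> R) : (forall k, measurable_fun setT (g k)) ->
    measurable_fun setT (fun w => limn (series (g ^~ w))).
  move=> mg; apply: measurable_limn => n.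
  rewrite (_ : (fun w => series (g ^~ w) n) = fun w => \sum_(0 <= k < n) g k w).
    exact: measurable_sum.
  by apply/funext => w; rewrite seriesEnat.
have mh : measurable_fun setT h.
  apply: measurable_funM; last first.
    by apply: (mser (fun k w => al ^+ k * a k w)) => k; exact: measurable_funM.
  apply: measurable_fun_inv_gt0; first by move=> w; rewrite ltr_wpDl// sqrtr_ge0.
  apply: measurable_funD => //; apply: measurable_fun_sqrt.
  apply: measurable_funM => //.
  apply: (mser (fun k w => be ^+ k * `|a k w| ^+ 2)) => k.
  apply: measurable_funM => //; apply: measurable_funX.
  exact: (measurableT_comp (@normr_measurable R setT)).
have ae1 : {ae P, forall w, exists B, forall n, \sum_(i < n) be ^+ i * a i w ^+ 2 <= B}.
  apply: (ae_summable (Z := fun i w => be ^+ i * a i w ^+ 2) (c := fun i => be ^+ i * K) (M := (1 - be)^-1 * K)).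
  - by move=> i; apply: measurable_funM => //; exact: measurable_funX.
  - by move=> i w; rewrite mulr_ge0 ?sqr_ge0// exprn_ge0// ltW.
  - move=> i; under eq_integral do rewrite EFinM.
    rewrite ge0_integralZl_EFin//.
    + by rewrite (EFinM _ K) lee_wpmul2l// lee_fin exprn_ge0// ltW.
    + by move=> w _; rewrite lee_fin sqr_ge0.
    + by apply/measurable_EFinP; exact: measurable_funX.
    + by rewrite exprn_ge0// ltW.
  - move=> n; rewrite -mulr_suml ler_wpM2r//; apply: geom_sum_le.
    by rewrite (ltW be0) -subr_gt0.
have md n : measurable_fun setT (fun w => wdir al be eps n (a ^~ w)).
  exact: measurable_wdir.
pose h1 w := (1 - al) * h w.
have [ih _ hcv] : [/\ P.-integrable setT (EFin \o h1),
    [sequence \int[P]_w `|(wdir al be eps n (a ^~ w))%:E - (h1 w)%:E| ]_n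
      @ \oo --> 0 &
    [sequence \int[P]_w (wdir al be eps n (a ^~ w))%:E]_n @ \oo -->
      \int[P]_w (h1 w)%:E]%E.
  apply: (@dominated_convergence _ _ _ P setT measurableT
     (fun n w => (wdir al be eps n (a ^~ w))%:E) (EFin \o h1)
     (EFin \o cst (wbound al be))).
  - by move=> n; apply/measurable_EFinP.
  - by apply/measurable_EFinP; exact: measurable_funM.
  - apply: filterS ae1 => w [B hB] _; apply: cvg_EFin; first exact: nearW.
    exact: (wdir_cvg hB).
  - by apply: (@bounded_integrable _ _ _ _ `|wbound al be|).
  - by apply: aeW => w n _; rewrite lee_fin; exact: wdir_le.
have al0 : 1 - al != 0 by rewrite gt_eqF// onem_al_gt0.
have ih2 : P.-integrable setT (EFin \o h).
  rewrite (_ : EFin \o h = fun w => ((1 - al)^-1%:E * (EFin \o h1) w)%E).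
    exact: integrableZl.
  by apply/funext => w /=; rewrite -EFinM /h1 mulrA mulVf// mul1r.
have -> : (1 - al) * fine ('E_P[h])%E = fine (\int[P]_w (h1 w)%:E)%E.
  by rewrite unlock -[RHS]/(\int[P]_w ((1 - al) * h w)) RintegralZl.
by apply: fine_cvg; rewrite fineK//; exact: (integrable_fin_num measurableT ih).
Qed.

End field_limit.

End weights.

(** * Mean fields of a globally regular innovation *)

(** The expected direction after [L] steps at a parameter that does not move;
    [y] is one coordinate of an innovation. *)
Definition meanfield (R : realType) (al be eps : R) (d : nat)
    (dU : measure_display) (UU : measurableType dU) (y : UU -> 'rV[R]_d -> R)
    (dT : measure_display) (T : measurableType dT) (P : probability T R)
    (V : nat -> T -> UU) (L : nat) (th : 'rV[R]_d) : R :=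
  \int[P]_w wdir al be eps L (fun i => y (V i w) th).

Section meanfield.
Context {R : realType} {al be eps p K : R} {d : nat}.
Hypotheses (al01 : 0 <= al < 1) (hbe : al ^+ 2 < be < 1) (eps0 : 0 < eps).
Hypotheses (p2 : 2 <= p) (K0 : 0 <= K).
Context {dU : measure_display} {UU : measurableType dU}.
Variable mu : {measure set UU -> \bar R}.
Variable y : UU -> 'rV[R]_d -> R.
Hypothesis my : measurable_fun setT (fun x : UU * borel_rV R d => y x.1 x.2).
Hypothesis hK : forall th, (\int[mu]_u (`|y u th| `^ p)%:E <= K%:E)%E.
Hypothesis hL : forall th th',
  (\int[mu]_u (`|y u th - y u th'| `^ p)%:E <= (K * `|th - th'| `^ p)%:E)%E.
Context {dT : measure_display} {T : measurableType dT} {P : probability T R}.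
Variable V : nat -> T -> UU.
Hypothesis iV : iidseq P V mu.

Local Notation F := (meanfield al be eps y P V).
Local Notation Q := (2 * wbound al be / eps).

Lemma measurable_section th : measurable_fun setT (y ^~ th).
Proof.
exact: (measurableT_comp my (measurable_fun_pair (@measurable_id _ UU setT)
  (@measurable_cst _ _ UU (borel_rV R d) setT th))).
Qed.

Lemma measurable_abs_powR (d' : measure_display) (T' : measurableType d')
    (g : T' -> R) : measurable_fun setT g ->
  measurable_fun setT (fun w => (`|g w| `^ p)%:E).
Proof.
move=> mg; apply/measurable_EFinP; apply: (measurableT_comp (measurable_powR p)).
exact: (measurableT_comp (@normr_measurable R setT)).
Qed.

Lemma measurable_section_V th k : measurable_fun setT (fun w => y (V k w) th).
Proof. by have [mV _] := iV; apply: (measurableT_comp (measurable_section th)). Qed.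

Lemma pmoment_V th k : (\int[P]_w (`|y (V k w) th| `^ p)%:E <= K%:E)%E.
Proof.
rewrite (iidseq_integral (h := fun u => (`|y u th| `^ p)%:E) k iV) ?hK//.
by apply: measurable_abs_powR; exact: measurable_section.
Qed.

Lemma pmoment_diff_V th th' k :
  (\int[P]_w (`|y (V k w) th - y (V k w) th'| `^ p)%:E
    <= (K * `|th - th'| `^ p)%:E)%E.
Proof.
rewrite (iidseq_integral (h := fun u => (`|y u th - y u th'| `^ p)%:E) k iV) ?hL//.
by apply: measurable_abs_powR; apply: measurable_funB; exact: measurable_section.
Qed.

Lemma second_moment_V th k : (\int[P]_w (y (V k w) th ^+ 2)%:E <= (1 + K)%:E)%E.
Proof.
have := second_moment p2 ltr01 K0 (measurable_section_V th k) (pmoment_V th k).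
by rewrite expr1n powR1 mul1r.
Qed.

Lemma meanfield_le L th : `|F L th| <= wbound al be.
Proof.
apply: Rintegral_bound => [|w]; last exact: wdir_le.
by apply: measurable_wdir => // k; exact: measurable_section_V.
Qed.

Lemma wdir_lip_const_ge0 : 0 <= Q.
Proof.
apply: divr_ge0; last exact: ltW.
by apply: mulr_ge0 => //; exact: ltW (wbound_gt0 al01 hbe).
Qed.

(** Samples of age at least [L] carry the weight [be ^ L]; the scale
    [sqrt (be ^ L)] balances the two terms of [expected_wdir_diff]. *)
Lemma meanfield_cauchy L M th : (L <= M)%N ->
  `|F L th - F M th| <= Q * (2 + K) * Num.sqrt be ^+ L.
Proof.
move=> LM; have be0 := be_gt0 hbe.
have sb0 : 0 < Num.sqrt be by rewrite sqrtr_gt0.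
have eL : 0 < Num.sqrt be ^+ L by rewrite exprn_gt0.
have -> : F L th = \int[P]_w wdir al be eps M (fun i => if (i < L)%N then y (V i w) th else 0).
  by rewrite /meanfield; apply: eq_Rintegral => w _; rewrite (wdir_trunc _ LM).
have h := expected_wdir_diff (P := P) al01 hbe eps0 (n := M)
   (a := fun i w => if (i < L)%N then y (V i w) th else 0)
   (b := fun i w => y (V i w) th)
   (kap := fun i => if (i < L)%N then 0 else 1 + K) _ _ eL _.
apply: (le_trans (h _ _ _)).
- by move=> k; case: (k < L)%N => //; exact: measurable_section_V.
- by move=> k; exact: measurable_section_V.
- move=> k _; case: (k < L)%N.
    under eq_integral do rewrite subrr expr0n /=.
    by rewrite integral0.
  under eq_integral do rewrite sub0r sqrrN.
  exact: second_moment_V.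
rewrite -[leRHS]mulrA ler_wpM2l ?wdir_lip_const_ge0// [leRHS]mulrDl mulr_natl mulr2n -addrA lerD2l.
rewrite ler_pdivrMr// (le_trans (geom_split hbe _ _ _ _))// ?addr_ge0//.
have -> : be ^+ L = Num.sqrt be ^+ L * Num.sqrt be ^+ L.
  by rewrite -exprMn -expr2 sqr_sqrtr// ltW.
by rewrite le_eqVlt; apply/orP; left; apply/eqP; ring.
Qed.

(** The p-th moment of the increments of [y] at the scale [|th - th'|] bounds
    their second moments by the square of this scale. *)
Lemma meanfield_lip L th th' :
  `|F L th - F L th'| <= Q * (2 + K) * `|th - th'|.
Proof.
have [->|ne] := eqVneq th th'; first by rewrite !subrr !normr0 mulr0.
pose r := `|th - th'|; have r0 : 0 < r by rewrite normr_gt0 subr_eq0.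
have h := expected_wdir_diff (P := P) al01 hbe eps0 (n := L)
   (a := fun i w => y (V i w) th) (b := fun i w => y (V i w) th')
   (kap := fun i => (1 + K) * r ^+ 2) _ _ r0 _.
apply: (le_trans (h _ _ _)).
- by move=> k; exact: measurable_section_V.
- by move=> k; exact: measurable_section_V.
- move=> k _.
  have Kr0 : 0 <= K * r `^ p by rewrite mulr_ge0// powR_ge0.
  have := second_moment p2 r0 Kr0 (measurable_funB (measurable_section_V th k)
    (measurable_section_V th' k)) (pmoment_diff_V th th' k).
  have -> // : r ^+ 2 + r `^ (2 - p) * (K * r `^ p) = (1 + K) * r ^+ 2.
  rewrite mulrCA -powRD ?(gt_eqF r0) ?implybT// subrK powR_mulrn ?(ltW r0)//.
  by rewrite mulrDl mul1r.
rewrite -[leRHS]mulrA ler_wpM2l ?wdir_lip_const_ge0// -/r [leRHS]mulrDl mulr_natl mulr2n -addrA lerD2l.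
rewrite -mulr_suml ler_pdivrMr//.
rewrite (_ : (r + K * r) * r = 1 * ((1 + K) * r ^+ 2)); last by ring.
rewrite [leLHS]mulrA ler_wpM2r ?mulr_ge0 ?addr_ge0 ?(ltW r0)//.
have b1 := onem_be_gt0 hbe.
rewrite -ler_pdivlMl// mulr1; apply: geom_sum_le.
by rewrite (ltW (be_gt0 hbe)) -subr_gt0.
Qed.

(** Lets the copies that define the vector field differ from those that drive
    the algorithm. *)
Lemma meanfield_law (dT' : measure_display) (T' : measurableType dT')
    (P' : probability T' R) (V' : nat -> T' -> UU) L th :
  iidseq P' V' mu -> meanfield al be eps y P' V' L th = F L th.
Proof.
move=> iV'.
have mh : measurable_fun setT (fun u : seqspace UU => wdir al be eps L (fun i => y (u i) th)).
  apply: (measurable_wdir _ _ _ eps0 (a := fun i (u : seqspace UU) => y (u i) th)) => k.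
  exact: (measurableT_comp (measurable_section th) (measurable_seq_proj k)).
exact: (Rintegral_iidseq_law iV' iV mh (fun u => wdir_le al01 hbe eps0 L _)).
Qed.

(** The right-hand side is the formula that defines the Adam vector field. *)
Lemma meanfield_cvg th :
  (F n th @[n --> \oo] -->
   (1 - al) * fine ('E_P[fun w =>
     ((Num.sqrt ((1 - be) *
       limn (series (fun k => be ^+ k * `|y (V k w) th| ^+ 2))) + eps)^-1
     * limn (series (fun k => al ^+ k * y (V k w) th)))%R])%E).
Proof.
apply: (wdir_expectation_cvg al01 hbe eps0 (a := fun k w => y (V k w) th) (K := 1 + K)).
- exact: addr_ge0.
- by move=> k; exact: measurable_section_V.
- by move=> k; exact: second_moment_V.
Qed.

End meanfield.

(** * Exponential moments and decoupling *)

Section exponential.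
Context {R : realType}.

Lemma expR_le_quadratic (x : R) : `|x| <= 2^-1 -> expR x <= 1 + x + 2 * x ^+ 2.
Proof.
rewrite ler_norml => /andP[x1 x2].
have h : 0 < 1 - x by lra.
have e1 : 1 - x <= expR (- x) by rewrite -[1 - x]/(1 + - x) expR_ge1Dx.
have e2 : expR x <= (1 - x)^-1.
  by rewrite -[expR x]invrK -expRN lef_pV2 ?posrE ?expR_gt0.
apply: (le_trans e2); rewrite -[leLHS]mul1r ler_pdivrMr//; nra.
Qed.

Context {d : measure_display} {T : measurableType d} {P : probability T R}.

(** The quadratic upper bound of the exponential near 0 loses its linear term
    when the variable is centred. *)
Lemma expectation_expR_le (Z : T -> R) (b : R) : measurable_fun setT Z ->
  (forall w, `|Z w| <= b) -> b <= 2^-1 -> \int[P]_w Z w = 0 ->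
  (\int[P]_w (expR (Z w))%:E <= (expR (2 * b ^+ 2))%:E)%E.
Proof.
move=> mZ Zb b2 EZ.
have iZ := bounded_integrable (P := P) mZ Zb.
have b0 : 0 <= b by apply: le_trans (Zb point); exact: normr_ge0.
apply: (@le_trans _ _ (\int[P]_w (1 + Z w + 2 * b ^+ 2)%:E)%E).
  apply: ge0_le_integral => //.
  - apply/measurable_EFinP; exact: (measurableT_comp (@measurable_expR R)).
  - by apply/measurable_EFinP; apply: measurable_funD => //; exact: measurable_funD.
  - move=> w _; rewrite lee_fin.
    apply: (le_trans (expR_le_quadratic (le_trans (Zb w) b2))).
    rewrite lerD2l ler_wpM2l// -[Z w ^+ 2]real_normK ?num_real//.
    by rewrite ler_sqr ?nnegrE.
have i1 (c : R) : P.-integrable setT (EFin \o (cst c : T -> R)).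
  by apply: (@bounded_integrable _ _ _ _ `|c|).
have i2 : P.-integrable setT (EFin \o (fun w => 1 + Z w)).
  by apply: (@bounded_integrable _ _ _ _ (1 + b)) => [|w];
    [exact: measurable_funD|rewrite (le_trans (ler_normD _ _))// normr1 lerD2l].
have i3 : P.-integrable setT (EFin \o (fun w => 1 + Z w + 2 * b ^+ 2)).
  apply: (@bounded_integrable _ _ _ _ (1 + b + `|2 * b ^+ 2|)) => [|w].
    by apply: measurable_funD => //; exact: measurable_funD.
  by do 2 rewrite (le_trans (ler_normD _ _)) ?lerD// ?normr1 ?lerD2l//.
rewrite -(Rintegral_EFin i3) lee_fin.
have -> : \int[P]_w (1 + Z w + 2 * b ^+ 2) = \int[P]_w (1 + Z w) + \int[P]_w (2 * b ^+ 2).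
  exact: (RintegralD measurableT i2 (i1 _)).
have -> : \int[P]_w (1 + Z w) = \int[P]_w 1 + \int[P]_w Z w by exact: (RintegralD measurableT (i1 _) iZ).
rewrite EZ !Rintegral_cst//= probability_setT !mulr1 addr0.
exact: expR_ge1Dx.
Qed.

End exponential.

(** Being known at time [n], for functions of the driving sequence; this
    replaces measurability with respect to a filtration. *)
Definition past_dep (U A : Type) (n : nat) (g : (nat -> U) -> A) :=
  forall u u' : nat -> U, (forall k, (k < n)%N -> u k = u' k) -> g u = g u'.

Section process.
Context {R : realType} {al be eps p K : R} {d : nat}.
Hypotheses (al01 : 0 <= al < 1) (hbe : al ^+ 2 < be < 1) (eps0 : 0 < eps).
Hypotheses (p2 : 2 <= p) (K0 : 0 <= K).
Context {dU : measure_display} {UU : measurableType dU}.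
Variable mu : {measure set UU -> \bar R}.
Variable y : UU -> 'rV[R]_d -> R.
Hypothesis my : measurable_fun setT (fun x : UU * borel_rV R d => y x.1 x.2).
Hypothesis hK : forall th, (\int[mu]_u (`|y u th| `^ p)%:E <= K%:E)%E.
Hypothesis hL : forall th th',
  (\int[mu]_u (`|y u th - y u th'| `^ p)%:E <= (K * `|th - th'| `^ p)%:E)%E.
Context {dT : measure_display} {T : measurableType dT} {P : probability T R}.
Variable V : nat -> T -> UU.
Hypothesis iV : iidseq P V mu.

Local Notation F := (meanfield al be eps y P V).
Local Notation C := (wbound al be).

Lemma measurable_y (g : seqspace UU -> borel_rV R d) k :
  measurable_fun setT g -> measurable_fun setT (fun u : seqspace UU => y (u k) (g u)).
Proof.
move=> mg.
exact: (measurableT_comp my (measurable_fun_pair (measurable_seq_proj k) mg)).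
Qed.

Lemma measurable_law (g : seqspace UU -> R) : measurable_fun setT g ->
  measurable_fun setT (fun w => g (fun k => V k w)).
Proof. by move=> mg; exact: (measurableT_comp mg (measurable_to_seq iV.1)). Qed.

Lemma past_dep_splice n A (g : (nat -> UU) -> A) u v :
  past_dep n g -> g (splice n u v) = g u.
Proof. by apply=> k kn; rewrite /splice kn. Qed.

(** The parameter [g] is known at time [n], so it may be fixed while the sample
    [n] is averaged. *)
Lemma decoupled_moment n (g : seqspace UU -> borel_rV R d) :
  measurable_fun setT g -> past_dep n g ->
  (\int[P]_w (`|y (V n w) (g (fun k => V k w))| `^ p)%:E <= K%:E)%E.
Proof.
move=> mg pg.
have mh : measurable_fun setT (fun u : seqspace UU => (`|y (u n) (g u)| `^ p)%:E).
  by apply: measurable_abs_powR; exact: measurable_y.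
have := iidseq_splice_le (n := n) (G := cst K%:E) iV mh.
rewrite integral_cst//= probability_setT mule1; apply=> //.
move=> w; apply: le_trans (pmoment_V my hK iV (g (fun k => V k w)) n).
under eq_integral do rewrite (past_dep_splice _ _ pg) /splice ltnn.
by [].
Qed.

Lemma decoupled_moment_diff n (g g' : seqspace UU -> borel_rV R d) (r : R) :
  measurable_fun setT g -> past_dep n g ->
  measurable_fun setT g' -> past_dep n g' ->
  (forall u, `|(g u : 'rV[R]_d) - g' u| <= r) ->
  (\int[P]_w (`|y (V n w) (g (fun k => V k w)) - y (V n w) (g' (fun k => V k w))|
     `^ p)%:E <= (K * r `^ p)%:E)%E.
Proof.
move=> mg pg mg' pg' gr.
have mh : measurable_fun setT (fun u : seqspace UU =>
    (`|y (u n) (g u) - y (u n) (g' u)| `^ p)%:E).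
  by apply: measurable_abs_powR; apply: measurable_funB; exact: measurable_y.
have := iidseq_splice_le (n := n) (G := cst (K * r `^ p)%:E) iV mh.
rewrite integral_cst//= probability_setT mule1; apply=> //.
move=> w.
under eq_integral do
  rewrite (past_dep_splice _ _ pg) (past_dep_splice _ _ pg') /splice ltnn.
apply: (le_trans (pmoment_diff_V my hL iV _ _ n)).
rewrite lee_fin ler_wpM2l// ge0_ler_powR ?nnegrE//.
- by apply: le_trans p2.
- by apply: le_trans (gr (fun k => V k w)).
Qed.

Lemma continuous_meanfield L : continuous (F L : 'rV[R]_d -> R).
Proof.
move=> x A /= /(nbhs_ballP (F L x)) [e /= e0 eA].
set Q := 2 * C / eps * (2 + K).
have Q0 : 0 <= Q by rewrite mulr_ge0 ?addr_ge0// (wdir_lip_const_ge0 al01 hbe eps0).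
have eQ : 0 < e / (Q + 1) by rewrite divr_gt0// ltr_wpDl.
apply/nbhs_ballP; exists (e / (Q + 1)) => //= z; rewrite mx_norm_ball /ball_ /= => xz.
apply: eA; rewrite /ball /=.
apply: (le_lt_trans (meanfield_lip al01 hbe eps0 p2 K0 my hL iV L _ _)).
rewrite -/Q (@le_lt_trans _ _ ((Q + 1) * `|x - z|))//.
  by rewrite ler_wpM2r// lerDl.
by rewrite mulrC -ltr_pdivlMr ?ltr_wpDl.
Qed.

(** Lipschitz continuity makes the mean field Borel, so that it may be evaluated
    at random parameters. *)
Lemma measurable_meanfield L (g : seqspace UU -> borel_rV R d) :
  measurable_fun setT g -> measurable_fun setT (fun u => F L (g u)).
Proof.
move=> mg; apply: (measurableT_comp (f := (F L : borel_rV R d -> R))) => //.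
apply: (measurability _ (RGenOpens.measurableE R)).
move=> _ [_ [a [b ->] <-]]; rewrite setTI; apply: sub_sigma_algebra.
apply: (@open_comp _ _ (F L : 'rV[R]_d -> R)); last exact: interval_open.
by move=> x _; exact: continuous_meanfield.
Qed.

End process.

(** * Freezing the parameter *)

Section directions.
Context {R : realType} (al be eps p : R) {U Th : Type}.
Variables (y : U -> Th -> R) (th : nat -> (nat -> U) -> Th).

(** The frozen direction at step [k] uses the parameter of time [k + 1 - L],
    which is independent of the [L] samples [k + 1 - L], ..., [k]; the full
    direction is the one that drives Adam. *)
Definition full_dir (k : nat) (u : nat -> U) : R :=
  wdir al be eps k.+1 (fun i => y (u (k - i)%N) (th (k - i) u)).

Definition frozen_dir (L k : nat) (u : nat -> U) : R :=
  wdir al be eps L (fun i => y (u (k - i)%N) (th (k.+1 - L) u)).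

Definition history_gap (L k : nat) (i : nat) (u : nat -> U) : R :=
  y (u (k - i)%N) (th (k - i) u) -
  (if (i < L)%N then y (u (k - i)%N) (th (k.+1 - L) u) else 0).

(** The form in which [wnorm_le_powR] bounds the effect of freezing. *)
Definition history_err (L k : nat) (u : nat -> U) : R :=
  (1 - be) * \sum_(i < k.+1) be ^+ i * `|history_gap L k i u| `^ p.

Hypotheses (al01 : 0 <= al < 1) (hbe : al ^+ 2 < be < 1) (eps0 : 0 < eps).
Hypothesis p2 : 2 <= p.

Lemma history_err_ge0 L k u : 0 <= history_err L k u.
Proof.
rewrite mulr_ge0 ?(ltW (onem_be_gt0 hbe))//; apply: sumr_ge0 => i _.
by rewrite mulr_ge0 ?powR_ge0// exprn_ge0// ltW// (be_gt0 hbe).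
Qed.

Lemma full_frozen L k u eta : (L <= k.+1)%N -> 0 < eta ->
  `|full_dir k u - frozen_dir L k u| <=
  2 * wbound al be / eps * (2 * eta + eta `^ (1 - p) * history_err L k u).
Proof.
move=> Lk e0; rewrite /frozen_dir (wdir_trunc _ Lk).
apply: (le_trans (wdir_lip al01 hbe eps0 _ _ _)).
rewrite ler_wpM2l ?(wdir_lip_const_ge0 al01 hbe eps0)//.
exact: (wnorm_le_powR hbe k.+1 (history_gap L k ^~ u) p2 e0).
Qed.

End directions.

Lemma wdir_ext (R : realType) (al be eps : R) n (a b : nat -> R) :
  (forall i, (i < n)%N -> a i = b i) -> wdir al be eps n a = wdir al be eps n b.
Proof.
move=> ab; rewrite /wdir /wnorm.
congr (_ * _ / (Num.sqrt (_ * _) + _)); apply: eq_bigr => i _; by rewrite ab.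
Qed.

Section process.
Context {R : realType} {al be eps p K : R} {d : nat}.
Hypotheses (al01 : 0 <= al < 1) (hbe : al ^+ 2 < be < 1) (eps0 : 0 < eps).
Hypotheses (p2 : 2 <= p) (K0 : 0 <= K).
Context {dU : measure_display} {UU : measurableType dU}.
Variable mu : {measure set UU -> \bar R}.
Variable y : UU -> 'rV[R]_d -> R.
Hypothesis my : measurable_fun setT (fun x : UU * borel_rV R d => y x.1 x.2).
Hypothesis hK : forall th, (\int[mu]_u (`|y u th| `^ p)%:E <= K%:E)%E.
Hypothesis hL : forall th th',
  (\int[mu]_u (`|y u th - y u th'| `^ p)%:E <= (K * `|th - th'| `^ p)%:E)%E.
Context {dT : measure_display} {T : measurableType dT} {P : probability T R}.
Variable V : nat -> T -> UU.
Hypothesis iV : iidseq P V mu.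
Variable th : nat -> (nat -> UU) -> 'rV[R]_d.
Hypothesis mth : forall n, measurable_fun setT (th n : seqspace UU -> borel_rV R d).
Hypothesis pth : forall n, past_dep n (th n).

Local Notation F := (meanfield al be eps y P V).
Local Notation C := (wbound al be).
Local Notation seqV w := (fun k => V k w).

Lemma past_depW n m A (g : (nat -> UU) -> A) : (n <= m)%N ->
  past_dep n g -> past_dep m g.
Proof. by move=> nm pg u u' uu'; apply: pg => k kn; apply: uu'; exact: leq_trans nm. Qed.

Lemma measurable_history_gap L k i :
  measurable_fun setT (fun u : seqspace UU => history_gap y th L k i u).
Proof.
apply: measurable_funB; first exact: (measurable_y my).
by case: (i < L)%N => //; exact: (measurable_y my).
Qed.

Lemma measurable_history_err L k :
  measurable_fun setT (fun u : seqspace UU => history_err be p y th L k u).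
Proof.
apply: measurable_funM => //; apply: measurable_sum => i.
apply: measurable_funM => //; apply/measurable_EFinP; apply: measurable_abs_powR.
exact: measurable_history_gap.
Qed.

(** The recent terms are small because the parameter moves by at most [r] during
    the lag, the older ones because of their weights. *)
Lemma expected_history_err L k (r : R) : (L <= k.+1)%N -> 0 <= r ->
  (forall i u, (i < L)%N -> `|th (k - i) u - th (k.+1 - L) u| <= r) ->
  (\int[P]_w (history_err be p y th L k (seqV w))%:E <=
     (K * r `^ p + K * be ^+ L)%:E)%E.
Proof.
move=> Lk r0 hr.
have A0 : 0 <= K * r `^ p by rewrite mulr_ge0// powR_ge0.
apply: (@le_trans _ _ ((1 - be) * \sum_(i < k.+1) be ^+ i *
    (if (i < L)%N then K * r `^ p else K))%:E); last first.
  by rewrite lee_fin; apply: (geom_split hbe).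
apply: (expectation_wsum hbe
  (a := fun i w => `|history_gap y th L k i (seqV w)| `^ p)
  (kap := fun i => if (i < L)%N then K * r `^ p else K)).
- by move=> i w; exact: powR_ge0.
- move=> i; apply/measurable_EFinP; apply: measurable_abs_powR.
  by apply: (measurable_law iV (g := history_gap y th L k i)); exact: measurable_history_gap.
move=> i; rewrite ltnS => ik; rewrite /history_gap; case: (ltnP i L) => iL.
  apply: (decoupled_moment_diff p2 K0 my hL iV (g := th (k - i)) (g' := th (k.+1 - L))) => //.
    by apply: (past_depW _ (@pth _)); lia.
  by move=> u; exact: hr.
under eq_integral do rewrite subr0.
exact: (decoupled_moment my hK iV).
Qed.

Lemma measurable_frozen_dir L k :
  measurable_fun setT (fun u : seqspace UU => frozen_dir al be eps y th L k u).
Proof.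
apply: (measurable_wdir al be L eps0
   (a := fun i (u : seqspace UU) => y (u (k - i)%N) (th (k.+1 - L) u))) => i.
exact: (measurable_y my).
Qed.

(** The frozen direction minus its conditional mean given the first [k + 1 - L]
    samples. *)
Definition fluct L k (u : nat -> UU) : R :=
  frozen_dir al be eps y th L k u - F L (th (k.+1 - L) u).

Lemma measurable_fluct L k : measurable_fun setT (fun u : seqspace UU => fluct L k u).
Proof.
apply: measurable_funB; first exact: measurable_frozen_dir.
exact: (measurable_meanfield al01 hbe eps0 p2 K0 my hL iV).
Qed.

Lemma past_dep_fluct L k : (0 < L)%N -> past_dep k.+1 (fluct L k).
Proof.
move=> L0 u u' uu'; rewrite /fluct /frozen_dir.
rewrite (pth (u := u) (u' := u')); last first.
  by move=> j jk; apply: uu'; apply: leq_trans jk _; rewrite leq_subLR leq_addl.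
by congr (_ - _); apply: wdir_ext => i iL; rewrite uu'// ltnS leq_subr.
Qed.

(** The block of samples is read backwards; the reflection [f] of the indices
    up to [k] brings it to the form of the mean field. *)
Lemma fluct_centred L k x : (0 < L)%N -> (L <= k.+1)%N ->
  \int[P]_w (wdir al be eps L (fun i => y (V (k - i)%N w) x) - F L x) = 0.
Proof.
move=> L0 Lk.
pose f j := if (j <= k)%N then (k - j)%N else j.
have fK : cancel f f.
  move=> j; rewrite /f; case: (leqP j k) => jk; last by rewrite leqNgt jk.
  by rewrite leq_subr subKn.
have iW := iidseq_reindex fK iV.
have mW j : measurable_fun setT (fun w => y (V (k - j)%N w) x).
  exact: (measurable_section_V my iV).
rewrite RintegralB//.
- rewrite Rintegral_cst//= probability_setT mulr1.
  rewrite -(meanfield_law al01 hbe eps0 my iV L x iW) /meanfield.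
  rewrite [X in X - _](_ : _ = \int[P]_w wdir al be eps L (fun i => y (V (f i) w) x)).
    by rewrite subrr.
  apply: eq_Rintegral => w _; apply: wdir_ext => i iL; rewrite /f.
  by rewrite -ltnS (leq_trans iL Lk).
- apply: (bounded_integrable (C := C)) => [|w]; last exact: wdir_le.
  by apply: (measurable_wdir _ _ _ eps0 (a := fun i w => y (V (k - i)%N w) x)).
- by apply: (bounded_integrable (C := `|F L x|)).
Qed.

Variable ga : nat -> R.
Hypothesis ga0 : forall k, 0 <= ga k.

(** The fluctuations of one residue class modulo L are martingale
    increments, since the frozen direction at time k only involves the
    parameter at time k + 1 - L and the samples after it. *)
Definition class_sum L N j rho (u : nat -> UU) : R :=
  \sum_(N <= k < N + j | (k %% L == rho)%N) ga k * fluct L k u.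

Lemma measurable_class_sum L N j rho :
  measurable_fun setT (fun u : seqspace UU => class_sum L N j rho u).
Proof.
apply: (eq_measurable_fun (fun u : seqspace UU => \sum_(N <= k < N + j)
    (if (k %% L == rho)%N then ga k * fluct L k u else 0))).
  by move=> u _; rewrite /class_sum [in RHS]big_mkcond.
apply: measurable_sum => k; case: (_ == _) => //.
by apply: measurable_funM => //; exact: measurable_fluct.
Qed.

(** Induction on the number of terms: the last term of the class is averaged
    first, by decoupling at the time [m + 1 - L] before which all the earlier
    terms are known. *)
Lemma class_sum_exp L N j rho (lam : R) : (0 < L)%N -> (L <= N)%N ->
  (forall k, (N <= k)%N -> `|lam| * ga k * (2 * C) <= 2^-1) ->
  (\int[P]_w (expR (lam * class_sum L N j rho (seqV w)))%:E <=
   (expR (\sum_(N <= k < N + j) 2 * (`|lam| * ga k * (2 * C)) ^+ 2))%:E)%E.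
Proof.
move=> L0 LN hlam; elim: j => [|j IH].
  rewrite /class_sum addn0; under eq_integral do rewrite big_geq// mulr0 expR0.
  by rewrite integral_cst//= probability_setT mule1 big_geq// expR0.
rewrite addnS big_nat_recr ?leq_addr//=.
set E := \sum_(N <= k < N + j) _ in IH *.
set m := (N + j)%N in E IH *.
set b := `|lam| * ga m * (2 * C).
have b0 : 0 <= b.
  apply: mulr_ge0; first exact: mulr_ge0.
  by apply: mulr_ge0 => //; exact: ltW (wbound_gt0 al01 hbe).
have Lm : (L <= m.+1)%N by rewrite leqW// (leq_trans LN)// leq_addr.
have csS u : class_sum L N j.+1 rho u = class_sum L N j rho u +
    (if (m %% L == rho)%N then ga m * fluct L m u else 0).
  by rewrite /class_sum addnS big_mkcond big_nat_recr ?leq_addr//= -big_mkcond.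
have mS i : measurable_fun setT (fun u : seqspace UU => expR (lam * class_sum L N i rho u)).
  apply: (measurableT_comp (@measurable_expR R)); apply: measurable_funM => //.
  exact: measurable_class_sum.
rewrite expRD; case: (boolP (m %% L == rho)%N) csS => [mrho|_] csS; last first.
  under eq_integral do rewrite csS addr0.
  apply: (le_trans IH); rewrite lee_fin ler_peMr ?expR_ge0//.
  by rewrite -expR0 ler_expR mulr_ge0// sqr_ge0.
pose n := (m.+1 - L)%N.
have pS : past_dep n (class_sum L N j rho).
  move=> u u' uu'; rewrite /class_sum big_nat_cond [RHS]big_nat_cond.
  apply: eq_bigr => k /andP[/andP[Nk kNj] /eqP krho]; congr (_ * _).
  apply: (past_dep_fluct L0) => i ik; apply: uu'; apply: leq_trans ik _.
  (* two members of a residue class are at least L apart *)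
  rewrite ltn_subRL addnC ltnS; move/eqP: mrho => mrho.
  have : (k = m %[mod L])%N by rewrite krho mrho.
  move=> /eqP; rewrite eq_sym eqn_mod_dvd ?(ltnW kNj)// => /dvdn_leq h.
  by have := h ltac:(rewrite subn_gt0; exact: kNj); rewrite -/m in kNj *; lia.
have mh : measurable_fun setT (fun u : seqspace UU =>
    (expR (lam * class_sum L N j.+1 rho u))%:E).
  by apply/measurable_EFinP.
have mG : measurable_fun setT (fun w => (expR (lam * class_sum L N j rho (seqV w)))%:E).
  apply/measurable_EFinP.
  exact: (measurable_law iV (g := fun u => expR (lam * class_sum L N j rho u))).
apply: (le_trans (iidseq_splice_le (n := n)
   (h := fun u : seqspace UU => (expR (lam * class_sum L N j.+1 rho u))%:E)
   (G := fun w => ((expR (2 * b ^+ 2))%:E *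
      (expR (lam * class_sum L N j rho (seqV w)))%:E)%E) iV mh _ _ _)).
- by move=> u; rewrite lee_fin expR_ge0.
- exact: measurable_funeM.
- move=> w; pose x := th n (seqV w).
  pose Z w' := lam * ga m * (wdir al be eps L (fun i => y (V (m - i)%N w') x) - F L x).
  have eZ w' : (expR (lam * class_sum L N j.+1 rho (splice n (seqV w) (seqV w'))))%:E =
      ((expR (lam * class_sum L N j rho (seqV w)))%:E * (expR (Z w'))%:E)%E.
    rewrite csS mulrDr expRD (past_dep_splice _ _ pS) -EFinM; congr (_ * expR _)%:E.
    rewrite mulrA /fluct /frozen_dir -/n (past_dep_splice _ _ (@pth n)) /Z.
    congr (_ * (_ - _)); apply: wdir_ext => i iL; rewrite /splice ifF//.
    by apply/negbTE; rewrite -leqNgt /n; lia.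
  under eq_integral do rewrite eZ.
  have mD : measurable_fun setT (fun w' => wdir al be eps L (fun i => y (V (m - i)%N w') x)).
    apply: (measurable_wdir _ _ _ eps0 (a := fun i w => y (V (m - i)%N w) x)) => i.
    exact: (measurable_section_V my iV).
  have mZ : measurable_fun setT Z.
    by apply: measurable_funM => //; exact: measurable_funB.
  rewrite ge0_integralZl_EFin//; last first.
    by apply/measurable_EFinP; exact: (measurableT_comp (@measurable_expR R)).
  rewrite [leRHS]muleC lee_wpmul2l ?lee_fin ?expR_ge0//.
  have Fle : `|F L x| <= C := meanfield_le al01 hbe eps0 my iV L x.
  have bD w' : `|wdir al be eps L (fun i => y (V (m - i)%N w') x) - F L x| <= 2 * C.
    by rewrite (le_trans (ler_normB _ _))// mulr_natl mulr2n lerD// wdir_le.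
  apply: expectation_expR_le => //.
  - by move=> w'; rewrite /Z !normrM (ger0_norm (ga0 m)) ler_wpM2l// mulr_ge0.
  - exact: hlam (leq_addr _ _).
  - rewrite /Z RintegralZl//; first by rewrite fluct_centred ?mulr0.
    by apply: (bounded_integrable (C := 2 * C)) => //; exact: measurable_funB.
rewrite ge0_integralZl_EFin//.
by rewrite muleC EFinM lee_wpmul2r// lee_fin expR_ge0.
Qed.

End process.

(** * Powers and logarithms of the step sizes *)

Section powers.
Context {R : realType}.
Implicit Types q s e : R.

Lemma powR_small s e : 0 < s -> 0 < e ->
  exists2 r : R, 0 < r & forall q, 0 < q -> q <= r -> q `^ s <= e.
Proof.
move=> s0 e0; exists (e `^ s^-1); first exact: powR_gt0.
move=> q q0 qr.
rewrite (_ : e = (e `^ s^-1) `^ s); last first.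
  by rewrite -powRrM mulVf ?gt_eqF// powRr1// ltW.
by apply: ge0_ler_powR; rewrite ?nnegrE ?powR_ge0// ltW.
Qed.

Lemma powR_expR (x r : R) : expR x `^ r = expR (r * x).
Proof. by rewrite /powR gt_eqF ?expR_gt0// expRK. Qed.

(** The r-th power of [x <= exp x] at [x = c y / r]. *)
Lemma expR_powR_decay (r c y : R) : 0 < r -> 0 < c -> 0 < y ->
  expR (- (c * y)) <= (r / c) `^ r * y `^ (- r).
Proof.
move=> r0 c0 y0.
have h : (c / r * y) `^ r <= expR (c * y).
  rewrite (_ : expR (c * y) = expR (c / r * y) `^ r); last first.
    by rewrite powR_expR; congr expR; field; rewrite gt_eqF.
  apply: ge0_ler_powR; rewrite ?nnegrE ?expR_ge0 ?(ltW r0)//.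
    by rewrite mulr_ge0 ?divr_ge0// ltW.
  by apply: le_trans (expR_ge1Dx _); rewrite lerDr.
have e : (r / c) `^ r = ((c / r) `^ r)^-1.
  have cr0 : 0 <= c / r by rewrite divr_ge0// ltW.
  rewrite (_ : r / c = (c / r) `^ (-1)); last by rewrite powR_inv1// invf_div.
  by rewrite -powRrM mulN1r powRN.
rewrite expRN e powRN -invfM.
rewrite lef_pV2 ?posrE ?expR_gt0 ?mulr_gt0 ?powR_gt0 ?divr_gt0//.
by rewrite -powRM// ltW// divr_gt0.
Qed.

(** Geometric decay over a lag of length [q ^ (-1/3)] beats every power of [q];
    the power [p / 3] is the one that is summable. *)
Lemma expn_powR_decay (be p q : R) (L : nat) : 0 < be < 1 -> 0 < p -> 0 < q ->
  q `^ (- 3^-1) <= L%:R ->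
  be ^+ L <= (p / - ln be) `^ p * q `^ (p / 3).
Proof.
move=> /andP[be0 be1] p0 q0 qL.
have c0 : 0 < - ln be by rewrite oppr_gt0 ln_lt0// be0.
have y0 : 0 < q `^ (- 3^-1) by rewrite powR_gt0.
have -> : be ^+ L = expR (- (- ln be * L%:R)).
  by rewrite mulNr opprK mulrC expRM_natl lnK ?posrE.
apply: (@le_trans _ _ (expR (- (- ln be * q `^ (- 3^-1))))).
  by rewrite ler_expR lerN2 ler_wpM2l// ltW.
apply: (le_trans (expR_powR_decay p0 c0 y0)).
by rewrite -powRrM mulrNN [3^-1 * p]mulrC.
Qed.

(** Any positive exponent would do; 1/12 is small enough to leave a power of [q]
    in [window_sum_le], where 1/2 - 1/3 - 1/12 = 1/12. *)
Lemma ln_inv_le q : 0 < q -> - ln q <= 12 * q `^ (- 12^-1).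
Proof.
move=> q0; pose z := q `^ (- 12^-1); have z0 : 0 < z by rewrite powR_gt0.
have : ln z <= z.
  exact: ltW (ln_sublinear z0).
rewrite {1}/z ln_powR -/z => h; rewrite mulrC -ler_pdivrMr// (le_trans _ h)//.
by rewrite mulNr mulNr mulrC.
Qed.

End powers.

(** * Windows of elapsed time *)

Section grid.
Context {R : realType}.
Variable ga : nat -> R.

(** The training times of step sizes that are indexed from 0. *)
Definition ttime (n : nat) : R := \sum_(k < n) ga k.

Hypothesis ga_gt0 : forall k, 0 < ga k.
Hypothesis ga_decr : forall k, ga k.+1 <= ga k.
Hypothesis ga_unb : forall M, exists n, M <= ttime n.

Lemma ga_le k l : (k <= l)%N -> ga l <= ga k.
Proof. by move=> kl; rewrite -(subnK kl); elim: (l - k)%N => //= n; exact: le_trans (ga_decr _). Qed.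

Lemma ttimeS n : ttime n.+1 = ttime n + ga n.
Proof. by rewrite /ttime big_ord_recr. Qed.

Lemma ttime_sum m n : (m <= n)%N -> ttime n - ttime m = \sum_(m <= k < n) ga k.
Proof.
move=> mn; rewrite /ttime -!(big_mkord xpredT ga) (big_cat_nat (leq0n m) mn) /=.
by rewrite addrAC subrr add0r.
Qed.

Lemma ttime_le m n : (m <= n)%N -> ttime m <= ttime n.
Proof.
move=> mn; rewrite -subr_ge0 ttime_sum//; apply: sumr_ge0 => k _; exact: ltW.
Qed.

Lemma ttime_sub_le m n (r : R) : (m <= n)%N -> ga m <= r ->
  ttime n - ttime m <= (n - m)%:R * r.
Proof.
move=> mn mr; rewrite ttime_sum// (@le_trans _ _ (\sum_(m <= k < n) r))//.
  rewrite !big_nat; apply: ler_sum => k /andP[mk _].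
  exact: le_trans (ga_le mk) mr.
by rewrite sumr_const_nat mulr_natl.
Qed.

Variable delta : R.
Hypothesis delta0 : 0 < delta.

Definition next_index (m : nat) : nat := ex_minn (ga_unb (ttime m + delta)).

Definition grid (i : nat) : nat := iter i next_index 0%N.

Lemma next_index_ge m : delta <= ttime (next_index m) - ttime m.
Proof. by rewrite /next_index; case: ex_minnP => n h _; rewrite lerBrDl. Qed.

Lemma next_index_gt m : (m < next_index m)%N.
Proof.
rewrite ltnNge; apply/negP => /ttime_le h.
have := next_index_ge m; rewrite leNgt => /negP; apply.
by rewrite (le_lt_trans _ delta0)// subr_le0.
Qed.

Lemma next_index_le m : ttime (next_index m) - ttime m <= delta + ga m.
Proof.
have mn := next_index_gt m; move: mn; rewrite /next_index.
case: ex_minnP => -[//|n] h hmin mn.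
rewrite ttimeS addrAC; apply: lerD; last exact: ga_le.
rewrite lerBlDl leNgt; apply/negP => /ltW/hmin; by rewrite ltnn.
Qed.

Lemma grid_lt i : (grid i < grid i.+1)%N. Proof. exact: next_index_gt. Qed.

Lemma grid_ge i : (i <= grid i)%N.
Proof. by elim: i => // i IH; exact: leq_ltn_trans IH (grid_lt i). Qed.

Lemma grid_le i j : (i <= j)%N -> (grid i <= grid j)%N.
Proof.
move=> ij; rewrite -(subnK ij); elim: (j - i)%N => // n IH.
by rewrite addSn (leq_trans IH)// ltnW// grid_lt.
Qed.

(** In a window the step sizes add up to at least [delta] and exceed the one at
    its end, so its powers [1 + s] add up to at least [delta] times the power
    [s] of the latter. *)
Lemma grid_summable (s B : R) : 0 <= s ->
  (forall n, \sum_(k < n) ga k `^ (1 + s) <= B) ->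
  forall n, \sum_(i < n) ga (grid i) `^ s <= ga 0%N `^ s + B / delta.
Proof.
move=> s0 hB.
have key n : delta * \sum_(i < n) ga (grid i.+1) `^ s <=
    \sum_(k < grid n) ga k `^ (1 + s).
  elim: n => [|n IH]; first by rewrite !big_ord0 mulr0.
  rewrite big_ord_recr /= mulrDr.
  rewrite -!(big_mkord xpredT (fun k => ga k `^ (1 + s))) in IH *.
  rewrite (big_cat_nat (leq0n (grid n)) (ltnW (grid_lt n))) /=.
  apply: lerD => //.
  apply: (@le_trans _ _ (\sum_(grid n <= k < grid n.+1) ga k * ga (grid n.+1) `^ s)).
    rewrite -mulr_suml ler_wpM2r ?powR_ge0//.
    by rewrite -ttime_sum ?(ltnW (grid_lt n))// next_index_ge.
  rewrite !big_nat; apply: ler_sum => k /andP[_ kn].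
  rewrite powRD; last by rewrite (gt_eqF (ga_gt0 k)) implybT.
  rewrite powRr1 ?(ltW (ga_gt0 k))// ler_wpM2l ?(ltW (ga_gt0 k))//.
  apply: ge0_ler_powR; rewrite ?nnegrE ?(ltW (ga_gt0 _))//.
  by apply: ga_le; exact: ltnW.
case=> [|n].
  rewrite big_ord0 addr_ge0 ?powR_ge0// divr_ge0 ?(ltW delta0)//.
  by have := hB 0%N; rewrite big_ord0.
rewrite big_ord_recl lerD2l ler_pdivlMr// mulrC.
exact: le_trans (key n) (hB _).
Qed.

End grid.

(** The lag q ^ (- 1/3): long enough for the discounted past to vanish, short
    enough for the parameter to move by little. *)
Definition lag (R : realType) (q : R) : nat := (Num.truncn (q `^ (- 3^-1))).+1.

Section lag.
Context {R : realType}.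
Implicit Types q : R.

Lemma lag_ge q : q `^ (- 3^-1) <= (lag q)%:R.
Proof. by rewrite /lag; apply/ltW/truncnS_gt. Qed.

Lemma lag_le q : 0 < q -> q <= 1 -> (lag q)%:R <= 2 * q `^ (- 3^-1).
Proof.
move=> q0 q1; rewrite /lag -natr1 mulr_natl mulr2n; apply: lerD.
  by rewrite truncn_le// powR_ge0.
rewrite -[leLHS](powRr0 q).
by apply: ger_powR; rewrite ?q0 ?q1// oppr_le0.
Qed.

Lemma lag_mul_le q : 0 < q -> q <= 1 -> (lag q)%:R * q <= 2 * q `^ (2 / 3).
Proof.
move=> q0 q1; rewrite (_ : q `^ (2 / 3) = q `^ (- 3^-1) * q); last first.
  rewrite (_ : 2 / 3 = - 3^-1 + 1); last by field.
  by rewrite powRD ?(gt_eqF q0) ?implybT// powRr1// ltW.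
by rewrite mulrA ler_wpM2r ?(ltW q0)// lag_le.
Qed.

End lag.

(** * The drift error of a window *)

Section process.
Context {R : realType} {al be eps p K : R} {d : nat}.
Hypotheses (al01 : 0 <= al < 1) (hbe : al ^+ 2 < be < 1) (eps0 : 0 < eps).
Hypotheses (p2 : 2 <= p) (K0 : 0 <= K).
Context {dU : measure_display} {UU : measurableType dU}.
Variable mu : {measure set UU -> \bar R}.
Variable y : UU -> 'rV[R]_d -> R.
Hypothesis my : measurable_fun setT (fun x : UU * borel_rV R d => y x.1 x.2).
Hypothesis hK : forall th, (\int[mu]_u (`|y u th| `^ p)%:E <= K%:E)%E.
Hypothesis hL : forall th th',
  (\int[mu]_u (`|y u th - y u th'| `^ p)%:E <= (K * `|th - th'| `^ p)%:E)%E.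
Context {dT : measure_display} {T : measurableType dT} {P : probability T R}.
Variable V : nat -> T -> UU.
Hypothesis iV : iidseq P V mu.
Variable th : nat -> (nat -> UU) -> 'rV[R]_d.
Hypothesis mth : forall n, measurable_fun setT (th n : seqspace UU -> borel_rV R d).
Hypothesis pth : forall n, past_dep n (th n).
Variable ga : nat -> R.
Hypothesis ga_gt0 : forall k, 0 < ga k.
Hypothesis ga_decr : forall k, ga k.+1 <= ga k.
Hypothesis ga_unb : forall M, exists n, M <= ttime ga n.
Variable Cs : R.
Hypothesis Cs0 : 0 <= Cs.
Hypothesis th_step : forall n u, `|th n.+1 u - th n u| <= Cs * ga n.
Variable delta : R.
Hypothesis delta0 : 0 < delta.

Local Notation F := (meanfield al be eps y P V).
Local Notation C := (wbound al be).
Local Notation seqV w := (fun k => V k w).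
Local Notation G := (grid ga_unb delta).
Local Notation q i := (ga (G i)).
Local Notation L i := (lag (ga (G i))).
Local Notation csum i rho := (class_sum (al := al) (be := be) (eps := eps) (P := P)
  y V th ga (L i) (G i.+1) (G i.+2 - G i.+1) rho).

Lemma th_move m n u : (m <= n)%N ->
  `|th n u - th m u| <= Cs * (ttime ga n - ttime ga m).
Proof.
move=> mn; rewrite -(subnK mn); elim: (n - m)%N => [|k IH].
  by rewrite add0n !subrr normr0 mulr0.
rewrite addSn ttimeS (_ : th _ u - th m u = (th (k + m).+1 u - th (k + m) u) +
  (th (k + m) u - th m u)); last by rewrite addrA subrK.
rewrite (le_trans (ler_normD _ _))// (_ : Cs * _ = Cs * ga (k + m)%N +
  Cs * (ttime ga (k + m) - ttime ga m)); first by rewrite lerD.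
by ring.
Qed.

Definition window_err i (u : nat -> UU) : R :=
  \sum_(G i.+1 <= k < G i.+2) ga k * history_err be p y th (L i) k u.

(** The two parts measure the errors of freezing and the martingale sums.  The
    weight [q ^ ((p + 1) / 3)] compensates for the [q ^ (-1/3)] residue classes,
    and it is harmless for [csum_le] because the logarithm of a power of [q] is
    only [|log q|].  The window [i.+1] is measured by the step size at the
    beginning of the window before, which is at least one lag long. *)
Definition window_var i (u : nat -> UU) : R :=
  window_err i u + q i `^ ((p + 1) / 3) *
    \sum_(rho < L i) (expR (q i `^ (- 2^-1) * csum i rho u) +
                      expR (- q i `^ (- 2^-1) * csum i rho u)).

Lemma window_err_ge0 i u : 0 <= window_err i u.
Proof.
apply: sumr_ge0 => k _; rewrite mulr_ge0 ?(ltW (ga_gt0 _))//.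
exact: history_err_ge0 hbe _ _ _.
Qed.

Lemma measurable_window_err i :
  measurable_fun setT (fun u : seqspace UU => window_err i u).
Proof.
apply: measurable_sum => k; apply: measurable_funM => //.
exact: (measurable_history_err my mth).
Qed.

Lemma measurable_csum i rho (c : R) :
  measurable_fun setT (fun u : seqspace UU => expR (c * csum i rho u)).
Proof.
apply: (measurableT_comp (@measurable_expR R)); apply: measurable_funM => //.
exact: (measurable_class_sum al01 hbe eps0 p2 K0 my hL iV mth).
Qed.

Lemma measurable_window_var i :
  measurable_fun setT (fun u : seqspace UU => window_var i u).
Proof.
apply: measurable_funD; first exact: measurable_window_err.
apply: measurable_funM => //; apply: measurable_sum => rho.
by apply: measurable_funD; exact: measurable_csum.
Qed.

Lemma window_var_ge0 i u : 0 <= window_var i u.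
Proof.
apply: addr_ge0; first exact: window_err_ge0.
rewrite mulr_ge0 ?powR_ge0//; apply: sumr_ge0 => rho _.
by rewrite addr_ge0// expR_ge0.
Qed.

(** The second condition bounds the length of a window, the third makes a lag fit
    into a window, and the last one puts the martingale increments, multiplied
    by [q ^ (-1/2)], in the range of [expectation_expR_le]. *)
Definition small_window i : Prop :=
  [/\ q i <= 1, q i <= delta, 2 * q i `^ (2 / 3) <= delta &
      2 * C * q i `^ (2^-1) <= 2^-1].

Lemma small_windowP : exists2 r : R, 0 < r & forall i, q i <= r -> small_window i.
Proof.
have C0 := wbound_gt0 al01 hbe.
have s0 : (0 : R) < 2 / 3 by rewrite divr_gt0.
have s1 : (0 : R) < 2^-1 by rewrite invr_gt0.
have e1 : 0 < delta / 2 by rewrite divr_gt0.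
have e2 : 0 < (4 * C)^-1 by rewrite invr_gt0 mulr_gt0.
have [r1 r10 h1] := powR_small s0 e1.
have [r2 r20 h2] := powR_small s1 e2.
exists (Num.min (Num.min 1 delta) (Num.min r1 r2)).
  by rewrite !lt_min ltr01 delta0 r10 r20.
move=> i; rewrite !le_min => /andP[/andP[q1 qd] /andP[qr1 qr2]]; split=> //.
  by rewrite mulrC -ler_pdivlMr// h1.
rewrite (@le_trans _ _ (2 * C * (4 * C)^-1))//.
  by rewrite ler_wpM2l ?h2// mulr_ge0// ltW.
rewrite le_eqVlt; apply/orP; left; apply/eqP; field.
by rewrite gt_eqF.
Qed.

Section small.
Variable i : nat.
Hypothesis sw : small_window i.

Let m := G i.
Let N := G i.+1.
Let N' := G i.+2.

Let q0 : 0 < q i := ga_gt0 _.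

Lemma ga_le_q k : (m <= k)%N -> ga k <= q i.
Proof. exact: ga_le. Qed.

Lemma window_time : \sum_(N <= k < N') ga k <= 2 * delta.
Proof.
have [_ qd _ _] := sw.
rewrite -ttime_sum// ?(ltnW (grid_lt _ _ delta0 _))//.
rewrite (le_trans (next_index_le ga_gt0 ga_decr ga_unb delta0 _))//.
rewrite mulr_natl mulr2n lerD2l (le_trans _ qd)//.
by apply: ga_le => //; exact: ltnW (grid_lt _ _ delta0 _).
Qed.

Lemma lag_fits : (L i <= N - m)%N.
Proof.
have [q1 _ q23 _] := sw.
have mN : (m <= N)%N by apply: ltnW (grid_lt _ _ delta0 _).
have h : delta <= (N - m)%:R * q i.
  apply: le_trans (next_index_ge ga_unb delta m) _.
  exact: ttime_sub_le.
rewrite -(ler_nat R) -(ler_pM2r q0); apply: le_trans h.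
exact: le_trans (lag_mul_le q0 q1) q23.
Qed.

Lemma lag_le_index k : (N <= k)%N -> (L i <= k.+1)%N.
Proof. by move=> Nk; have := lag_fits; rewrite /N in Nk *; lia. Qed.

Lemma lag_move k j u : (N <= k)%N -> (j < L i)%N ->
  `|th (k - j) u - th (k.+1 - L i) u| <= Cs * ((L i)%:R * q i).
Proof.
move=> Nk jL; have hf := lag_fits.
have mN : (m < N)%N by apply: grid_lt.
have h1 : (k.+1 - L i <= k - j)%N by lia.
rewrite (le_trans (th_move u h1))// ler_wpM2l//.
have h2 : (m <= k.+1 - L i)%N by lia.
rewrite (le_trans (ttime_sub_le ga_decr h1 (ga_le_q h2)))//.
by rewrite ler_wpM2r ?(ltW q0)// ler_nat; lia.
Qed.

Lemma expected_window_err :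
  (\int[P]_w (window_err i (seqV w))%:E <=
   (2 * delta * (K * (Cs * ((L i)%:R * q i)) `^ p + K * be ^+ L i))%:E)%E.
Proof.
have be0 := ltW (be_gt0 hbe).
set A := K * _ `^ p + _.
have A0 : 0 <= A by rewrite addr_ge0// mulr_ge0 ?powR_ge0 ?exprn_ge0.
under eq_integral do rewrite /window_err -sumEFin.
rewrite ge0_integral_sum//; last 2 first.
- move=> k; apply/measurable_EFinP; apply: measurable_funM => //.
  by apply: (measurable_law iV (g := history_err be p y th (L i) k));
     exact: (measurable_history_err my mth).
- move=> k w _; rewrite lee_fin mulr_ge0 ?(ltW (ga_gt0 _))//.
  exact: history_err_ge0 hbe _ _ _.
apply: (@le_trans _ _ (\sum_(N <= k < N') (ga k * A)%:E)%E); last first.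
  by rewrite sumEFin lee_fin -mulr_suml ler_wpM2r// window_time.
rewrite big_seq [leRHS]big_seq; apply: lee_sum => k.
rewrite mem_index_iota => /andP[Nk _].
under eq_integral do rewrite EFinM.
rewrite ge0_integralZl_EFin//; last 3 first.
- by move=> w _; rewrite lee_fin; exact: history_err_ge0 hbe _ _ _.
- apply/measurable_EFinP.
  by apply: (measurable_law iV (g := history_err be p y th (L i) k));
     exact: (measurable_history_err my mth).
- exact: ltW.
rewrite EFinM lee_wpmul2l ?lee_fin ?(ltW (ga_gt0 _))//.
apply: (expected_history_err al01 hbe eps0 p2 K0 my hK hL iV mth pth).
- exact: lag_le_index.
- by rewrite mulr_ge0// mulr_ge0// ltW.
- by move=> j u jL; exact: lag_move.
Qed.

(** The exponents of [class_sum_exp] add up to [O(lam ^ 2 q)] times the length of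
    the window, which is of order 1 at the scale [lam = q ^ (-1/2)]. *)
Lemma expected_csum_exp (lam : R) rho : `|lam| = q i `^ (- 2^-1) ->
  (\int[P]_w (expR (lam * csum i rho (seqV w)))%:E <=
   (expR (16 * C ^+ 2 * delta))%:E)%E.
Proof.
move=> hlam; have [q1 _ _ qC] := sw.
have C0 := wbound_gt0 al01 hbe.
have lq : `|lam| * q i = q i `^ 2^-1.
  rewrite hlam -[X in _ * X](powRr1 (ltW q0)) -powRD ?(gt_eqF q0) ?implybT//.
  by congr (_ `^ _); field.
have hb k : (N <= k)%N -> `|lam| * ga k * (2 * C) <= 2^-1.
  move=> Nk; apply: le_trans qC; rewrite [leRHS]mulrC ler_wpM2r//.
    by rewrite mulr_ge0// ltW.
  rewrite -lq ler_wpM2l// ga_le_q//; apply: leq_trans Nk.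
  exact: ltnW (grid_lt _ _ delta0 _).
have L0 : (0 < L i)%N by [].
have LN : (L i <= N)%N by apply: leq_trans lag_fits _; exact: leq_subr.
apply: (le_trans (class_sum_exp al01 hbe eps0 p2 K0 my hL iV mth pth
   (fun k => ltW (ga_gt0 k)) (N' - N) rho L0 LN hb)).
rewrite subnKC; last by apply: ltnW (grid_lt _ _ delta0 _).
rewrite lee_fin ler_expR.
have c80 : 0 <= 8 * C ^+ 2 by apply: mulr_ge0 => //; exact: sqr_ge0.
apply: (@le_trans _ _ (\sum_(N <= k < N') 8 * C ^+ 2 * ga k)).
  rewrite !big_nat; apply: ler_sum => k /andP[Nk _].
  rewrite (_ : 2 * (`|lam| * ga k * (2 * C)) ^+ 2 = 8 * C ^+ 2 * (`|lam| ^+ 2 * ga k) * ga k); last by ring.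
  rewrite ler_wpM2r ?(ltW (ga_gt0 _))// ler_piMr//.
  apply: (@le_trans _ _ (`|lam| ^+ 2 * q i)).
    rewrite ler_wpM2l ?sqr_ge0// ga_le_q//; apply: leq_trans Nk.
    exact: ltnW (grid_lt _ _ delta0 _).
  rewrite expr2 -mulrA lq hlam -powRD ?(gt_eqF q0) ?implybT//.
  by rewrite addNr powRr0.
rewrite -mulr_sumr (_ : 16 * C ^+ 2 * delta = 8 * C ^+ 2 * (2 * delta)); last by ring.
by rewrite ler_wpM2l ?window_time.
Qed.

Lemma expected_window_var :
  (\int[P]_w (window_var i (seqV w))%:E <=
   ((2 * delta * (K * (2 * Cs) `^ p + K * (p / - ln be) `^ p) +
     4 * expR (16 * C ^+ 2 * delta)) * q i `^ (p / 3))%:E)%E.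
Proof.
have [q1 _ _ _] := sw.
have be0 := be_gt0 hbe; have be1 : be < 1 by case/andP: hbe.
have p0 : 0 < p by apply: lt_le_trans p2.
have mV (g : seqspace UU -> R) : measurable_fun setT g ->
   measurable_fun setT (fun w => g (seqV w)) by exact: measurable_law iV _.
have mE rho c := mV _ (measurable_csum i rho c).
have mW := mV _ (measurable_window_err i).
rewrite /window_var; under eq_integral do rewrite EFinD.
rewrite ge0_integralD//; last 4 first.
- by move=> w _; rewrite lee_fin window_err_ge0.
- exact/measurable_EFinP.
- move=> w _; rewrite lee_fin mulr_ge0 ?powR_ge0//; apply: sumr_ge0 => rho _.
  by rewrite addr_ge0// expR_ge0.
- apply/measurable_EFinP; apply: measurable_funM => //; apply: measurable_sum => rho.
  by apply: measurable_funD; exact: mE.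
rewrite [X in (_ <= X%:E)%E]mulrDl EFinD; apply: leeD.
  apply: (le_trans expected_window_err).
  rewrite lee_fin -[leRHS]mulrA ler_wpM2l ?mulr_ge0 ?(ltW delta0)//.
  rewrite mulrDl; apply: lerD; rewrite -[leRHS]mulrA ler_wpM2l//; last first.
    by apply: expn_powR_decay => //; [rewrite be0|exact: lag_ge].
  apply: (@le_trans _ _ ((2 * Cs * q i `^ (2 / 3)) `^ p)).
    apply: ge0_ler_powR; rewrite ?nnegrE ?(ltW p0)//.
    - by rewrite mulr_ge0// mulr_ge0// ltW.
    - by rewrite !mulr_ge0// powR_ge0.
    - by rewrite (mulrC 2) -[leRHS]mulrA ler_wpM2l// lag_mul_le.
  rewrite powRM ?mulr_ge0 ?powR_ge0// -powRrM ler_wpM2l ?powR_ge0//.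
  apply: ger_powR; first by rewrite q0.
  have : p / 3 <= p by rewrite ler_pdivrMr//; lra.
  lra.
under eq_integral do rewrite EFinM.
rewrite ge0_integralZl_EFin ?powR_ge0//; last 2 first.
- move=> w _; rewrite lee_fin; apply: sumr_ge0 => rho _.
  by rewrite addr_ge0// expR_ge0.
- apply/measurable_EFinP; apply: measurable_sum => rho.
  by apply: measurable_funD; exact: mE.
under eq_integral do rewrite -sumEFin.
rewrite ge0_integral_sum//; last first.
  by move=> rho; apply/measurable_EFinP; apply: measurable_funD; exact: mE.
set M := expR (16 * C ^+ 2 * delta).
apply: (@le_trans _ _ ((q i `^ ((p + 1) / 3))%:E * (\sum_(rho < L i) (2 * M)%:E))%E).
  rewrite lee_wpmul2l ?lee_fin ?powR_ge0//; apply: lee_sum => rho _.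
  under eq_integral do rewrite EFinD.
  rewrite ge0_integralD//; last 2 first.
  - by apply/measurable_EFinP; exact: mE.
  - by apply/measurable_EFinP; exact: mE.
  rewrite mulr_natl mulr2n EFinD; apply: leeD; apply: expected_csum_exp.
    by rewrite ger0_norm// powR_ge0.
  by rewrite normrN ger0_norm// powR_ge0.
rewrite sumEFin -EFinM lee_fin sumr_const card_ord -[_ *+ L i]mulr_natl.
have M0 : 0 <= M by exact: expR_ge0.
apply: (@le_trans _ _ (q i `^ ((p + 1) / 3) * (2 * q i `^ (- 3^-1) * (2 * M)))).
  by rewrite ler_wpM2l ?powR_ge0// ler_wpM2r ?mulr_ge0// lag_le.
rewrite (_ : q i `^ ((p + 1) / 3) * _ =
   4 * M * (q i `^ ((p + 1) / 3) * q i `^ (- 3^-1))); last by ring.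
rewrite -powRD ?(gt_eqF q0) ?implybT//.
by rewrite (_ : (p + 1) / 3 - 3^-1 = p / 3)//; field.
Qed.

Lemma sum_csum u : \sum_(rho < L i) csum i rho u =
  \sum_(N <= k < N') ga k * fluct (al := al) (be := be) (eps := eps) (P := P) y V th (L i) k u.
Proof.
rewrite /class_sum subnKC; last by apply: ltnW (grid_lt _ _ delta0 _).
under eq_bigr do rewrite big_mkcond /=.
rewrite exchange_big /=; apply: eq_bigr => k _.
have kL : (k %% L i < L i)%N by rewrite ltn_mod.
rewrite (bigD1 (Ordinal kL))//= eqxx big1 ?addr0// => rho.
by rewrite -val_eqE /= eq_sym => /negPf ->.
Qed.

(** Taking logarithms in the exponential moments turns a bound of the window
    variable into a pathwise bound of the martingale sums. *)
Lemma csum_le u rho : window_var i u <= 1 -> (rho < L i)%N ->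
  `|csum i rho u| <= q i `^ (2^-1) * ((p + 1) / 3 * (12 * q i `^ (- 12^-1))).
Proof.
move=> Z1 rL; set S := csum i rho u; set s := (p + 1) / 3.
set lam := q i `^ (- 2^-1).
have lam0 : 0 < lam by exact: powR_gt0.
have s0 : 0 < s by rewrite divr_gt0//; move: p2; lra.
have h1 : q i `^ s * expR (lam * `|S|) <= 1.
  apply: le_trans Z1; rewrite /window_var -[leLHS]add0r lerD ?window_err_ge0//.
  rewrite ler_wpM2l ?powR_ge0//.
  rewrite (bigD1 (Ordinal rL))//= -/S -/lam -[leLHS]addr0 lerD//; last first.
    by apply: sumr_ge0 => r _; rewrite addr_ge0// expR_ge0.
  have [_|_] := ger0P S; first by rewrite lerDl expR_ge0.
  by rewrite mulrN mulNr lerDr expR_ge0.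
have h2 : lam * `|S| <= s * - ln (q i).
  rewrite -ler_expR mulrN expRN -(powR_expR (ln (q i)) s) lnK ?posrE//.
  by rewrite -[leRHS]mul1r ler_pdivlMr ?powR_gt0// mulrC.
have -> : q i `^ 2^-1 = lam^-1 by rewrite /lam powRN invrK.
rewrite ler_pdivlMl// (le_trans h2)// ler_wpM2l ?(ltW s0)//.
exact: ln_inv_le.
Qed.

Variable Finf : 'rV[R]_d -> R.
Hypothesis hF : forall x, F n x @[n --> \oo] --> Finf x.

Local Notation Q := (2 * C / eps).

Lemma meanfield_rate l x : `|F l x - Finf x| <= Q * (2 + K) * Num.sqrt be ^+ l.
Proof.
apply/ler_addgt0Pr => e e0.
have /cvgrPdist_le /(_ e e0) [n0 _ hn] := @hF x.
have := hn (maxn n0 l) (leq_maxl _ _); rewrite distrC => h1.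
rewrite (_ : F l x - Finf x = (F l x - F (maxn n0 l) x) +
  (F (maxn n0 l) x - Finf x)); last by rewrite addrA subrK.
rewrite (le_trans (ler_normD _ _))// lerD//.
exact: (meanfield_cauchy al01 hbe eps0 p2 K0 my hK iV _ (leq_maxr _ _)).
Qed.

(** The range is the window after the one that provides the lag. *)
Definition window_sum u : R := \sum_(N <= k < N') ga k *
  (full_dir al be eps y th k u - Finf (th k u)).

Definition window_rate : R := 24 * ((p + 1) / 3) +
  2 * delta * (Q * (2 + K) * (2 * Cs + (p / - ln (Num.sqrt be)) `^ p)).

(** Three parts: the error of freezing, the martingale sums, and the difference
    of the finite mean field at the frozen parameter from the limiting one at
    the current parameter. *)
Lemma window_sum_le u eta : 0 < eta -> window_var i u <= 1 ->
  `|window_sum u| <= Q * (4 * eta * delta + eta `^ (1 - p) * window_var i u) +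
     window_rate * q i `^ (12^-1).
Proof.
move=> e0 Z1; have [q1 _ _ _] := sw.
have be0 := be_gt0 hbe; have be1 : be < 1 by case/andP: hbe.
have Q0 : 0 <= Q := wdir_lip_const_ge0 al01 hbe eps0.
have Q20 : 0 <= Q * (2 + K) by rewrite mulr_ge0// addr_ge0.
have qs (s : R) : 12^-1 <= s -> q i `^ s <= q i `^ (12^-1).
  by move=> hs; apply: ger_powR; rewrite ?q0.
pose e1 k := full_dir al be eps y th k u - frozen_dir al be eps y th (L i) k u.
pose e2 k := fluct (al := al) (be := be) (eps := eps) (P := P) y V th (L i) k u.
pose e3 k := F (L i) (th (k.+1 - L i) u) - Finf (th k u).
have eqS : window_sum u = \sum_(N <= k < N') ga k * e1 k +
    \sum_(N <= k < N') ga k * e2 k + \sum_(N <= k < N') ga k * e3 k.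
  rewrite -!big_split /=; apply: eq_bigr => k _; rewrite -!mulrDr; congr (_ * _).
  rewrite /e1 /e2 /e3 /fluct; ring.
have b1 : `|\sum_(N <= k < N') ga k * e1 k| <=
    Q * (4 * eta * delta + eta `^ (1 - p) * window_var i u).
  apply: (@le_trans _ _ (\sum_(N <= k < N') ga k * (Q * (2 * eta + eta `^ (1 - p) *
      history_err be p y th (L i) k u)))).
    rewrite (le_trans (ler_norm_sum _ _ _))// !big_nat; apply: ler_sum => k /andP[Nk _].
    rewrite normrM (ger0_norm (ltW (ga_gt0 k))) ler_wpM2l ?(ltW (ga_gt0 k))//.
    exact: (full_frozen _ _ al01 hbe eps0 p2 _ (lag_le_index Nk) e0).
  rewrite (eq_bigr (fun k => Q * (2 * eta) * ga k + Q * eta `^ (1 - p) *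
     (ga k * history_err be p y th (L i) k u))); last by move=> k _; ring.
  rewrite big_split /= -!mulr_sumr mulrDr; apply: lerD.
    rewrite -[leLHS]mulrA ler_wpM2l// (_ : 4 * eta * delta = 2 * eta * (2 * delta)); last by ring.
    by rewrite ler_wpM2l ?window_time// mulr_ge0// ltW.
  rewrite -[leLHS]mulrA ler_wpM2l// ler_wpM2l ?powR_ge0//.
  rewrite /window_var lerDl mulr_ge0 ?powR_ge0//; apply: sumr_ge0 => rho _.
  by rewrite addr_ge0// expR_ge0.
have b2 : `|\sum_(N <= k < N') ga k * e2 k| <= 24 * ((p + 1) / 3) * q i `^ (12^-1).
  rewrite -sum_csum (le_trans (ler_norm_sum _ _ _))//.
  apply: (@le_trans _ _ (\sum_(rho < L i)
     q i `^ (2^-1) * ((p + 1) / 3 * (12 * q i `^ (- 12^-1))))).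
    by apply: ler_sum => rho _; exact: csum_le.
  rewrite sumr_const card_ord -[leLHS]mulr_natl.
  set s := (p + 1) / 3; have s0 : 0 <= s by rewrite divr_ge0//; move: p2; lra.
  clearbody s; apply: (@le_trans _ _ (2 * q i `^ (- 3^-1) *
     (q i `^ (2^-1) * (s * (12 * q i `^ (- 12^-1)))))).
    rewrite ler_wpM2r ?lag_le//.
    by rewrite !mulr_ge0 ?powR_ge0.
  rewrite (_ : 2 * _ * _ = 24 * s * (q i `^ (- 3^-1) * q i `^ (2^-1) * q i `^ (- 12^-1)));
    last by ring.
  rewrite -!powRD ?(gt_eqF q0) ?implybT//.
  by rewrite (_ : - 3^-1 + 2^-1 - 12^-1 = 12^-1)//; field.
have b3 : `|\sum_(N <= k < N') ga k * e3 k| <=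
    2 * delta * (Q * (2 + K) * (2 * Cs + (p / - ln (Num.sqrt be)) `^ p)) * q i `^ (12^-1).
  apply: (@le_trans _ _ (\sum_(N <= k < N') ga k *
     (Q * (2 + K) * (2 * Cs + (p / - ln (Num.sqrt be)) `^ p) * q i `^ (12^-1)))).
    rewrite (le_trans (ler_norm_sum _ _ _))// !big_nat; apply: ler_sum => k /andP[Nk _].
    rewrite normrM (ger0_norm (ltW (ga_gt0 k))) ler_wpM2l ?(ltW (ga_gt0 k))//.
    rewrite /e3 (_ : F _ _ - _ = (F (L i) (th (k.+1 - L i) u) - F (L i) (th k u)) +
      (F (L i) (th k u) - Finf (th k u))); last by rewrite addrA subrK.
    rewrite (le_trans (ler_normD _ _))//.
    set Kb := (p / - ln (Num.sqrt be)) `^ p; set z := q i `^ 12^-1.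
    rewrite (_ : Q * (2 + K) * (2 * Cs + Kb) * z =
      Q * (2 + K) * (2 * Cs * z) + Q * (2 + K) * (Kb * z)); last by ring.
    apply: lerD.
      apply: (le_trans (meanfield_lip al01 hbe eps0 p2 K0 my hL iV _ _ _)).
      rewrite ler_wpM2l// distrC; have := @lag_move k 0%N u Nk isT; rewrite subn0 => h.
      rewrite (le_trans h)// (_ : 2 * Cs * z = Cs * (2 * z)); last by ring.
      rewrite ler_wpM2l// (le_trans (lag_mul_le q0 q1))// ler_wpM2l// qs//; lra.
    apply: (le_trans (meanfield_rate _ _)); rewrite ler_wpM2l//.
    have sb : 0 < Num.sqrt be < 1.
      by rewrite sqrtr_gt0 be0 -sqrtr1 ltr_sqrt.
    have p0 : 0 < p by apply: lt_le_trans p2.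
    apply: (le_trans (expn_powR_decay sb p0 q0 (lag_ge _))).
    rewrite ler_wpM2l ?powR_ge0// qs//; move: p2; lra.
  rewrite -mulr_suml -[leRHS]mulrA ler_wpM2r ?window_time//.
  apply: mulr_ge0; last exact: powR_ge0.
  by apply: mulr_ge0 => //; rewrite addr_ge0 ?powR_ge0// mulr_ge0.
rewrite eqS; apply: (le_trans (ler_normD _ _)).
apply: (le_trans (lerD (le_trans (ler_normD _ _) (lerD b1 b2)) b3)).
by rewrite -addrA lerD2l -mulrDl.
Qed.

End small.

End process.

Section process.
Context {R : realType} {al be eps p K : R} {d : nat}.
Hypotheses (al01 : 0 <= al < 1) (hbe : al ^+ 2 < be < 1) (eps0 : 0 < eps).
Hypotheses (p2 : 2 <= p) (K0 : 0 <= K).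
Context {dU : measure_display} {UU : measurableType dU}.
Variable mu : {measure set UU -> \bar R}.
Variable y : UU -> 'rV[R]_d -> R.
Hypothesis my : measurable_fun setT (fun x : UU * borel_rV R d => y x.1 x.2).
Hypothesis hK : forall th, (\int[mu]_u (`|y u th| `^ p)%:E <= K%:E)%E.
Hypothesis hL : forall th th',
  (\int[mu]_u (`|y u th - y u th'| `^ p)%:E <= (K * `|th - th'| `^ p)%:E)%E.
Context {dT : measure_display} {T : measurableType dT} {P : probability T R}.
Variable V : nat -> T -> UU.
Hypothesis iV : iidseq P V mu.
Variable th : nat -> (nat -> UU) -> 'rV[R]_d.
Hypothesis mth : forall n, measurable_fun setT (th n : seqspace UU -> borel_rV R d).
Hypothesis pth : forall n, past_dep n (th n).
Variable ga : nat -> R.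
Hypothesis ga_gt0 : forall k, 0 < ga k.
Hypothesis ga_decr : forall k, ga k.+1 <= ga k.
Hypothesis ga_unb : forall M, exists n, M <= ttime ga n.
Variable Cs : R.
Hypothesis Cs0 : 0 <= Cs.
Hypothesis th_step : forall n u, `|th n.+1 u - th n u| <= Cs * ga n.
Variable delta : R.
Hypothesis delta0 : 0 < delta.

Local Notation F := (meanfield al be eps y P V).
Local Notation C := (wbound al be).
Local Notation seqV w := (fun k => V k w).
Local Notation G := (grid ga_unb delta).
Local Notation q i := (ga (G i)).
Variable B : R.
Hypothesis ga_sum : forall n, \sum_(k < n) ga k `^ (1 + p / 3) <= B.
Hypothesis ga_cvg0 : ga @ \oo --> 0.
Variable Finf : 'rV[R]_d -> R.
Hypothesis hF : forall x, F n x @[n --> \oo] --> Finf x.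

Local Notation Z := (window_var (al := al) (be := be) (eps := eps) (p := p) (P := P)
  y V th ga_unb delta).
Local Notation W := (window_sum (al := al) (be := be) (eps := eps)
  y th ga_unb delta).

Lemma grid_step_cvg0 : q n @[n --> \oo] --> 0.
Proof.
apply/cvgrPdist_le => e e0.
move/cvgrPdist_le : ga_cvg0 => /(_ e e0) [n0 _ hn].
exists n0 => // n /= n0n; apply: hn => /=.
exact: leq_trans n0n (grid_ge _ _ delta0 _).
Qed.

(** The window variables are almost surely summable and therefore tend to zero.
    In [window_sum_le] the scale [eta] is fixed first, so that the first term is
    below [e / 2] as soon as the window variable is small. *)
Lemma window_sums_cvg0 : {ae P, forall w, W i Finf (seqV w) @[i --> \oo] --> 0}.
Proof.
have p0 : 0 < p by apply: lt_le_trans p2.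
have [r r0 hr] := small_windowP al01 hbe ga_gt0 ga_unb delta0.
have [i0 _ hi0] : \forall i \near \oo, q i <= r.
  move/cvgrPdist_le : grid_step_cvg0 => /(_ r r0); apply: filterS => i.
  by rewrite sub0r normrN; apply: le_trans; exact: ler_norm.
have sw i : small_window (al := al) (be := be) ga_unb delta (i0 + i).
  by apply: hr; apply: hi0 => /=; exact: leq_addr.
set K2 := 2 * delta * (K * (2 * Cs) `^ p + K * (p / - ln be) `^ p) +
     4 * expR (16 * C ^+ 2 * delta).
have K20 : 0 <= K2.
  apply: addr_ge0; last by rewrite mulr_ge0// expR_ge0.
  by rewrite mulr_ge0 ?mulr_ge0 ?(ltW delta0)// addr_ge0// mulr_ge0// powR_ge0.
have ps0 : 0 <= p / 3 by rewrite divr_ge0// ltW.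
have : {ae P, forall w, exists B', forall n,
    \sum_(i < n) Z (i0 + i)%N (seqV w) <= B'}.
  apply: (ae_summable (Z := fun i w => Z (i0 + i)%N (seqV w))
    (c := fun i => K2 * q (i0 + i)%N `^ (p / 3))
    (M := K2 * (ga 0%N `^ (p / 3) + B / delta))).
  - move=> i; apply: (measurable_law iV (g := Z (i0 + i)%N)).
    exact: (measurable_window_var al01 hbe eps0 p2 K0 my hL iV mth).
  - by move=> i w; exact: (window_var_ge0 hbe y V th ga_gt0 ga_unb delta).
  - move=> i; exact: (expected_window_var al01 hbe eps0 p2 K0 my hK hL iV mth pth
      ga_gt0 ga_decr Cs0 th_step delta0 (sw i)).
  - move=> n; rewrite -mulr_sumr ler_wpM2l//.
    apply: le_trans (grid_summable ga_gt0 ga_decr ga_unb delta0 ps0 ga_sum (i0 + n)).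
    rewrite big_split_ord /= lerDr; apply: sumr_ge0 => i _; exact: powR_ge0.
apply: filterS.
move=> w [B' hB'].
have Zcv : Z (i0 + i)%N (seqV w) @[i --> \oo] --> 0.
  apply: (bounded_series_cvg0 _ hB') => i.
  exact: (window_var_ge0 hbe y V th ga_gt0 ga_unb delta).
rewrite -(cvg_shiftn i0); apply/cvgrPdist_le => e e0.
have Q0 : 0 < 2 * C / eps.
  by rewrite divr_gt0// mulr_gt0// (wbound_gt0 al01 hbe).
(* chosen such that 2 C / eps * (4 * eta * delta) = e / 2 *)
pose eta := e / 2 / (2 * C / eps * (4 * delta)).
have eta0 : 0 < eta.
  apply: divr_gt0; first exact: divr_gt0.
  by apply: mulr_gt0 => //; rewrite mulr_gt0.
set rate := window_rate (al := al) (be := be) (eps := eps) (p := p) (K := K) Cs delta.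
pose f i := 2 * C / eps * (eta `^ (1 - p)) * Z (i0 + i)%N (seqV w) +
   rate * q (i0 + i)%N `^ (12^-1).
have qcv : q (i0 + i)%N `^ (12^-1) @[i --> \oo] --> 0.
  apply/cvgrPdist_le => e' e'0.
  have s0 : (0 : R) < 12^-1 by rewrite invr_gt0.
  have [r' r'0 hr'] := powR_small s0 e'0.
  move/cvgrPdist_le : grid_step_cvg0 => /(_ r' r'0) [n0 _ hn].
  exists n0 => // n /= n0n; rewrite sub0r normrN ger0_norm ?powR_ge0//.
  apply: hr' => //; have := hn (i0 + n)%N; rewrite /= sub0r normrN ger0_norm ?(ltW (ga_gt0 _))//.
  by apply; rewrite (leq_trans n0n)// leq_addl.
have fcv : f i @[i --> \oo] --> 0.
  rewrite (_ : 0 = 2 * C / eps * (eta `^ (1 - p)) * 0 + rate * 0); last by rewrite !mulr0 addr0.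
  by apply: cvgD; apply: cvgMr.
have e20 : 0 < e / 2 by rewrite divr_gt0.
move/cvgrPdist_le : fcv => /(_ _ e20); move/cvgrPdist_le : Zcv => /(_ 1 ltr01).
apply: filterS2 => i; rewrite !sub0r !normrN => Z1 fi.
rewrite /= (addnC i i0).
have Z1' : Z (i0 + i)%N (seqV w) <= 1 by apply: le_trans Z1; exact: ler_norm.
have := window_sum_le al01 hbe eps0 p2 K0 my hK hL iV ga_gt0 ga_decr Cs0 th_step delta0
  (sw i) hF eta0 Z1'.
move=> /le_trans; apply.
rewrite -/rate mulrDr -addrA [e](_ : _ = e / 2 + e / 2); last by field.
apply: lerD; last first.
  by apply: le_trans fi; rewrite mulrA; exact: ler_norm.
rewrite (_ : 4 * eta * delta = eta * (4 * delta)); last by ring.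
by rewrite mulrCA /eta divfK// gt_eqF// mulr_gt0// mulr_gt0.
Qed.

End process.

(** * The flow and its Euler steps *)

Section flow.
Context {R : realType} {d : nat}.
Variables (f : 'rV[R]_d -> 'rV[R]_d) (Psi : R -> 'rV[R]_d -> 'rV[R]_d).
Hypothesis hPsi : semiflow_of f Psi.

Lemma flow_quotient x t j e : 0 <= t -> 0 < e -> exists2 r, 0 < r &
  forall h, h != 0 -> `|h| < r -> 0 <= t + h ->
    `|f (Psi t x) 0 j - h^-1 * (Psi (t + h) x 0 j - Psi t x 0 j)| <= e.
Proof.
move=> t0 e0; have [_ /(_ t t0)] := hPsi x.
move=> /cvgrPdist_le /(_ e e0) /nbhs_ballP[r /= r0 hr].
exists r => // h h0 hlt th0.
have := hr h; rewrite /ball /= sub0r normrN => /(_ hlt h0 th0).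
by apply: le_trans; have := coord_le_norm (f (Psi t x) -
  h^-1 *: (Psi (t + h) x - Psi t x)) j; rewrite !mxE.
Qed.

(** At time 0 only a right derivative is given; continuing the flow line by its
    tangent to negative times makes the mean value theorem applicable on
    segments that start at 0. *)
Lemma flow_is_derive x j (t : R) : 0 <= t ->
  is_derive t (1 : R) (fun s : R => if 0 <= s then Psi s x 0 j
     else x 0 j + s * f x 0 j) (f (Psi t x) 0 j).
Proof.
move=> t0; set phi := fun s : R => _.
have [P0 _] := hPsi x.
have cv : (fun h => h^-1 *: ((phi \o shift t) (h *: (1 : R)) - phi t)) @ 0^' -->
    (f (Psi t x) 0 j : R).
  apply/cvgrPdist_le => e e0.
  have [r r0 hr] := flow_quotient x j t0 e0.
  have [r' r'0 hr'] : exists2 r', 0 < r' & forall h : R, `|h| < r' -> t = 0 \/ 0 <= t + h.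
    move: t0; rewrite le_eqVlt => /predU1P[<-|t0]; first by exists 1 => // h _; left.
    exists t => // h; rewrite ltr_norml => /andP[h1 _]; right.
    by rewrite -lerBlDl sub0r ltW.
  apply/nbhs_ballP; exists (Num.min r r'); first by rewrite /= lt_min r0.
  move=> h; rewrite /ball /= sub0r normrN lt_min => /andP[hr1 hr2] h0.
  rewrite /= /phi t0 (_ : h *: (1 : R) = h); last exact: mulr1.
  rewrite (addrC h t) -[h^-1 *: _]/(h^-1 * _).
  case: (leP 0 (t + h)) => th0; first exact: hr.
  have [tE|] := hr' h hr2; last by rewrite leNgt th0.
  rewrite tE add0r P0 addrAC subrr add0r mulrA mulVf// mul1r subrr normr0.
  exact: ltW.
by apply: DeriveDef; [apply/cvg_ex; eexists; exact: cv|exact: cvg_lim cv].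
Qed.

Lemma flow_mvt x j (a b : R) : 0 <= a -> a <= b ->
  exists2 c, a <= c <= b &
    Psi b x 0 j - Psi a x 0 j = f (Psi c x) 0 j * (b - a).
Proof.
move=> a0 ab.
pose phi (s : R) := if 0 <= s then Psi s x 0 j else x 0 j + s * f x 0 j.
have dphi (t : R) : 0 <= t -> is_derive t (1 : R) phi (f (Psi t x) 0 j).
  exact: flow_is_derive.
have [c cab] : exists2 c, c \in `[a, b] & phi b - phi a = f (Psi c x) 0 j * (b - a).
  apply: (@MVT_segment _ phi (fun t => f (Psi t x) 0 j)) => //.
    move=> t; rewrite in_itv /= => /andP[at_ _]; apply: dphi.
    by rewrite (le_trans a0)// ltW.
  apply: derivable_within_continuous => t; rewrite in_itv /= => /andP[at_ _].
  by have [] := dphi t (le_trans a0 at_).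
rewrite /phi a0 (le_trans a0 ab) => e; exists c => //.
Qed.

Variable Cs : R.
Hypothesis Cs0 : 0 <= Cs.
Hypothesis f_le : forall x j, `|f x 0 j| <= Cs.

Lemma flow_lip x (a b : R) : 0 <= a -> a <= b -> `|Psi b x - Psi a x| <= Cs * (b - a).
Proof.
move=> a0 ab; apply: norm_le_coord; first by rewrite mulr_ge0// subr_ge0.
move=> j; rewrite !mxE; have [c _ ->] := flow_mvt x j a0 ab.
by rewrite normrM (ger0_norm (_ : 0 <= b - a)) ?subr_ge0// ler_wpM2r// subr_ge0.
Qed.

Variables (rho Lam : R).
Hypothesis Lam0 : 0 <= Lam.
Hypothesis f_lip : forall x z j, `|x| <= rho -> `|z| <= rho ->
  `|f x 0 j - f z 0 j| <= Lam * `|x - z|.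

(** By the mean value theorem the increment is [f] at an intermediate point, and
    this point is at a distance of at most [Cs * (b - a)] from the start. *)
Lemma flow_euler x (a b : R) : 0 <= a -> a <= b ->
  (forall s, 0 <= s -> s <= b -> `|Psi s x| <= rho) ->
  `|Psi b x - Psi a x - (b - a) *: f (Psi a x)| <= Lam * Cs * (b - a) ^+ 2.
Proof.
move=> a0 ab hrho; have ba0 : 0 <= b - a by rewrite subr_ge0.
apply: norm_le_coord; first by rewrite !mulr_ge0// sqr_ge0.
move=> j; rewrite !mxE; have [c /andP[ac cb] ->] := flow_mvt x j a0 ab.
rewrite [(b - a) * _]mulrC -mulrBl normrM (ger0_norm ba0) expr2 mulrA.
rewrite ler_wpM2r//.
apply: (le_trans (f_lip _ _ _)).
- by apply: hrho => //; exact: le_trans ac.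
- exact: hrho.
rewrite -mulrA ler_wpM2l// (le_trans (flow_lip _ a0 ac))// ler_wpM2l//.
by rewrite lerD2r.
Qed.

End flow.

Section gronwall.
Context {R : realType}.
Variables (ga E : nat -> R) (bet Lam : R) (N M : nat).
Hypotheses (ga0 : forall k, 0 <= ga k) (E0 : forall k, 0 <= E k).
Hypotheses (Lam0 : 0 <= Lam) (bet0 : 0 <= bet).

(** The estimate is proved for the right-hand side of the hypothesis, which
    grows at most by the factor [1 + Lam * ga k] in each step. *)
Lemma discrete_gronwall :
  (forall m, (N <= m <= M)%N -> E m <= bet + Lam * \sum_(N <= k < m) ga k * E k) ->
  forall m, (N <= m <= M)%N -> E m <= bet * expR (Lam * \sum_(N <= k < m) ga k).
Proof.
move=> hE; pose U m := bet + Lam * \sum_(N <= k < m) ga k * E k.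
suff hU i : (N + i <= M)%N -> U (N + i)%N <= bet * expR (Lam * \sum_(N <= k < N + i) ga k).
  move=> m /andP[Nm mM]; apply: (le_trans (hE m _)); first by rewrite Nm.
  by have := hU (m - N)%N; rewrite subnKC//; apply.
elim: i => [|i IH] iM.
  by rewrite addn0 /U !big_geq// !mulr0 addr0 expR0 mulr1.
have iM' : (N + i <= M)%N by lia.
rewrite addnS /U !big_nat_recr ?leq_addr//= !mulrDr expRD addrA -/(U (N + i)%N).
apply: (@le_trans _ _ (U (N + i)%N * (1 + Lam * ga (N + i)%N))).
  rewrite mulrDr mulr1 lerD2l [leRHS]mulrC -mulrA ler_wpM2l// ler_wpM2l//.
  by apply: hE; rewrite leq_addr.
rewrite mulrA; apply: ler_pM.
- apply: addr_ge0 => //; apply: mulr_ge0 => //; apply: sumr_ge0 => k _.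
  exact: mulr_ge0.
- by rewrite addr_ge0// mulr_ge0.
- exact: IH.
- exact: expR_ge1Dx.
Qed.

End gronwall.

(** * From windows to stretches of bounded time *)

Section chain.
Context {R : realType}.
Variable ga : nat -> R.
Hypothesis ga_gt0 : forall k, 0 < ga k.
Hypothesis ga_decr : forall k, ga k.+1 <= ga k.
Hypothesis ga_unb : forall M, exists n, M <= ttime ga n.
Hypothesis ga_cvg0 : ga @ \oo --> 0.
Variables (a : nat -> R) (A : R).
Hypothesis A0 : 0 <= A.
Hypothesis a_le : forall k, `|a k| <= A * ga k.

Lemma sum_le_time n m : (n <= m)%N ->
  `|\sum_(n <= k < m) a k| <= A * (ttime ga m - ttime ga n).
Proof.
move=> nm; rewrite (le_trans (ler_norm_sum _ _ _))// ttime_sum// mulr_sumr.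
by apply: ler_sum => k _.
Qed.

Lemma small_steps r : 0 < r -> exists n0, forall n, (n0 <= n)%N -> ga n <= r.
Proof.
move=> r0; move/cvgrPdist_le : ga_cvg0 => /(_ r r0) [n0 _ hn].
exists n0 => n n0n; have := hn n n0n; rewrite /= sub0r normrN.
by apply: le_trans; exact: ler_norm.
Qed.

Section grid_facts.
Variable delta : R.
Hypothesis delta0 : 0 < delta.
Local Notation G := (grid ga_unb delta).

Lemma grid_locate n : exists2 i, (G i <= n)%N & (n < G i.+1)%N.
Proof.
have ex : exists i, (n < G i.+1)%N by exists n; exact: grid_ge.
case: (ex_minnP ex) => -[|i] ni hmin; first by exists 0%N.
exists i.+1 => //; rewrite leqNgt; apply/negP => /hmin; by rewrite ltnn.
Qed.

Lemma grid_time i l : l%:R * delta <= ttime ga (G (i + l)) - ttime ga (G i).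
Proof.
elim: l => [|l IH]; first by rewrite addn0 subrr mul0r.
rewrite addnS -natr1 mulrDl mul1r (_ : _ - _ = (ttime ga (G (i + l)) - ttime ga (G i)) +
  (ttime ga (G (i + l).+1) - ttime ga (G (i + l)))); last by ring.
by rewrite lerD// next_index_ge.
Qed.

Lemma grid_sum_le i0 (e : R) :
  (forall i, (i0 <= i)%N -> `|\sum_(G i <= k < G i.+1) a k| <= e) ->
  forall i l, (i0 <= i)%N -> `|\sum_(G i <= k < G (i + l)) a k| <= l%:R * e.
Proof.
move=> he i l ii; elim: l => [|l IH]; first by rewrite addn0 big_geq// normr0 mul0r.
rewrite addnS (@big_cat_nat _ _ _ (G (i + l))) /=; last 2 first.
- by apply: grid_le => //; exact: leq_addr.
- exact: ltnW (grid_lt _ _ delta0 _).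
rewrite (le_trans (ler_normD _ _))// -natr1 mulrDl mul1r lerD// he//.
by rewrite (leq_trans ii)// leq_addr.
Qed.

End grid_facts.

(** A stretch of bounded time consists of boundedly many windows and of two
    incomplete ones, whose contribution is at most the elapsed time and hence
    small for a fine mesh. *)
Lemma small_sums :
  (forall m, let G := grid ga_unb (m.+1%:R^-1) in
     (\sum_(G i.+1 <= k < G i.+2) a k) @[i --> \oo] --> 0) ->
  forall T e : R, 0 < T -> 0 < e -> exists n0, forall n m, (n0 <= n)%N -> (n <= m)%N ->
    ttime ga m - ttime ga n <= T -> `|\sum_(n <= k < m) a k| <= e.
Proof.
move=> hW T e T0 e0.
(* the mesh makes the incomplete windows at both ends contribute e / 2 *)
pose mm := Num.truncn (8 * A / e); pose delta : R := mm.+1%:R^-1.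
have delta0 : 0 < delta by rewrite invr_gt0.
have hA : 4 * A * delta <= e / 2.
  have h : 8 * A / e <= mm.+1%:R by exact/ltW/truncnS_gt.
  rewrite /delta ler_pdivrMr// mulrAC ler_pdivlMr//.
  move: h; rewrite ler_pdivrMr// [_ * e]mulrC.
  by rewrite (_ : 4 * A * 2 = 8 * A); last by ring.
pose e' := e / 2 / (T / delta + 1).
have Td0 : 0 < T / delta + 1 by rewrite ltr_wpDl// divr_ge0// ltW.
have e'0 : 0 < e' by rewrite divr_gt0// divr_gt0.
pose G := grid ga_unb delta.
move/cvgrPdist_le : (hW mm) => /(_ e' e'0) [i1 _ hi1].
have [n1 hn1] := small_steps delta0.
pose i0 := (maxn i1 n1).+1.
have he i : (i0 <= i)%N -> `|\sum_(G i <= k < G i.+1) a k| <= e'.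
  case: i => // i; rewrite /i0 ltnS => ii.
  have := hi1 i (leq_trans (leq_maxl _ _) ii).
  by rewrite /= sub0r normrN.
have hga i : (i0 <= i)%N -> ga (G i) <= delta.
  move=> ii; apply: hn1; apply: (leq_trans _ (grid_ge ga_gt0 ga_unb delta0 i)).
  by apply: leq_trans ii; rewrite /i0 leqW// leq_maxr.
have part n i : (i0 <= i)%N -> (G i <= n)%N -> (n < G i.+1)%N ->
    `|\sum_(G i <= k < n) a k| <= A * (2 * delta).
  move=> ii Gn nG; rewrite (le_trans (sum_le_time Gn))// ler_wpM2l//.
  rewrite (@le_trans _ _ (ttime ga (G i.+1) - ttime ga (G i)))//.
    by rewrite lerD2r ttime_le// ltnW.
  rewrite (le_trans (next_index_le ga_gt0 ga_decr ga_unb delta0 _))//.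
  by rewrite mulr_natl mulr2n lerD2l; exact: hga.
exists (G i0) => n m n0 nm nmT.
have [i Gn nG] := grid_locate delta0 n.
have [i' Gm mG] := grid_locate delta0 m.
have ii : (i0 <= i)%N.
  rewrite -ltnS; case: (ltnP i0 i.+1) => // h.
  have := leq_trans nG (grid_le ga_gt0 ga_unb delta0 h); rewrite -/G ltnNge.
  by rewrite n0.
have ii' : (i <= i')%N.
  rewrite -ltnS; case: (ltnP i i'.+1) => // h.
  have := leq_trans mG (grid_le ga_gt0 ga_unb delta0 h); rewrite -/G ltnNge.
  by rewrite (leq_trans Gn nm).
have GG : (G i <= G i')%N by apply: grid_le.
have eqS : \sum_(n <= k < m) a k = \sum_(G i <= k < G i') a k +
    \sum_(G i' <= k < m) a k - \sum_(G i <= k < n) a k.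
  rewrite -(@big_cat_nat _ _ _ (G i') (G i) m)//= (@big_cat_nat _ _ _ n (G i) m)//=.
  by rewrite addrAC subrr add0r.
have hl : (i' - i)%:R <= T / delta + 1.
  case: (posnP (i' - i)) => [->|l0]; first exact: ltW.
  have := grid_time delta i.+1 (i' - i).-1.
  rewrite (_ : (i.+1 + (i' - i).-1)%N = i'); last by lia.
  rewrite -/G => h.
  have h2 : ttime ga (G i') - ttime ga (G i.+1) <= T.
    apply: le_trans nmT; apply: lerB; first exact: ttime_le.
    by apply: ttime_le => //; exact: ltnW.
  rewrite -(prednK l0) -natr1 lerD2r ler_pdivlMr//.
  exact: le_trans h h2.
have b1 : `|\sum_(G i <= k < G i') a k| <= e / 2.
  have := grid_sum_le delta0 he (i' - i) ii; rewrite subnKC// => h.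
  apply: (le_trans h); apply: (@le_trans _ _ ((T / delta + 1) * e')).
    by rewrite ler_wpM2r// ltW.
  by rewrite /e' mulrC divfK// gt_eqF.
have b2 := part m i' (leq_trans ii ii') Gm mG.
have b3 := part n i ii Gn nG.
rewrite eqS (le_trans (ler_normB _ _))// (le_trans (lerD (ler_normD _ _) (lexx _)))//.
rewrite (le_trans (lerD (lerD b1 b2) b3))// -addrA.
rewrite (_ : A * (2 * delta) + A * (2 * delta) = 4 * A * delta); last by ring.
by rewrite (le_trans (lerD (lexx _) hA))// (_ : e / 2 + e / 2 = e)//; field.
Qed.

End chain.

(** * Comparison with the flow *)

Section pseudotrajectory.
Context {R : realType} {d : nat}.
Variables (f : 'rV[R]_d -> 'rV[R]_d) (Psi : R -> 'rV[R]_d -> 'rV[R]_d).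
Hypothesis hPsi : semiflow_of f Psi.
Variable Cs : R.
Hypothesis Cs0 : 0 <= Cs.
Hypothesis f_le : forall x j, `|f x 0 j| <= Cs.
Hypothesis f_lip : forall rho : R, exists2 Lam : R, 0 <= Lam & forall x z j,
  `|x| <= rho -> `|z| <= rho -> `|f x 0 j - f z 0 j| <= Lam * `|x - z|.
Variable ga : nat -> R.
Hypothesis ga_gt0 : forall k, 0 < ga k.
Hypothesis ga_decr : forall k, ga k.+1 <= ga k.
Hypothesis ga_unb : forall M, exists n, M <= ttime ga n.
Hypothesis ga_cvg0 : ga @ \oo --> 0.
Variables (x : nat -> 'rV[R]_d) (y : R -> 'rV[R]_d).
Hypothesis hy : linear_interpolation (ttime ga) x y.
Hypothesis x_step : forall n, `|x n.+1 - x n| <= Cs * ga n.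
Variable rho0 : R.
Hypothesis x_le : forall n, `|x n| <= rho0.
Hypothesis small : forall (T e : R) (j : 'I_d), 0 < T -> 0 < e ->
  exists n0, forall n m, (n0 <= n)%N -> (n <= m)%N -> ttime ga m - ttime ga n <= T ->
    `|\sum_(n <= k < m) (x k.+1 0 j - x k 0 j - ga k * f (x k) 0 j)| <= e.

Lemma small_vector (T e : R) : 0 < T -> 0 < e ->
  exists n0, forall n m, (n0 <= n)%N -> (n <= m)%N -> ttime ga m - ttime ga n <= T ->
    `|x m - x n - \sum_(n <= k < m) ga k *: f (x k)| <= e.
Proof.
move=> T0 e0; have [F hF] := choice (fun j => small j T0 e0).
exists (\max_(j < d) F j)%N => n m Fn nm nmT.
apply: norm_le_coord; first exact: ltW.
move=> j; rewrite !mxE summxE.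
rewrite (_ : x m 0 j - x n 0 j = \sum_(n <= k < m) (x k.+1 0 j - x k 0 j)); last first.
  by rewrite (telescope_sumr (fun k => x k 0 j)).
rewrite -sumrB; under eq_bigr do rewrite mxE.
apply: hF => //; apply: leq_trans Fn; exact: leq_bigmax.
Qed.

Lemma interpolation_close n s : ttime ga n <= s <= ttime ga n.+1 ->
  `|y s - x n| <= Cs * ga n.
Proof.
move=> /andP[s1 s2]; have [_ /(_ n s) ->] := hy; last by rewrite s1.
have tS : ttime ga n.+1 - ttime ga n = ga n by rewrite ttimeS addrAC subrr add0r.
rewrite addrAC subrr add0r normrZ tS (le_trans _ (x_step n))// ler_piMl//.
rewrite ger0_norm; last by rewrite divr_ge0 ?subr_ge0// ltW.
by rewrite ler_pdivrMr// mul1r -tS lerD2r.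
Qed.

Lemma time_locate s : 0 <= s -> exists2 n, ttime ga n <= s & s < ttime ga n.+1.
Proof.
move=> s0; have ex : exists n, s < ttime ga n.+1.
  have [n hn] := ga_unb s; exists n; apply: (le_lt_trans hn).
  by rewrite ttimeS ltrDl.
case: (ex_minnP ex) => -[|n] sn hmin; first by exists 0%N => //; rewrite /ttime big_ord0.
exists n.+1 => //; rewrite leNgt; apply/negP => /hmin; by rewrite ltnn.
Qed.

(** On a stretch of time of length [T] the interpolated trajectory stays close
    to the flow line through its starting point.  Both are Euler schemes for
    [f], one up to the summed error of the drift and the other up to
    [flow_euler], and the discrete Gronwall inequality compares them. *)
Lemma tracking (T : R) : 0 < T -> exists K1 K2 : R, [/\ 0 <= K1, 0 < K2 &
  forall e : R, 0 < e -> exists n0, forall n (s h : R), (n0 <= n)%N ->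
    ttime ga n <= s -> s < ttime ga n.+1 -> 0 <= h -> h <= T ->
    `|y (s + h) - Psi h (y s)| <= K1 * ga n + K2 * e].
Proof.
move=> T0; pose rho := rho0 + Cs * ga 0%N + Cs * T.
have [Lam Lam0 hLam] := f_lip rho.
have rho0_ge0 : 0 <= rho0 by apply: le_trans (x_le 0%N).
have CT0 : 0 <= Cs * T by rewrite mulr_ge0// ltW.
have Cg0 : 0 <= Cs * ga 0%N by rewrite mulr_ge0// ltW.
have xrho k : `|x k| <= rho.
  by apply: (le_trans (x_le k)); rewrite /rho -addrA lerDl addr_ge0.
pose W := expR (Lam * T).
exists (3 * Cs + (3 * Cs + Lam * Cs * T) * W), W; split.
- by rewrite !(addr_ge0, mulr_ge0, expR_ge0)// ltW.
- exact: expR_gt0.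
move=> e e0; have [n0 hn0] := small_vector T0 e0.
exists n0 => n s h n0n ns sn h0 hT.
have s0 : 0 <= s.
  by apply: le_trans ns; have := ttime_le ga_gt0 (leq0n n); rewrite {1}/ttime big_ord0.
have ysx : `|y s - x n| <= Cs * ga n by apply: interpolation_close; rewrite ns ltW.
pose z r := Psi r (y s).
have z0 : z 0 = y s by rewrite /z; have [] := hPsi (y s).
have zlip a b : 0 <= a -> a <= b -> `|z b - z a| <= Cs * (b - a).
  by move=> a0 ab; exact: (flow_lip hPsi).
have Cgn : Cs * ga n <= Cs * ga 0%N by rewrite ler_wpM2l// (ga_le ga_decr).
have zrho r : 0 <= r -> r <= T -> `|z r| <= rho.
  move=> r0 rT; rewrite (_ : z r = x n + (y s - x n) + (z r - y s)); last first.
    by apply/rowP => i; rewrite !mxE; ring.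
  rewrite (le_trans (ler_normD _ _))// lerD//; last first.
    by rewrite -z0 (le_trans (zlip _ _ _ _))// subr0 ler_wpM2l.
  by rewrite (le_trans (ler_normD _ _))// lerD// (le_trans ysx).
have tn : ttime ga n.+1 = ttime ga n + ga n by rewrite ttimeS.
have sh0 : 0 <= s + h by rewrite addr_ge0.
have [m ms sm] := time_locate sh0.
have ysm : `|y (s + h) - x m| <= Cs * ga m.
  by apply: interpolation_close; rewrite ms ltW.
have nm : (n <= m)%N.
  rewrite leqNgt; apply/negP => mn.
  have := lt_le_trans sm (ttime_le ga_gt0 mn); rewrite ltNge.
  by rewrite (le_trans ns)// lerDl.
have Cmn : Cs * ga m <= Cs * ga n by rewrite ler_wpM2l// (ga_le ga_decr).
have Cn0 : 0 <= Cs * ga n by rewrite mulr_ge0// ltW.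
have bet0 : 0 <= 3 * (Cs * ga n) + e + Lam * (Cs * ga n) * T.
  by rewrite !addr_ge0 ?mulr_ge0// ltW.
case: (ltngtP n m) => [{}nm|mn|nm']; last 2 first.
- by move: nm; rewrite leqNgt mn.
- rewrite -nm' in ysm sm.
  have hz : `|z h - z 0| <= Cs * ga n.
    rewrite (le_trans (zlip _ _ _ _))// ler_wpM2l// subr0.
    by move: sm; rewrite tn => sm; lra.
  have -> : y (s + h) - Psi h (y s) = (y (s + h) - x n) - (y s - x n) - (z h - z 0).
    by rewrite z0 /z; apply/rowP => i; rewrite !mxE; ring.
  rewrite (le_trans (ler_normB _ _))// (le_trans (lerD (ler_normB _ _) (lexx _)))//.
  rewrite (le_trans (lerD (lerD ysm ysx) hz))//.
  have pos : 0 <= (3 * Cs + Lam * Cs * T) * W * ga n + W * e.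
    by rewrite !(addr_ge0, mulr_ge0, expR_ge0)// ltW.
  by move: pos; lra.
(* r k is the running time of the flow line at the index k; both schemes are
   compared at the indices from n.+1 to m *)
pose r k := ttime ga k - s.
have r0 k : (n < k)%N -> 0 <= r k.
  by move=> nk; rewrite subr_ge0 (le_trans (ltW sn))// ttime_le.
have rh k : (k <= m)%N -> r k <= h.
  by move=> km; rewrite lerBlDl (le_trans _ ms)// ttime_le.
have rS k : r k.+1 = r k + ga k by rewrite /r ttimeS addrAC.
pose E k := `|x k - z (r k)|.
have EN : E n.+1 <= 3 * (Cs * ga n).
  have rn : r n.+1 <= ga n by rewrite /r tn; lra.
  have hz : `|z (r n.+1) - z 0| <= Cs * ga n.
    by rewrite (le_trans (zlip _ _ _ _)) ?r0// ler_wpM2l// subr0.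
  rewrite /E (_ : _ - _ = (x n.+1 - x n) - (y s - x n) - (z (r n.+1) - z 0)); last first.
    by rewrite z0; apply/rowP => i; rewrite !mxE; ring.
  rewrite (le_trans (ler_normB _ _))// (le_trans (lerD (ler_normB _ _) (lexx _)))//.
  by rewrite (le_trans (lerD (lerD (x_step n) ysx) hz))// le_eqVlt; apply/predU1P; left; ring.
have tsum k : (n < k)%N -> (k <= m)%N -> \sum_(n.+1 <= i < k) ga i <= T.
  move=> nk km; rewrite -ttime_sum// (le_trans _ hT)// (le_trans _ (rh _ km))//.
  by rewrite lerD2l lerN2 ltW.
have Em k : (n.+1 <= k <= m)%N ->
    E k <= (3 * (Cs * ga n) + e + Lam * (Cs * ga n) * T) +
           Lam * \sum_(n.+1 <= i < k) ga i * E i.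
  move=> /andP[nk km].
  have b1 : `|x k - x n.+1 - \sum_(n.+1 <= i < k) ga i *: f (x i)| <= e.
    apply: hn0 => //; first exact: leqW.
    by rewrite ttime_sum//; exact: tsum.
  have b2 : `|\sum_(n.+1 <= i < k) ga i *: (f (x i) - f (z (r i)))| <=
      Lam * \sum_(n.+1 <= i < k) ga i * E i.
    rewrite (le_trans (ler_norm_sum _ _ _))// mulr_sumr big_nat_cond [leRHS]big_nat_cond.
    apply: ler_sum => i /andP[/andP[ni ik] _].
    rewrite normrZ (ger0_norm (ltW (ga_gt0 i))) mulrCA ler_wpM2l//; first exact: ltW.
    apply: norm_le_coord; first exact: mulr_ge0 Lam0 (normr_ge0 _).
    move=> j; rewrite !mxE; apply: hLam => //; apply: zrho; first exact: r0.
    by rewrite (le_trans _ hT)// rh// (leq_trans (ltnW ik)).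
  have b3 : `|\sum_(n.+1 <= i < k) (z (r i.+1) - z (r i) - ga i *: f (z (r i)))| <=
      Lam * (Cs * ga n) * T.
    rewrite (le_trans (ler_norm_sum _ _ _))//.
    apply: (@le_trans _ _ (Lam * (Cs * ga n) * \sum_(n.+1 <= i < k) ga i)); last first.
      by apply: ler_wpM2l (tsum _ nk km); apply: mulr_ge0 Lam0 Cn0.
    rewrite mulr_sumr big_nat_cond [leRHS]big_nat_cond.
    apply: ler_sum => i /andP[/andP[ni ik] _].
    have gi : ga i = r i.+1 - r i by rewrite rS addrAC subrr add0r.
    rewrite {1}gi (le_trans (flow_euler hPsi Cs0 f_le Lam0 hLam _ _ _))//.
    + exact: r0.
    + by rewrite rS lerDl ltW.
    + move=> q q0 qr; apply: zrho => //; rewrite (le_trans qr)// (le_trans _ hT)//.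
      by rewrite rh// (leq_trans ik).
    rewrite -gi expr2 mulrA ler_wpM2r//; first exact: ltW.
    by rewrite -mulrA ler_wpM2l// ler_wpM2l// (ga_le ga_decr)// ltnW.
  have -> : E k = `|(x n.+1 - z (r n.+1)) +
      (x k - x n.+1 - \sum_(n.+1 <= i < k) ga i *: f (x i)) +
      \sum_(n.+1 <= i < k) ga i *: (f (x i) - f (z (r i))) -
      \sum_(n.+1 <= i < k) (z (r i.+1) - z (r i) - ga i *: f (z (r i)))|.
    rewrite /E; congr (`| _ |).
    under [in X in _ = _ + X - _]eq_bigr do rewrite scalerBr.
    have tz : \sum_(n.+1 <= i < k) (z (r i.+1) - z (r i)) = z (r k) - z (r n.+1).
      by rewrite (telescope_sumr (fun i => z (r i))).
    rewrite [X in _ = _ + X - _]sumrB [X in _ = _ - X]sumrB tz.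
    by apply/rowP => i; rewrite !mxE; ring.
  rewrite (le_trans (ler_normB _ _))// (le_trans (lerD (ler_normD _ _) (lexx _)))//.
  rewrite (le_trans (lerD (lerD (ler_normD _ _) (lexx _)) (lexx _)))//.
  rewrite (le_trans (lerD (lerD (lerD EN b1) b2) b3))// le_eqVlt.
  by apply/predU1P; left; ring.
have G := discrete_gronwall (fun k => ltW (ga_gt0 k)) (fun k => normr_ge0 _) Lam0 bet0 Em.
have {}G : E m <= (3 * (Cs * ga n) + e + Lam * (Cs * ga n) * T) * W.
  apply: (le_trans (G m _)); first by rewrite nm leqnn.
  by rewrite ler_wpM2l// ler_expR ler_wpM2l//; exact: tsum.
have hz : `|z h - z (r m)| <= Cs * ga n.
  rewrite (le_trans (zlip _ _ _ _)) ?r0 ?rh//.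
  apply: le_trans Cmn; rewrite ler_wpM2l// /r.
  by move: sm; rewrite ttimeS => sm; lra.
have -> : y (s + h) - Psi h (y s) = (y (s + h) - x m) + (x m - z (r m)) - (z h - z (r m)).
  by rewrite /z; apply/rowP => i; rewrite !mxE; ring.
rewrite (le_trans (ler_normB _ _))// (le_trans (lerD (ler_normD _ _) (lexx _)))//.
rewrite (le_trans (lerD (lerD (le_trans ysm Cmn) G) hz))//.
rewrite (_ : (_ * ga n + W * e) = 3 * (Cs * ga n) +
  (3 * (Cs * ga n) + e + Lam * (Cs * ga n) * T) * W); last by ring.
by rewrite addrAC lerD2r (_ : 3 = 1 + 2)//; lra.
Qed.

Lemma tracking_pseudotrajectory : asymptotic_pseudotrajectory Psi y.
Proof.
move=> T T0; have [K1 [K2 [K10 K20 hK]]] := tracking T0.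
pose S t : set (\bar R) := [set (eucl_norm (y (t + h) - Psi h (y t)))%:E | h in `[0, T]].
have Sge0 t : (0 <= ereal_sup (S t))%E.
  apply: (@le_trans _ _ (eucl_norm (y (t + 0) - Psi 0 (y t)))%:E).
    by rewrite lee_fin eucl_norm_ge0.
  by apply: ereal_sup_ubound; exists 0 => //; rewrite /= in_itv /= lexx ltW.
have Sle e : 0 < e -> \forall t \near +oo, (ereal_sup (S t) <= e%:E)%E.
  move=> e0; pose D : R := d%:R + 1.
  have D0 : 0 < D by rewrite ltr_wpDl.
  have e'0 : 0 < e / D / 2 / K2 by rewrite !divr_gt0.
  have [n0 hn0] := hK _ e'0.
  have e''0 : 0 < e / D / 2 / (K1 + 1) by rewrite !divr_gt0// ltr_wpDl.
  have [n1 hn1] := @small_steps _ _ ga_cvg0 _ e''0.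
  near=> t.
  have tn : ttime ga (maxn n0 n1) <= t by near: t; apply: nbhs_pinfty_ge; exact: num_real.
  have t0 : 0 <= t.
    apply: le_trans tn; have := ttime_le ga_gt0 (leq0n (maxn n0 n1)).
    by rewrite {1}/ttime big_ord0.
  have [n nt tn1] := time_locate t0.
  have Nn : (maxn n0 n1 <= n)%N.
    rewrite leqNgt; apply/negP => h.
    have := lt_le_trans tn1 (le_trans (ttime_le ga_gt0 h) tn).
    by rewrite ltxx.
  apply: ub_ereal_sup => _ [h /= /[!in_itv] /= /andP[h0 hT] <-].
  rewrite lee_fin (le_trans (eucl_norm_le _))//.
  have := hn0 n t h (leq_trans (leq_maxl _ _) Nn) nt tn1 h0 hT.
  rewrite [K2 * _]mulrC divfK ?gt_eqF// => hb.
  have gn : K1 * ga n <= e / D / 2.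
    have := hn1 n (leq_trans (leq_maxr _ _) Nn).
    rewrite ler_pdivlMr ?ltr_wpDl// => hg; apply: le_trans hg.
    by rewrite mulrC ler_wpM2l ?lerDl// ltW.
  have {gn}hb : `|y (t + h) - Psi h (y t)| <= e / D.
    apply: (le_trans hb); apply: (le_trans (lerD gn (lexx _))).
    by rewrite -splitr.
  rewrite (le_trans (ler_wpM2l _ hb))// mulrCA ler_piMr//; first exact: ltW.
  by rewrite ler_pdivrMr// mul1r lerDl.
have hfin : \forall t \near +oo, ereal_sup (S t) \is a fin_num.
  near=> t; rewrite ge0_fin_numE//.
  rewrite (@le_lt_trans _ _ 1%:E) ?ltry//; near: t; exact: Sle.
apply/fine_cvgP; split => //.
apply/cvgrPdist_le => e e0; near=> t.
have h : (ereal_sup (S t) <= e%:E)%E by near: t; exact: Sle.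
rewrite sub0r normrN -[(fine \o _) t]/(fine (ereal_sup (S t))).
rewrite ger0_norm ?(fine_ge0 (Sge0 t))// -lee_fin fineK//.
by near: t.
Unshelve. all: by end_near.
Qed.

End pseudotrajectory.

(** * Localisation of Adam *)

Section increments.
Context {R : realType} {dU : measure_display} {UU : measurableType dU} {d : nat}.
Variables (X : UU -> 'rV[R]_d -> 'rV[R]_d) (gamma : nat -> R) (al be eps : R).
Variable vartheta : 'rV[R]_d.
Hypotheses (al01 : 0 <= al < 1) (hbe : al ^+ 2 < be < 1) (eps0 : 0 < eps).
Hypothesis gamma_gt0 : forall n, 0 < gamma n.+1.
Local Notation path := (adam_path X gamma al be eps vartheta).
Local Notation C := (wbound al be).
Local Notation dir j := (full_dir al be eps (fun v th => X v th 0 j) path).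

(** The closed form of the averages turns the increment into the expression of
    [bias_correction]. *)
Lemma adam_increment n u j :
  `|path n.+1 u 0 j - path n u 0 j - gamma n.+1 * dir j n u|
    <= gamma n.+1 * (C * be ^+ n.+1).
Proof.
have [hm hv] := adam_state_sum X gamma al be eps vartheta u n.+1 j.
have -> : path n.+1 u 0 j = path n u 0 j + gamma n.+1 *
  (Num.sqrt ((adam_state X gamma al be eps vartheta n.+1 u).2 0 j /
    (1 - be ^+ n.+1)) + eps)^-1 * (adam_state X gamma al be eps vartheta n.+1 u).1.2 0 j.
  by rewrite /adam_path /= !mxE.
rewrite (addrC (path n u 0 j)) addrK hm hv -mulrA -mulrBr normrM gtr0_norm// ler_wpM2l//.
  exact: ltW.
by rewrite mulrC /full_dir; exact: bias_correction.
Qed.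

Lemma dir_le n u j : `|dir j n u| <= C.
Proof. exact: wdir_le. Qed.

Lemma adam_path_step n u : `|path n.+1 u - path n u| <= 2 * C * gamma n.+1.
Proof.
have C0 := ltW (wbound_gt0 al01 hbe).
apply: norm_le_coord => [|j].
  by apply: mulr_ge0; [apply: mulr_ge0|exact: ltW].
rewrite [X in `|X|]mxE [X in _ + X]mxE -[X in `|X|](subrK (gamma n.+1 * dir j n u)).
rewrite (le_trans (ler_normD _ _))//.
apply: (le_trans (lerD (adam_increment n u j) (lexx _))).
rewrite normrM gtr0_norm// -mulrDr mulrC ler_wpM2r//; first exact: ltW.
rewrite mulr_natl mulr2n lerD ?dir_le//.
rewrite ler_piMr// exprn_ile1//; first exact: ltW (be_gt0 hbe).
by case/andP: hbe => _ /ltW.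
Qed.

End increments.

Section clipped_moments.
Context {R : realType} {d : nat} {p : R}.
Hypothesis p2 : 2 <= p.
Context {dO dU : measure_display} {Omega : measurableType dO} {P : probability Omega R}.
Context {UU : measurableType dU} (U : {RV P >-> UU}) (X : UU -> 'rV[R]_d -> 'rV[R]_d).
Hypotheses (mX : product_measurable X) (hXU : locally_regular U X p).

Lemma measurable_eucl_norm (dT : measure_display) (T : measurableType dT)
    (g : T -> 'rV[R]_d) : (forall j, measurable_fun setT (fun w => g w 0 j)) ->
  measurable_fun setT (fun w => eucl_norm (g w)).
Proof.
move=> mg; apply: measurable_fun_sqrt; apply: measurable_sum => j.
exact: measurable_funX.
Qed.

Lemma coord_moment_le (g : UU -> 'rV[R]_d) j (M : R) :
  (forall j, measurable_fun setT (fun u => g u 0 j)) ->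
  ('E_P[fun w => (eucl_norm (g (U w)) `^ p)%R] <= M%:E)%E ->
  (\int[distribution P U]_u (`|g u 0 j| `^ p)%:E <= M%:E)%E.
Proof.
move=> mg; rewrite unlock => hM.
have mpow (h : UU -> R) : measurable_fun setT h ->
    measurable_fun setT (fun u => (h u `^ p)%:E).
  by move=> mh; apply/measurable_EFinP; exact: (measurableT_comp (measurable_powR p)).
have mabs : measurable_fun setT (fun u => `|g u 0 j|).
  exact: (measurableT_comp (@normr_measurable R setT)).
apply: (@le_trans _ _ (\int[distribution P U]_u (eucl_norm (g u) `^ p)%:E)%E).
  apply: ge0_le_integral => //.
  - exact: (mpow (fun u => `|g u 0 j|)).
  - by apply: (mpow (fun u => eucl_norm (g u))); exact: measurable_eucl_norm.
  - move=> u _; rewrite lee_fin; apply: ge0_ler_powR.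
    + by rewrite (le_trans _ p2).
    + by rewrite nnegrE.
    + by rewrite nnegrE eucl_norm_ge0.
    + exact: coord_le_eucl.
rewrite ge0_integral_distribution//.
- by apply: (mpow (fun u => eucl_norm (g u))); exact: measurable_eucl_norm.
- by move=> u; rewrite lee_fin powR_ge0.
Qed.

Lemma continuous_bounded (c : R -> R) (b : R) : continuous c -> 0 <= b ->
  exists2 M, 0 <= M & forall s, 0 <= s <= b -> c s <= M.
Proof.
move=> cc b0; have [|s0 _ hs0] := @EVT_max _ c 0 b b0.
  exact: continuous_subspaceT.
exists `|c s0| => // s sb; apply: le_trans (ler_norm _).
by apply: hs0; rewrite in_itv.
Qed.

(** A continuous function is bounded on the compact set of the norms of clipped
    parameters, and clipping is 1-Lipschitz. *)
Lemma clipped_moments (N : R) : 0 <= N -> exists2 K, 0 <= K & forall j,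
  (forall th, (\int[distribution P U]_u (`|X u (clip N th) 0 j| `^ p)%:E <= K%:E)%E) /\
  (forall th th', (\int[distribution P U]_u
     (`|X u (clip N th) 0 j - X u (clip N th') 0 j| `^ p)%:E
       <= (K * `|th - th'| `^ p)%:E)%E).
Proof.
move=> N0; have [c cc hc] := hXU.
have dN0 : 0 <= d%:R * N by rewrite mulr_ge0.
have [M M0 hM] := continuous_bounded cc (addr_ge0 dN0 dN0).
have eN (th : 'rV[R]_d) : 0 <= eucl_norm (clip N th) <= d%:R * N.
  rewrite eucl_norm_ge0; apply: (le_trans (eucl_norm_le _)).
  by rewrite ler_wpM2l// norm_clip.
pose K1 := `|c 0| * (1 + expR (`|c 0| * (d%:R * N))).
have K10 : 0 <= K1 by rewrite mulr_ge0// addr_ge0// expR_ge0.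
have K20 : 0 <= M * d%:R `^ p by rewrite mulr_ge0// powR_ge0.
have mXth th j : measurable_fun setT (fun u => X u th 0 j).
  apply: (measurable_innovation mX (U := fun u : UU => u)
    (g := fun _ => th : borel_rV R d)) => //.
exists (K1 + M * d%:R `^ p); first exact: addr_ge0.
move=> j; split=> [th|th th'].
  apply: (coord_moment_le (g := fun u => X u (clip N th))) => //.
  have [h _] := hc (clip N th) (clip N th); apply: (le_trans h).
  rewrite lee_fin (@le_trans _ _ K1)// ?lerDl//.
  rewrite (le_trans (ler_norm _))// normrM /K1 ler_wpM2l//.
  rewrite ger0_norm ?addr_ge0 ?expR_ge0// lerD2l ler_expR.
  have /andP[e0 e1] := eN th.
  rewrite (@le_trans _ _ (`|c 0| * eucl_norm (clip N th)))//.
    by rewrite ler_wpM2r// ler_norm.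
  by rewrite ler_wpM2l.
have := coord_moment_le (g := fun u => X u (clip N th) - X u (clip N th')) j.
under eq_integral do rewrite !mxE.
apply.
  by move=> i; under eq_fun do rewrite !mxE; exact: measurable_funB.
have [_ h] := hc (clip N th) (clip N th'); apply: (le_trans h).
have /andP[e0 e1] := eN th; have /andP[e0' e1'] := eN th'.
rewrite lee_fin (@le_trans _ _ (M * eucl_norm (clip N th - clip N th') `^ p))//.
  by rewrite ler_wpM2r ?powR_ge0// hM// addr_ge0//= lerD.
rewrite mulrDl (@le_trans _ _ (M * d%:R `^ p * `|th - th'| `^ p))//; last first.
  by rewrite lerDr mulr_ge0// powR_ge0.
rewrite -mulrA ler_wpM2l// -powRM//.
apply: ge0_ler_powR.
- by rewrite (le_trans _ p2).
- by rewrite nnegrE eucl_norm_ge0.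
- by rewrite nnegrE mulr_ge0.
- by rewrite (le_trans (eucl_norm_le _))// ler_wpM2l// clip_lip.
Qed.

End clipped_moments.

(** * The Adam vector field *)

Section field.
Context {R : realType} {al be eps p : R} {d : nat}.
Hypotheses (al01 : 0 <= al < 1) (hbe : al ^+ 2 < be < 1) (eps0 : 0 < eps).
Hypothesis p2 : 2 <= p.
Context {dO dU : measure_display} {Omega : measurableType dO} {P : probability Omega R}.
Context {UU : measurableType dU} (U : {RV P >-> UU}) (X : UU -> 'rV[R]_d -> 'rV[R]_d).
Hypotheses (mX : product_measurable X) (hXU : locally_regular U X p).
Variable f : 'rV[R]_d -> 'rV[R]_d.
Hypothesis hf : adam_vector_field U X al be eps f.

Definition clipped (N : R) (j : 'I_d) (u : UU) (th : 'rV[R]_d) : R :=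
  X u (clip N th) 0 j.

Lemma measurable_clipped N j :
  measurable_fun setT (fun x : UU * borel_rV R d => clipped N j x.1 x.2).
Proof.
apply: (measurable_innovation mX (g := fun x : UU * borel_rV R d =>
  clip N x.2 : borel_rV R d)); first exact: measurable_fst.
by apply: measurable_clip; exact: measurable_snd.
Qed.

(** On the ball where clipping is void the vector field is a limit of mean fields
    of a globally regular innovation, and inherits their bounds. *)
Lemma meanfield_vector_field (dT : measure_display) (T : measurableType dT)
    (P' : probability T R) (V : nat -> T -> UU) N j th :
  0 <= N -> iidseq P' V (distribution P U) ->
  meanfield al be eps (clipped N j) P' V n th @[n --> \oo] --> f (clip N th) 0 j.
Proof.
move=> N0 iV; have [d1 [T1 [P'' [V' [iV' hV']]]]] := hf.
have iW := iid_copies_iidseq iV'.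
have [K K0 /(_ j)[hK _]] := clipped_moments p2 mX hXU N0.
rewrite (_ : (fun n => _) = fun n => meanfield al be eps (clipped N j) P''
    (fun k => V' k) n th); last first.
  apply/funext => n.
  exact: (meanfield_law al01 hbe eps0 (measurable_clipped N j) iW).
rewrite hV'.
exact: (meanfield_cvg al01 hbe eps0 p2 K0 (measurable_clipped N j) hK iW).
Qed.

Lemma vector_field_le x j : `|f x 0 j| <= wbound al be.
Proof.
have [d1 [T1 [P'' [V' [iV' _]]]]] := hf.
have iW := iid_copies_iidseq iV'.
have cv := meanfield_vector_field (normr_ge0 x) iW (j := j) (th := x).
rewrite clip_id// in cv.
apply: (cvgr_to_le (cvg_norm cv)) => //; near=> n.
exact: (meanfield_le al01 hbe eps0 (measurable_clipped _ _) iW).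
Unshelve. all: by end_near.
Qed.

Lemma vector_field_lip (rho : R) : exists2 Lam : R, 0 <= Lam & forall x z j,
  `|x| <= rho -> `|z| <= rho -> `|f x 0 j - f z 0 j| <= Lam * `|x - z|.
Proof.
have [rho_lt0|rho0] := ltP rho 0.
  exists 0 => // x z j xr; have := le_lt_trans xr rho_lt0.
  by rewrite ltNge normr_ge0.
have [d1 [T1 [P'' [V' [iV' _]]]]] := hf.
have iW := iid_copies_iidseq iV'.
have [K K0 hK] := clipped_moments p2 mX hXU rho0.
exists (2 * wbound al be / eps * (2 + K)).
  by apply: mulr_ge0; [exact: wdir_lip_const_ge0|exact: addr_ge0].
move=> x z j xr zr; have [_ hL] := hK j.
have cx := meanfield_vector_field rho0 iW (j := j) (th := x).
have cz := meanfield_vector_field rho0 iW (j := j) (th := z).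
rewrite clip_id// in cx; rewrite clip_id// in cz.
apply: (cvgr_to_le (cvg_norm (cvgB cx cz))) => //; near=> n.
exact: (meanfield_lip al01 hbe eps0 p2 K0 (measurable_clipped _ _) hL iW).
Unshelve. all: by end_near.
Qed.

End field.

(** * Vanishing drift errors *)

Lemma limsup_bounded (R : realType) (d : nat) (x : nat -> 'rV[R]_d) :
  (limn_esup (fun n => (eucl_norm (x n))%:E) < +oo)%E ->
  exists N : nat, forall n, `|x n| <= N%:R.
Proof.
move=> /ereal_inf_lt[_ [A [n0 _ An0] <-]] hlt.
set s := ereal_sup _ in hlt.
have es n : (n0 <= n)%N -> ((eucl_norm (x n))%:E <= s)%E.
  by move=> n0n; apply: ereal_sup_ubound; exists n => //; exact: An0.
have s_fin : s \is a fin_num.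
  rewrite ge0_fin_numE//; apply: le_trans (es n0 (leqnn _)).
  by rewrite lee_fin eucl_norm_ge0.
have xe n : `|x n| <= eucl_norm (x n).
  by apply: norm_le_coord (eucl_norm_ge0 _) _ => j; exact: coord_le_eucl.
have s0 : 0 <= fine s.
  by apply: fine_ge0; apply: le_trans (es n0 (leqnn _)); rewrite lee_fin eucl_norm_ge0.
have S0 : 0 <= \sum_(k < n0) `|x k| by exact: sumr_ge0.
pose M := fine s + \sum_(k < n0) `|x k|.
exists (Num.truncn M).+1 => n; apply: (@le_trans _ _ M); last exact/ltW/truncnS_gt.
have [n0n|nn0] := leqP n0 n.
  rewrite /M (le_trans (xe n))// (@le_trans _ _ (fine s)) ?lerDl//.
  by rewrite -lee_fin fineK// es.
rewrite /M (bigD1 (Ordinal nn0))//= addrCA lerDl addr_ge0//.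
by apply: sumr_ge0.
Qed.

Section drift.
Context {R : realType} {dU : measure_display} {UU : measurableType dU} {d : nat}.
Variables (X : UU -> 'rV[R]_d -> 'rV[R]_d) (gamma : nat -> R) (al be eps : R).
Variable vartheta : 'rV[R]_d.
Hypotheses (al01 : 0 <= al < 1) (hbe : al ^+ 2 < be < 1) (eps0 : 0 < eps).
Local Notation path := (adam_path X gamma al be eps vartheta).
Local Notation C := (wbound al be).
Local Notation ga := (fun k => gamma k.+1).
Hypothesis ga_gt0 : forall k, 0 < ga k.
Hypothesis ga_decr : forall k, ga k.+1 <= ga k.
Hypothesis ga_unb : forall M, exists n, M <= ttime ga n.
Variable f : 'rV[R]_d -> 'rV[R]_d.
Variables (N : R) (u : nat -> UU).
Hypothesis path_le : forall n, `|path n u| <= N.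

Definition drift_error (j : 'I_d) (k : nat) : R :=
  path k.+1 u 0 j - path k u 0 j - ga k * f (path k u) 0 j.

Lemma full_dir_clipped j k :
  full_dir al be eps (clipped X N j) path k u =
  full_dir al be eps (fun v th => X v th 0 j) path k u.
Proof. by apply: wdir_ext => i _; rewrite /clipped clip_id. Qed.

(** As long as the path stays in the ball where clipping is void, the drift
    errors differ from those of the clipped innovation by the bias corrections,
    which are summable. *)
Lemma drift_windows j delta : 0 < delta ->
  window_sum (al := al) (be := be) (eps := eps) (clipped X N j) path ga_unb delta i
    (fun x => f (clip N x) 0 j) u @[i --> \oo] --> 0 ->
  \sum_(grid ga_unb delta i.+1 <= k < grid ga_unb delta i.+2) drift_error j k
    @[i --> \oo] --> 0.
Proof.
move=> delta0 hW; pose G := grid ga_unb delta.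
have be0 := ltW (be_gt0 hbe).
have be1 : be < 1 by case/andP: hbe.
have C0 := ltW (wbound_gt0 al01 hbe).
pose D := ga 0%N * C / (1 - be).
have D0 : 0 <= D.
  apply: divr_ge0; last exact: ltW (onem_be_gt0 hbe).
  by apply: mulr_ge0 => //; exact: ltW.
pose W i := window_sum (al := al) (be := be) (eps := eps) (clipped X N j) path
  ga_unb delta i (fun x => f (clip N x) 0 j) u.
pose err i := \sum_(G i.+1 <= k < G i.+2) drift_error j k - W i.
have err_le i : `|err i| <= D * be ^+ i.
  rewrite /err /W /window_sum -/G -sumrB (le_trans (ler_norm_sum _ _ _))//.
  apply: (@le_trans _ _ (\sum_(G i.+1 <= k < G i.+2) ga 0%N * C * be ^+ k)).
    apply: ler_sum => k _; rewrite clip_id// full_dir_clipped /drift_error.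
    set w := full_dir _ _ _ _ _ _ _.
    rewrite (_ : _ - _ - _ - _ = path k.+1 u 0 j - path k u 0 j - ga k * w); last by ring.
    rewrite (le_trans (adam_increment X vartheta al01 hbe eps0 ga_gt0 k u j))// -mulrA.
    apply: ler_pM; [exact: ltW|by apply: mulr_ge0 => //; exact: exprn_ge0| |].
      exact: (ga_le ga_decr).
    by rewrite ler_wpM2l// exprS ler_piMl ?exprn_ge0// ltW.
  rewrite -mulr_sumr /D -[leRHS]mulrA; apply: ler_wpM2l.
    by apply: mulr_ge0 => //; exact: ltW.
  rewrite -{1}(add0n (G i.+1)) big_addn big_mkord.
  under eq_bigr do rewrite exprD mulrC.
  rewrite -mulr_sumr mulrC; apply: ler_pM.
  - by apply: sumr_ge0 => k _; exact: exprn_ge0.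
  - exact: exprn_ge0.
  - by apply: geom_sum_le; rewrite be0 be1.
  apply: ler_wiXn2l => //; first exact: ltW.
  exact: leq_trans (leqnSn i) (grid_ge ga_gt0 ga_unb delta0 i.+1).
have err0 : err i @[i --> \oo] --> 0.
  apply: (@squeeze_cvgr _ _ _ _ (fun i => - (D * be ^+ i)) (fun i => D * be ^+ i)).
  - by near=> i; rewrite -ler_norml.
  - rewrite -oppr0 -(mulr0 D); apply: cvgN; apply: cvgMr.
    by apply: cvg_expr; rewrite ger0_norm.
  - rewrite -(mulr0 D); apply: cvgMr.
    by apply: cvg_expr; rewrite ger0_norm.
rewrite (_ : (fun i => _) = fun i => err i + W i); last first.
  by apply/funext => i; rewrite /err subrK.
by have h := cvgD err0 hW; rewrite addr0 in h; exact: h.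
Unshelve. all: by end_near.
Qed.

Lemma drift_error_le j k : (forall x j, `|f x 0 j| <= C) ->
  `|drift_error j k| <= 3 * C * ga k.
Proof.
move=> f_le; have ga0 := ltW (ga_gt0 k).
rewrite /drift_error (le_trans (ler_normB _ _))//.
rewrite (_ : 3 * C * ga k = 2 * C * ga k + ga k * C); last by ring.
apply: lerD.
  apply: le_trans (adam_path_step X vartheta al01 hbe eps0 ga_gt0 k u).
  by have := coord_le_norm (path k.+1 u - path k u) j; rewrite [X in `|X|]mxE [X in _ + X]mxE.
by rewrite normrM ger0_norm// ler_wpM2l.
Qed.

End drift.

(** * The theorem *)

Lemma series_partial_sum (R : realType) (g : nat -> R) n :
  (\sum_(1 <= k < n.+1) (g k)%:E = (\sum_(k < n) g k.+1)%:E)%E.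
Proof. by rewrite big_add1 /= big_mkord sumEFin. Qed.

Lemma nonsummable_unbounded (R : realType) (g : nat -> R) :
  (forall n, (0 < n)%N -> 0 <= g n) -> (\sum_(1 <= n <oo) (g n)%:E = +oo)%E ->
  forall M, exists n, M <= \sum_(k < n) g k.+1.
Proof.
move=> g0 hoo M; apply: contrapT => /forallNP h.
have : (\sum_(1 <= n <oo) (g n)%:E <= M%:E)%E.
  apply: lime_le.
    by apply: is_cvg_nneseries => n n1 _; rewrite lee_fin g0.
  near=> n.
  have n0 : (0 < n)%N by near: n; exact: nbhs_infty_gt.
  rewrite -(prednK n0) series_partial_sum lee_fin leNgt.
  by apply/negP => /ltW; exact: h.
by rewrite hoo leNgt ltry.
Unshelve. all: by end_near.
Qed.

Lemma summable_bounded (R : realType) (g : nat -> R) :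
  (forall n, (0 < n)%N -> 0 <= g n) -> (\sum_(1 <= n <oo) (g n)%:E < +oo)%E ->
  exists B, forall n, \sum_(k < n) g k.+1 <= B.
Proof.
move=> g0 hlt; set s := (X in (X < _)%E) in hlt.
have ge n : ((\sum_(k < n) g k.+1)%:E <= s)%E.
  rewrite -series_partial_sum; apply: nneseries_lim_ge => k k1 _.
  by rewrite lee_fin g0.
have s_fin : s \is a fin_num.
  rewrite ge0_fin_numE//; apply: le_trans (ge 0%N).
  by rewrite big_ord0.
by exists (fine s) => n; rewrite -lee_fin fineK.
Qed.

Theorem corollary1p9 (R : realType) (eps alpha beta p : R)
  (heps : 0 < eps) (halpha : 0 <= alpha < 1)
  (hbeta : alpha ^+ 2 < beta < 1) (hp : 2 <= p)
  (gamma : nat -> R)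
  (gamma_gt0 : forall n, (0 < n)%N -> 0 < gamma n)
  (gamma_nonsummable : (\sum_(1 <= n <oo) (gamma n)%:E = +oo)%E)
  (gamma_decr : forall n, (0 < n)%N -> gamma n.+1 <= gamma n)
  (gamma_cvg0 : gamma @ \oo --> 0)
  (gamma_liminf :
     (0 < ereal_sup [set limn_einf (fun n =>
        ((gamma n)^-1 * gamma (n + `|Num.ceil ((gamma n)^-1 * e)|)%N)%R%:E)
        | e in [set e : R | (0 < e)%R]])%E)
  (gamma_summable : (\sum_(1 <= n <oo) (gamma n `^ (1 + p / 3))%:E < +oo)%E)
  (d : nat) (hd : (0 < d)%N) (vartheta : 'rV[R]_d)
  (dO : measure_display) (Omega : measurableType dO) (P : probability Omega R)
  (dU : measure_display) (UU : measurableType dU)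
  (X : UU -> 'rV[R]_d -> 'rV[R]_d) (U : {RV P >-> UU})
  (hX : product_measurable X) (hXU : locally_regular U X p)
  (dO' : measure_display) (Omega' : measurableType dO')
  (P' : probability Omega' R)
  (theta : nat -> Omega' -> 'rV[R]_d)
  (htheta : adam_process U X gamma alpha beta eps vartheta P' theta)
  (f : 'rV[R]_d -> 'rV[R]_d)
  (hf : adam_vector_field U X alpha beta eps f)
  (Psi : R -> 'rV[R]_d -> 'rV[R]_d) (hPsi : semiflow_of f Psi)
  (thetabar : R -> Omega' -> 'rV[R]_d)
  (hthetabar : forall w, linear_interpolation (training_time gamma)
     (theta ^~ w) (thetabar ^~ w)) :
  {ae P', forall w,
    (limn_esup (fun n => (eucl_norm (theta n w))%:E) < +oo)%E ->
    asymptotic_pseudotrajectory Psi (thetabar ^~ w)}.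
Proof.
have [V [m [v [iidV hrec]]]] := htheta.
have iV := iid_copies_iidseq iidV.
pose ga k := gamma k.+1.
have ga_gt0 k : 0 < ga k by exact: gamma_gt0.
have ga_decr k : ga k.+1 <= ga k by exact: gamma_decr.
have ga_cvg0 : ga @ \oo --> 0 by rewrite (cvg_shiftS gamma).
have ga_unb : forall M, exists n, M <= ttime ga n.
  by apply: nonsummable_unbounded => // n n0; exact/ltW/gamma_gt0.
have [B ga_sum] : exists B, forall n, \sum_(k < n) ga k `^ (1 + p / 3) <= B.
  apply: (summable_bounded (g := fun k => gamma k `^ (1 + p / 3))) => // n _.
  exact: powR_ge0.
have tE n : training_time gamma n = ttime ga n.
  by rewrite /training_time /ttime big_add1 /= big_mkord.
pose path := adam_path X gamma alpha beta eps vartheta.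
pose u w k := V k.+1 w.
have pathE n w : theta n w = path n (u w).
  have [h0 m0 v0 hS] := hrec w.
  by rewrite /path /adam_path (adam_stateP (u := u w) h0 m0 v0 hS).
have mth n : measurable_fun setT (path n : seqspace UU -> borel_rV R d).
  by have [] := measurable_adam_state gamma alpha beta vartheta heps hX n.
have pth n : past_dep n (path n).
  by move=> x x' hx; rewrite /path /adam_path (adam_state_ext _ _ _ _ _ _ hx).
pose C := wbound alpha beta.
have C0 : 0 <= C by exact: ltW (wbound_gt0 halpha hbeta).
have Cs0 : 0 <= 2 * C by exact: mulr_ge0.
have path_step n x : `|path n.+1 x - path n x| <= 2 * C * ga n.
  exact: (adam_path_step X vartheta halpha hbeta heps ga_gt0 n x).
have f_le x j : `|f x 0 j| <= C.
  exact: (vector_field_le halpha hbeta heps hp hX hXU hf).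
have windows N l (j : 'I_d) : {ae P', forall w,
    window_sum (al := alpha) (be := beta) (eps := eps) (clipped X N%:R j) path
      ga_unb l.+1%:R^-1 i (fun x => f (clip N%:R x) 0 j) (u w) @[i --> \oo] --> 0}.
  have [K K0 /(_ j)[hK hL]] := clipped_moments hp hX hXU (ler0n R N).
  have d0 : 0 < l.+1%:R^-1 :> R by rewrite invr_gt0.
  have hF x : meanfield alpha beta eps (clipped X N%:R j) P' (fun k => V k.+1) n x
      @[n --> \oo] --> f (clip N%:R x) 0 j.
    exact: (meanfield_vector_field halpha hbeta heps hp hX hXU hf).
  have := window_sums_cvg0 halpha hbeta heps hp K0 (measurable_clipped hX N%:R j)
    hK hL iV mth pth ga_gt0 ga_decr ga_unb Cs0 path_step d0 ga_sum ga_cvg0 hF.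
  exact.
have : {ae P', forall w N l j,
    window_sum (al := alpha) (be := beta) (eps := eps) (clipped X N%:R j) path
      ga_unb l.+1%:R^-1 i (fun x => f (clip N%:R x) 0 j) (u w) @[i --> \oo] --> 0}.
  by apply: ae_foralln => N; apply: ae_foralln => l; exact: filter_forall.
apply: filterS => w hw /limsup_bounded[N hN].
have path_le n : `|path n (u w)| <= N%:R by rewrite -pathE.
have hy : linear_interpolation (ttime ga) (fun n => path n (u w)) (thetabar ^~ w).
  have [h1 h2] := hthetabar w; split=> [n|n s].
    by rewrite -tE h1 pathE.
  by rewrite -!tE -!pathE; exact: h2.
apply: (tracking_pseudotrajectory hPsi Cs0 _ _ ga_gt0 ga_decr ga_unb ga_cvg0 hy _ path_le).
- by move=> x j; rewrite (le_trans (f_le x j))// mulr_natl mulr2n lerDl.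
- exact: (vector_field_lip halpha hbeta heps hp hX hXU hf).
- by move=> n; exact: path_step.
move=> T e j T0 e0.
have C30 : 0 <= 3 * C by exact: mulr_ge0.
apply: (small_sums (a := drift_error X gamma alpha beta eps vartheta f (u w) j) ga_gt0 ga_decr ga_cvg0 C30 _ _ T0 e0).
  by move=> k; exact: (drift_error_le X vartheta halpha hbeta heps ga_gt0 (u w) j k f_le).
move=> l; apply: (drift_windows halpha hbeta heps ga_gt0 ga_decr path_le).
  by rewrite invr_gt0.
exact: hw.
Qed.
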